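(* Let $n\in\mathbb{N}$, let $X\subset\mathbb{R}$ be an (open, half-open or closed) interval of finite length, according to the function space below, and let $N\in\mathbb{N}$ with $N>1$. Let $L_1,\dots,L_N:X\to X$ be nontrivial injective contractions such that $L_i(X)\cap L_j(X)=\emptyset$ for $i\ne j$ and $X=\bigcup_{i=1}^N L_i(X)$. Let $\mathcal{F}(X)$ be any one of the real Banach function spaces $C^k(X)$, $C^{k,\alpha}(X)$, $L^p(X)$, $W^{s,p}(X)$, $B^s_{p,q}(X)$, $F^s_{p,q}(X)$ (with the parameter ranges given in the context). For each $i\in\{1,\dots,N\}$ let $q_i\in\mathcal{F}(X)$ and let $s_i:X\to\mathbb{R}$ be bounded and such that $s_i f\in\mathcal{F}(X)$ for all $f\in\mathcal{F}(X)$. Let $T:\mathcal{F}(X)\to\mathcal{F}(X)$ be the RB operator given by $$Tf := q_i\circ L_i^{-1} + (s_i\circ L_i^{-1})\cdot (f\circ L_i^{-1})\quad\text{on } L_i(X),\qquad i=1,\dots,N,$$ and on the space $\mathcal{F}(X,\mathbb{R}_n)=\mathcal{F}(X)\otimes_{\mathbb{R}}\mathbb{R}_n$ define an RB operator $\widetilde{T}:\mathcal{F}(X,\mathbb{R}_n)\to\mathcal{F}(X,\mathbb{R}_n)$ by $$\widetilde{T}f := \sum_{A\subseteq\{1,\dots,n\}} T(f_A)\,e_A,\qquad f=\sum_{A\subseteq\{1,\dots,n\}} f_A e_A .$$ If $T:\mathcal{F}(X)\to\mathcal{F}(X)$ is contractive on $\mathcal{F}(X)$ with Lipschitz constant $\gamma_{\mathcal{F}(X)}$,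 then $\widetilde{T}$ is also contractive on $\mathcal{F}(X,\mathbb{R}_n)$ with the same Lipschitz constant. Furthermore, the unique fixed point $\psi\in\mathcal{F}(X,\mathbb{R}_n)$ of $\widetilde{T}$ satisfies the Clifford-valued self-referential equation $$\psi(L_i(x)) = q_i(x) + s_i(x)\,\psi(x),\qquad x\in X,\ i\in\{1,\dots,N\}.$$
   Context: Clifford algebra: $\mathbb{R}_n$ is the real associative unital algebra generated by the canonical basis $e_1,\dots,e_n$ of $\mathbb{R}^n$ subject to $e_ie_j+e_je_i=-2\delta_{ij}$. As a real vector space it has dimension $2^n$ with basis $\{e_A: A\subseteq\{1,\dots,n\}\}$, where $e_A:=e_{i_1}e_{i_2}\cdots e_{i_m}$ for $A=\{i_1<\dots<i_m\}$ and $e_\emptyset:=1$. Function spaces of real-valued functions on $X$, each a Banach space with its usual norm $\|\cdot\|_{\mathcal{F}(X)}$: $C^k(X)$, $k\in\mathbb{N}_0$ ($k$-times continuously differentiable functions); $C^{k,\alpha}(X)$, $k\in\mathbb{N}_0$, $0<\alpha\le1$ ($k$-times continuously differentiable functions whose $k$-th derivative is Hölder continuous with exponent $\alpha$); Lebesgue spaces $L^p(X)$, $1\le p<\infty$; Sobolev–Slobodeckij spaces $W^{s,p}(X)$, $s\in\mathbb{N}$ or $s>0$, $1\le p<\infty$; Besov spaces $B^s_{p,q}(X)$ and Triebel–Lizorkin spaces $F^s_{p,q}(X)$, $1\le p,q<\infty$, $s>0$. Clifford-valued functions: $\mathcal{F}(X,\mathbb{R}_n):=\mathcal{F}(X)\otimes_{\mathbb{R}}\mathbb{R}_n$.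 Its elements are exactly the functions $f=\sum_{A\subseteq\{1,\dots,n\}}f_Ae_A$ with all $f_A\in\mathcal{F}(X)$, and it is a Banach space with the norm $$\|f\|:=\Big(\sum_{A\subseteq\{1,\dots,n\}}\|f_A\|_{\mathcal{F}(X)}^2\Big)^{1/2}.$$ RB operator stands for Read–Bajraktarević operator. $T$ is contractive on $\mathcal{F}(X)$ with Lipschitz constant $\gamma_{\mathcal{F}(X)}\in[0,1)$ if $\|Tf-Tg\|_{\mathcal{F}(X)}\le\gamma_{\mathcal{F}(X)}\|f-g\|_{\mathcal{F}(X)}$ for all $f,g\in\mathcal{F}(X)$; likewise for $\widetilde{T}$ with the norm of $\mathcal{F}(X,\mathbb{R}_n)$. That $T$ maps $\mathcal{F}(X)$ into $\mathcal{F}(X)$ is part of the hypotheses.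
   Formalization: In the self-referential equation, q_i(x) is replaced by the sum over A of q_i(x)e_A, since as a scalar it fails in components other than the empty set; for L^p, W, B and F the equation holds almost everywhere for a suitable representative of the fixed point. *)

(* Defs.v *)
From HB Require Import structures.
From mathcomp Require Import all_boot all_order all_algebra.

Set Implicit Arguments.
Unset Strict Implicit.
Unset Printing Implicit Defensive.

Import Order.TTheory GRing.Theory Num.Theory.

Local Open Scope ring_scope.

(* The Clifford algebra is realised on its basis: [x A] is the coordinate of
   [x] along e_A, and e_A * e_B = csign A B * e_(A symdiff B), where [csign]
   collects one sign for each transposition (j < i) and one for each square
   (j = i, since e_i * e_i = -1).  [clifford_relation], [blade_basis] and
   [clifford_expand] check that this is the algebra with the defining relations,
   with the ordered products e_A as a basis. *)
Definition clifford (R : comNzRingType) (n : nat) : Type :=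
  {ffun {set 'I_n} -> R}.

Section Clifford.
Context {R : comNzRingType} {n : nat}.
Implicit Types (A B C : {set 'I_n}) (i j : 'I_n).

Local Notation Cl := (clifford R n).

HB.instance Definition _ := GRing.Lmodule.copy Cl {ffun {set 'I_n} -> R^o}.

Definition symdiff A B : {set 'I_n} := (A :\: B) :|: (B :\: A).

Definition csign A B : R :=
  \prod_(i in A) \prod_(j in B | (j <= i)%N) (-1).

Definition cbasis A : Cl := [ffun B => (B == A)%:R].

Definition cmul (x y : Cl) : Cl :=
  \sum_A \sum_B (x A * y B * csign A B) *: cbasis (symdiff A B).

Lemma in_symdiff A B i : (i \in symdiff A B) = (i \in A) (+) (i \in B).
Proof. by rewrite !inE; case: (i \in A); case: (i \in B). Qed.

Lemma symdiffA A B C : symdiff A (symdiff B C) = symdiff (symdiff A B) C.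
Proof. by apply/setP => i; rewrite !in_symdiff addbA. Qed.

Lemma symdiff0 A : symdiff A set0 = A.
Proof. by apply/setP => i; rewrite in_symdiff inE addbF. Qed.

Lemma sym0diff A : symdiff set0 A = A.
Proof. by apply/setP => i; rewrite in_symdiff inE addFb. Qed.

Lemma prod_symdiff (P : pred 'I_n) (F : 'I_n -> R) A B :
    (forall i, F i * F i = 1) ->
  \prod_(i in symdiff A B | P i) F i =
  (\prod_(i in A | P i) F i) * \prod_(i in B | P i) F i.
Proof.
move=> FF; rewrite big_mkcond [in RHS]big_mkcond [X in _ * X]big_mkcond /=.
rewrite -big_split; apply: eq_bigr => i _ /=; rewrite in_symdiff.
by case: (i \in A); case: (i \in B); case: (P i); rewrite //= ?mulr1 ?mul1r ?FF.
Qed.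

Lemma csignDr A B C : csign A (symdiff B C) = csign A B * csign A C.
Proof.
rewrite /csign -big_split /=; apply: eq_bigr => i _.
by apply: (prod_symdiff (fun j => (j <= i)%N)) => _; rewrite mulrNN mulr1.
Qed.

Lemma csignDl A B C : csign (symdiff A B) C = csign A C * csign B C.
Proof.
pose F i : R := \prod_(j in C | (j <= i)%N) (-1).
have FF i : F i * F i = 1.
  by rewrite /F -big_split big1// => j _; rewrite /= mulrNN mulr1.
have := prod_symdiff xpredT A B FF.
rewrite (eq_bigl (mem (symdiff A B))) => [|i]; last by rewrite andbT.
rewrite [in RHS](eq_bigl (mem A)) => [|i]; last by rewrite andbT.
by rewrite [X in _ * X](eq_bigl (mem B)) => // i; rewrite andbT.
Qed.

Lemma csign0 A : csign A set0 = 1.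
Proof. by rewrite /csign big1// => i _; rewrite big1// => j; rewrite inE. Qed.

Lemma c0sign A : csign set0 A = 1.
Proof. by rewrite /csign big1// => j; rewrite inE. Qed.

Lemma cscaleE (k : R) (x : Cl) A : (k *: x) A = k * x A.
Proof. exact: ffunE. Qed.

Lemma cbasis_expand (x : Cl) : x = \sum_A x A *: cbasis A.
Proof.
apply/ffunP => B; rewrite sum_ffunE (bigD1 B)//= cscaleE ffunE eqxx mulr1.
by rewrite big1 ?addr0// => A /negPf AB; rewrite cscaleE ffunE eq_sym AB mulr0.
Qed.

Lemma cmulE A B : cmul (cbasis A) (cbasis B) = csign A B *: cbasis (symdiff A B).
Proof.
rewrite /cmul (bigD1 A)//= [X in _ + X]big1 ?addr0; last first.
  by move=> C /negPf CA; rewrite big1// => D _; rewrite ffunE CA !mul0r scale0r.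
rewrite (bigD1 B)//= big1 ?addr0 ?ffunE ?eqxx ?mul1r//.
by move=> D /negPf DB; rewrite !ffunE DB mulr0 mul0r scale0r.
Qed.

Lemma cmulDl : left_distributive cmul +%R.
Proof.
move=> x y z; rewrite /cmul -big_split; apply: eq_bigr => A _.
rewrite -big_split; apply: eq_bigr => B _ /=.
by rewrite ffunE !mulrDl scalerDl.
Qed.

Lemma cmulDr : right_distributive cmul +%R.
Proof.
move=> x y z; rewrite /cmul -big_split; apply: eq_bigr => A _.
rewrite -big_split; apply: eq_bigr => B _ /=.
by rewrite ffunE mulrDr mulrDl scalerDl.
Qed.

Lemma cmulZl (k : R) x y : cmul (k *: x) y = k *: cmul x y.
Proof.
rewrite /cmul scaler_sumr; apply: eq_bigr => A _.
rewrite scaler_sumr; apply: eq_bigr => B _.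
by rewrite cscaleE scalerA !mulrA.
Qed.

Lemma cmulZr (k : R) x y : cmul x (k *: y) = k *: cmul x y.
Proof.
rewrite /cmul scaler_sumr; apply: eq_bigr => A _.
rewrite scaler_sumr; apply: eq_bigr => B _.
by rewrite cscaleE scalerA mulrCA !mulrA.
Qed.

Lemma cmul0l x : cmul 0 x = 0.
Proof. by have := cmulZl 0 0 x; rewrite !scale0r. Qed.

Lemma cmul0r x : cmul x 0 = 0.
Proof. by have := cmulZr 0 x 0; rewrite !scale0r. Qed.

Lemma cmul_suml (I : finType) (F : I -> Cl) y :
  cmul (\sum_i F i) y = \sum_i cmul (F i) y.
Proof.
by apply: (big_morph (cmul^~ y)) => [u v|]; rewrite ?cmulDl ?cmul0l.
Qed.

Lemma cmul_sumr (I : finType) (F : I -> Cl) x :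
  cmul x (\sum_i F i) = \sum_i cmul x (F i).
Proof.
by apply: (big_morph (cmul x)) => [u v|]; rewrite ?cmulDr ?cmul0r.
Qed.

Lemma cmulA : associative cmul.
Proof.
move=> x y z; rewrite (cbasis_expand x).
rewrite (cmul_suml _ y) (cmul_suml _ z) (cmul_suml _ (cmul y z)).
apply: eq_bigr => A _; rewrite !cmulZl; congr (_ *: _).
rewrite (cbasis_expand y) (cmul_suml _ z) !(cmul_sumr _ (cbasis A)).
rewrite (cmul_suml _ z); apply: eq_bigr => B _.
rewrite !(cmulZl, cmulZr); congr (_ *: _).
rewrite (cbasis_expand z) (cmul_sumr _ (cbasis B)).
rewrite (cmul_sumr _ (cbasis A)) (cmul_sumr _ (cmul _ _)).
apply: eq_bigr => C _; rewrite !cmulZr; congr (_ *: _).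
rewrite !cmulE cmulZr cmulZl !cmulE !scalerA symdiffA csignDr csignDl.
by rewrite mulrC mulrA.
Qed.

Lemma cmul1l : left_id (cbasis set0) cmul.
Proof.
move=> x; rewrite {1}(cbasis_expand x) cmul_sumr [RHS]cbasis_expand.
by apply: eq_bigr => A _; rewrite cmulZr cmulE c0sign sym0diff scale1r.
Qed.

Lemma cmul1r : right_id (cbasis set0) cmul.
Proof.
move=> x; rewrite {1}(cbasis_expand x) cmul_suml [RHS]cbasis_expand.
by apply: eq_bigr => A _; rewrite cmulZl cmulE csign0 symdiff0 scale1r.
Qed.

Lemma cone_neq0 : cbasis set0 != 0.
Proof.
apply/eqP => /ffunP/(_ set0); rewrite !ffunE eqxx => /eqP.
by rewrite oner_eq0.
Qed.

HB.instance Definition _ := GRing.Zmodule_isNzRing.Build Cl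
  cmulA cmul1l cmul1r cmulDl cmulDr cone_neq0.

HB.instance Definition _ := GRing.Lmodule_isLalgebra.Build R Cl
  (fun k x y => esym (cmulZl k x y)).

HB.instance Definition _ := GRing.Lalgebra_isAlgebra.Build R Cl
  (fun k x y => esym (cmulZr k x y)).

Definition cgen i : Cl := cbasis [set i].

(* [\prod] runs through 'I_n in increasing order: this is
   e_A = e_(i_1) * ... * e_(i_m) for A = {i_1 < ... < i_m}. *)
Definition blade A : Cl := \prod_(i in A) cgen i.

Lemma csign11 i j : csign [set i] [set j] = if (j <= i)%N then -1 else 1.
Proof.
rewrite /csign big_set1; case: ifP => ji.
  by rewrite (big_pred1 j)// => k; rewrite /= inE; case: eqP => [->|].
by rewrite big1// => k; rewrite inE => /andP[/eqP->]; rewrite ji.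
Qed.

Lemma clifford_relation i j :
  cgen i * cgen j + cgen j * cgen i = (- 2 * (i == j)%:R)%:A.
Proof.
rewrite [cgen i * _]cmulE [cgen j * _]cmulE !csign11.
have [<-|ij] := eqVneq i j.
  rewrite leqnn -scalerDl -opprD mulr1.
  suff -> : symdiff [set i] [set i] = set0 by [].
  by apply/setP => k; rewrite in_symdiff addbb inE.
have -> : symdiff [set j] [set i] = symdiff [set i] [set j].
  by apply/setP => k; rewrite !in_symdiff addbC.
rewrite mulr0 scale0r -scalerDl.
case: ltngtP => [|_|/val_inj ji]; rewrite ?addNr ?addrN ?scale0r//.
by rewrite ji eqxx in ij.
Qed.

Lemma blade_basis A : blade A = cbasis A.
Proof.
rewrite /blade; pose r := index_enum 'I_n.
suff H (s : seq 'I_n) : sorted (fun i j : 'I_n => (i < j)%N) s ->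
    \prod_(i <- s | i \in A) cgen i = cbasis [set i in A | i \in s].
  rewrite H; last first.
    have := iota_ltn_sorted 0 n; rewrite -val_enum_ord sorted_map enumT.
    by rewrite /r /index_enum unlock.
  by congr cbasis; apply/setP => i; rewrite !inE mem_index_enum andbT.
elim: s => [_|i s IH si].
  by rewrite big_nil; congr cbasis; apply/setP => j; rewrite !inE andbF.
have lt_is : all (fun j : 'I_n => (i < j)%N) s.
  by apply: order_path_min si => x y z; exact: ltn_trans.
rewrite big_cons IH; last exact: path_sorted si.
case: ifPn => iA; last first.
  congr cbasis; apply/setP => j; rewrite !inE.
  by case: eqP => [->|]//; rewrite (negbTE iA).
have -> : [set j in A | j \in i :: s] = symdiff [set i] [set j in A | j \in s].
  apply/setP => j; rewrite in_symdiff !inE.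
  case: eqP => [->|]//=; rewrite iA/=; apply/esym/negP.
  by move/(allP lt_is); rewrite ltnn.
rewrite [LHS]cmulE [csign _ _](_ : _ = 1) ?scale1r//.
rewrite /csign big_set1 big1// => j; rewrite !inE => /andP[/andP[_ js]].
by rewrite leqNgt (allP lt_is _ js).
Qed.

Lemma clifford_expand (x : Cl) : x = \sum_A x A *: blade A.
Proof.
by rewrite [LHS]cbasis_expand; apply: eq_bigr => A _; rewrite blade_basis.
Qed.

End Clifford.

From mathcomp Require Import all_classical all_reals all_analysis.

Import numFieldNormedType.Exports.

Local Open Scope classical_set_scope.
Local Open Scope ring_scope.

(* Functions on X are represented by total functions R -> R; nothing below
   depends on their values outside X. *)
Section FunctionSpaces.
Context {R : realType}.
Local Notation mu := (@lebesgue_measure R).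
Implicit Types (X : set R) (f g : R -> R).

(* Derivative relative to X: one-sided at an endpoint belonging to X. *)
Definition difference_quotient f (x y : R) : R := (f y - f x) / (y - x).

Definition derivable_on X f :=
  forall x, X x -> cvg (difference_quotient f x y @[y --> within X x^']).

Definition derive_on X f : R -> R :=
  fun x => lim (difference_quotient f x y @[y --> within X x^']).

Definition derive_on_n X (k : nat) f : R -> R := iter k (derive_on X) f.

Definition continuously_differentiable X (k : nat) f :=
  (forall j, (j < k)%N -> derivable_on X (derive_on_n X j f)) /\
  {within X, continuous (derive_on_n X k f)}.

Local Open Scope ereal_scope.

Definition sup_norm X f : \bar R := ereal_sup [set `|f x|%:E | x in X].

Definition Ck_norm X (k : nat) f : \bar R :=
  \sum_(j < k.+1) sup_norm X (derive_on_n X j f).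

Definition holder_seminorm X (alpha : R) f : \bar R :=
  ereal_sup [set (`|f z.1 - f z.2| / `|z.1 - z.2| `^ alpha)%:E
            | z in [set z : R * R | [/\ X z.1, X z.2 & z.1 != z.2]]].

Definition holder_norm X (k : nat) (alpha : R) f : \bar R :=
  Ck_norm X k f + holder_seminorm X alpha (derive_on_n X k f).

Definition Lp_norm X (p : R) f : \bar R := 'N[mu]_p%:E[(EFin \o f) \_ X].

Definition in_Lp X (p : R) f := measurable_fun X f /\ Lp_norm X p f < +oo.

Definition test_function X (phi : R -> R) :=
  (forall j x, derivable (derive1n j phi) x 1) /\
  exists c d : R, `[c, d] `<=` X° /\ forall x, ~ `[c, d]%classic x -> phi x = 0%R.

Definition weak_derivative X (j : nat) f g :=
  forall phi, test_function X phi ->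
    (\int[mu]_(x in X) (f x * (derive1n j phi) x) =
     (-1) ^+ j * \int[mu]_(x in X) (g x * phi x))%R.

(* A chosen representative of the j-th weak derivative of f. *)
Definition weak_derive X (p : R) (j : nat) f : R -> R :=
  xget (fun=> 0%R) [set g | in_Lp X p g /\ weak_derivative X j f g].

Definition gagliardo X (sigma p : R) f : \bar R :=
  \int[mu]_(x in X) \int[mu]_(y in X)
    (`|f x - f y| `^ p / `|x - y| `^ (1 + sigma * p))%:E.

(* s = m + sigma with m natural and 0 <= sigma < 1; the Gagliardo term is
   present only when s is not an integer. *)
Definition sobolev_norm X (s p : R) f : \bar R :=
  let m := Num.truncn s in
  let sigma := (s - m%:R)%R in
  (\sum_(j < m.+1) Lp_norm X p (weak_derive X p j f) `^ p
   + (if sigma == 0%R then 0 else gagliardo X sigma p (weak_derive X p m f)))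
  `^ p^-1.

Definition in_sobolev X (s p : R) f :=
  [/\ in_Lp X p f,
      forall j, (j <= Num.truncn s)%N ->
        exists g, in_Lp X p g /\ weak_derivative X j f g &
      sobolev_norm X s p f < +oo].

(* M-th order difference with step h, set to 0 unless the whole segment from
   x to x + M h lies in the interval X. *)
Definition finite_difference X (M : nat) (h : R) f (x : R) : R :=
  if (x \in X) && ((x + M%:R * h)%R \in X)
  then (\sum_(j < M.+1) (-1) ^+ (M - j) * 'C(M, j)%:R * f (x + j%:R * h))%R
  else 0%R.

Definition modulus_of_smoothness X (M : nat) (p : R) f (t : R) : \bar R :=
  ereal_sup [set Lp_norm X p (finite_difference X M h f)
            | h in [set h : R | (`|h| <= t)%R]].

(* Intrinsic norms by differences of order M = floor s + 1 > s. *)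
Definition besov_norm X (s p q : R) f : \bar R :=
  let M := (Num.truncn s).+1 in
  Lp_norm X p f
  + (\int[mu]_(t in `]0%R, 1%R[%classic)
       (((t `^ (- s))%:E * modulus_of_smoothness X M p f t) `^ q * (t^-1)%:E))
    `^ q^-1.

Definition triebel_lizorkin_norm X (s p q : R) f : \bar R :=
  let M := (Num.truncn s).+1 in
  let ball_mean (t x : R) := (t^-1)%:E *
    \int[mu]_(h in `](- t)%R, t[%classic) `|finite_difference X M h f x|%:E in
  let area_fun (x : R) :=
    (\int[mu]_(t in `]0%R, 1%R[%classic)
       (((t `^ (- s))%:E * ball_mean t x) `^ q * (t^-1)%:E)) `^ q^-1 in
  Lp_norm X p f + 'N[mu]_p%:E[area_fun \_ X].

Local Close Scope ereal_scope.

End FunctionSpaces.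

Inductive function_space (R : realType) :=
  | Ck of nat
  | Holder of nat & R
  | Lebesgue of R
  | SobolevSlobodeckij of R & R
  | Besov of R & R & R
  | TriebelLizorkin of R & R & R.

Section Spaces.
Context {R : realType}.
Implicit Types (X : set R) (F : function_space R).

Definition admissible F : Prop :=
  match F with
  | Ck _ => True
  | Holder _ alpha => 0 < alpha <= 1
  | Lebesgue p => 1 <= p
  | SobolevSlobodeckij s p => 0 < s /\ 1 <= p
  | Besov s p q | TriebelLizorkin s p q => [/\ 0 < s, 1 <= p & 1 <= q]
  end.

Definition space_enorm X F (f : R -> R) : \bar R :=
  match F with
  | Ck k => Ck_norm X k f
  | Holder k alpha => holder_norm X k alpha f
  | Lebesgue p => Lp_norm X p f
  | SobolevSlobodeckij s p => sobolev_norm X s p f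
  | Besov s p q => besov_norm X s p q f
  | TriebelLizorkin s p q => triebel_lizorkin_norm X s p q f
  end.

Definition space_norm X F (f : R -> R) : R := fine (space_enorm X F f).

(* On a non-closed X, finiteness of the norm of C^k(X) asks for bounded
   derivatives. *)
Definition in_space X F (f : R -> R) : Prop :=
  match F with
  | Ck k | Holder k _ => continuously_differentiable X k f
  | Lebesgue p | Besov _ p _ | TriebelLizorkin _ p _ => in_Lp X p f
  | SobolevSlobodeckij s p => in_sobolev X s p f
  end /\ (space_enorm X F f < +oo)%E.

(* "For x in X" in the sense of the space: everywhere for spaces of continuous
   functions, almost everywhere for spaces of classes of functions. *)
Definition for_space X F (P : R -> Prop) : Prop :=
  match F with
  | Ck _ | Holder _ _ => forall x, X x -> P x
  | _ => {ae (@lebesgue_measure R), forall x, X x -> P x}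
  end.

Definition eq_space (V : Type) X F (f g : R -> V) : Prop :=
  for_space X F (fun x => f x = g x).

Definition ccoord n (f : R -> clifford R n) (A : {set 'I_n}) : R -> R :=
  fun x => f x A.

Definition in_cspace n X F (f : R -> clifford R n) : Prop :=
  forall A, in_space X F (ccoord f A).

Definition cspace_norm n X F (f : R -> clifford R n) : R :=
  Num.sqrt (\sum_(A : {set 'I_n}) space_norm X F (ccoord f A) ^+ 2).

Definition contractive_on (V : zmodType) (mem : (R -> V) -> Prop)
    (nrm : (R -> V) -> R) (T : (R -> V) -> R -> V) (gamma : R) : Prop :=
  0 <= gamma < 1 /\
  forall f g, mem f -> mem g -> nrm (T f \- T g) <= gamma * nrm (f \- g).

(* At most one summand is present when the sets L_i(X) are disjoint: on L_i(X)
   this is q_i o L_i^-1 + (s_i o L_i^-1) * (f o L_i^-1). *)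
Definition RB_operator (N : nat) X (L q s : 'I_N -> R -> R) (f : R -> R) : R -> R :=
  fun y => \sum_(i < N | y \in L i @` X)
    let x := pinv X (L i) y in q i x + s i x * f x.

Definition clifford_operator n (T : (R -> R) -> R -> R)
    (f : R -> clifford R n) : R -> clifford R n :=
  fun x => \sum_(A : {set 'I_n}) T (ccoord f A) x *: blade A.

End Spaces.

(* Main.v *)
(* The coordinates of the Clifford-valued operator are copies of [T], so the
   contraction estimate is a sum of squares over coordinates.  The fixed point
   and the self-referential equation need completeness of the spaces: the
   iterates [T^n q_i0] converge geometrically in norm, and along a filter (all
   points of X, or almost all of them) pointwise; the equation is then the
   pointwise limit of [T^(n+1) f (L_i x) = q_i x + s_i x * T^n f x].

   The Lebesgue, Besov and Triebel-Lizorkin norms are treated uniformly: each is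
   a quasinorm dominating the L^p norm and, by Fatou's lemma, lower
   semicontinuous for almost everywhere convergence, whence completeness.  For
   the Sobolev-Slobodeckij norms this is applied to the tuple of weak
   derivatives, whose uniqueness follows by testing against products of
   rescaled functions exp(-1/x).  In C^k and C^(k,alpha), limits are
   differentiated termwise. *)

Require Import Defs.
From mathcomp Require Import all_boot all_order all_algebra.
From mathcomp Require Import all_classical all_reals all_analysis.
From mathcomp Require Import measurable_realfun.
From mathcomp Require Import ring lra.
Import Order.TTheory GRing.Theory Num.Theory.
Import numFieldNormedType.Exports.
Local Open Scope classical_set_scope.
Local Open Scope ring_scope.

Set Implicit Arguments.
Unset Strict Implicit.
Unset Printing Implicit Defensive.

(** * Contractions of spaces of functions *)

(** The obstacle is the point [L i x]. The maps [L i] are merely injective contractions, so the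
    preimage of a null set under [L i] may have positive measure, and [T psi = psi] almost
    everywhere need not give the equation at [L i x] for almost every [x]. The equation therefore
    depends on the representative: [psi] is taken equal to the pointwise limit of the iterates
    wherever that limit exists. Convergence at [x] forces convergence at [L i x], exceptional or
    not, and the equation follows.

    Quasinorms replace norms so that one elementary inequality, (x + y)^r <= 2^r (x^r + y^r), serves
    all the nested powers and integrals in place of Minkowski's inequality. The price is that a
    geometric series of increments no longer sums to a norm bound; hence completeness is asked for
    sequences with [nrm (u (n + k) - u n) <= C * gamma ^+ n], which the iterates of a contraction
    satisfy once the orbit is bounded. *)

Lemma clifford_coord (R : comNzRingType) n (c : {set 'I_n} -> R) (A : {set 'I_n}) :
  (\sum_B c B *: (blade B : clifford R n)) A = c A.
Proof.
rewrite sum_ffunE (bigD1 A)//= big1 ?addr0 => [|B /negPf BA].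
  by rewrite cscaleE blade_basis ffunE eqxx mulr1.
by rewrite cscaleE blade_basis ffunE eq_sym BA mulr0.
Qed.

Lemma ccoord_clifford_operator (R : realType) n (T : (R -> R) -> R -> R)
    (f : R -> clifford R n) A : ccoord (clifford_operator T f) A = T (ccoord f A).
Proof. by apply/funext => x; rewrite /ccoord /clifford_operator clifford_coord. Qed.

Section ForSpace.
Context {R : realType} (X : set R) (F : function_space R).

(** Encoding validity at all points as [globally [set: R]] makes both senses of [for_space] filters,
    so that one fixed-point argument covers continuous functions and classes of functions. *)
Definition space_filter : set_system R :=
  within X (match F with
            | Ck _ | Holder _ _ => globally [set: R]
            | _ => almost_everywhere (@lebesgue_measure R)
            end).

#[global] Instance space_filter_filter : Filter space_filter.
Proof.
have gF : Filter (globally [set: R]) by exact: globally_filter.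
have aeF : Filter (almost_everywhere (@lebesgue_measure R)).
  exact: ae_filter_ringOfSetsType.
by rewrite /space_filter; case: F => *; exact: within_filter.
Qed.

Lemma space_filterT : space_filter X.
Proof.
have gF : Filter (globally [set: R]) by exact: globally_filter.
have aeF : Filter (almost_everywhere (@lebesgue_measure R)).
  exact: ae_filter_ringOfSetsType.
by rewrite /space_filter; case: F => *; exact: withinT.
Qed.

Lemma for_spaceE (P : R -> Prop) : for_space X F P = space_filter P.
Proof.
rewrite /for_space /space_filter; case: F => * //; apply/propext;
  by split=> [h x _|h x]; [exact: h|exact: h x I].
Qed.

End ForSpace.

Section RBOperator.
Context {R : realType} (N : nat) (X : set R) (L q s : 'I_N -> R -> R).
Hypothesis L_inj : forall i, set_inj X (L i).
Hypothesis L_disj : forall i j, i != j -> (L i @` X) `&` (L j @` X) = set0.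

(** Disjointness leaves a single summand and injectivity lets [pinv] undo [L i]. No null set is
    excepted, so the identity applies to the iterates at every point [L i x]. *)
Lemma RB_operatorE f i x : X x ->
  RB_operator X L q s f (L i x) = q i x + s i x * f x.
Proof.
move=> Xx; rewrite /RB_operator (big_pred1 i) => [|j].
  by rewrite pinvKV ?mem_set//; apply: L_inj.
apply/idP/eqP => [/set_mem LjX|->]; last by apply/mem_set; exists x.
apply/eqP/negP => /negP ji.
suff : ((L j @` X) `&` (L i @` X)) (L i x) by rewrite L_disj.
by split => //; exists x.
Qed.

End RBOperator.

(* A Banach space up to renorming: the triangle inequality may lose a constant,
   and limits are also limits pointwise along [G]. *)
Record banach_like (R : realType) (inF : (R -> R) -> Prop)
    (nrm : (R -> R) -> R) (G : set_system R) : Prop := {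
  nrm_ge0 : forall f, 0 <= nrm f;
  inF_sub : forall f g, inF f -> inF g -> inF (f \- g);
  nrm_quasi : exists2 K : R, 0 <= K & forall f g, inF f -> inF g ->
    nrm (f \- g) <= K * (nrm f + nrm g);
  nrm_eq : forall f g, inF f -> inF g -> (\forall x \near G, f x = g x) ->
    nrm f = nrm g;
  nrm_eq0 : forall f, inF f -> nrm f = 0 -> \forall x \near G, f x = 0;
  inF_complete : forall (u : nat -> R -> R) (C gamma : R),
    0 <= gamma < 1 -> (forall n, inF (u n)) ->
    (forall n k, nrm (u (n + k)%N \- u n) <= C * gamma ^+ n) ->
    exists f, [/\ inF f,
      exists D : R, forall n, nrm (f \- u n) <= D * gamma ^+ n,
      forall x, cvg (u n x @[n --> \oo]) -> u n x @[n --> \oo] --> f x &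
      \forall x \near G, u n x @[n --> \oo] --> f x] }.

Section Contraction.
Context {R : realType} (inF : (R -> R) -> Prop) (nrm : (R -> R) -> R).
Context (G : set_system R) {GF : Filter G}.
Hypothesis XF : banach_like inF nrm G.
Variables (T : (R -> R) -> R -> R) (gamma : R).
Hypothesis TF : forall f, inF f -> inF (T f).
Hypothesis T_contr : contractive_on inF nrm T gamma.

Let nrm0 f : 0 <= nrm f. Proof. exact: nrm_ge0 XF f. Qed.
Let gamma_ge0 : 0 <= gamma. Proof. by have [/andP[]] := T_contr. Qed.
Let gamma_lt1 : gamma < 1. Proof. by have [/andP[]] := T_contr. Qed.

Let iterF f n : inF f -> inF (iter n T f).
Proof. by move=> Ff; elim: n => [|n IH]; [exact: Ff|exact: (TF IH)]. Qed.

Let iter_contr n f g : inF f -> inF g ->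
  nrm (iter n T f \- iter n T g) <= gamma ^+ n * nrm (f \- g).
Proof.
move=> Ff Fg; elim: n => [|n IH]; first by rewrite expr0 mul1r.
have [_ h] := T_contr; apply: le_trans (h _ _ _ _) _; try exact: iterF.
by rewrite exprS -mulrA ler_wpM2l.
Qed.

(* Since the triangle inequality loses a constant [K], the orbit is bounded
   by looking at the power [T^m] with [K * gamma ^ m < 1]. *)
Let orbit_bounded f : inF f ->
  exists C, forall k, nrm (iter k T f \- f) <= C.
Proof.
move=> Ff; have [K K0 quasi] := nrm_quasi XF.
have [m m0 Km] : exists2 m, (0 < m)%N & K * gamma ^+ m <= 2^-1.
  have : K * gamma ^+ n @[n --> \oo] --> K * 0.
    by apply: cvgM; [exact: cvg_cst|apply: cvg_expr; rewrite ger0_norm].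
  rewrite mulr0 => /cvgrPdist_le/(_ 2^-1) [|n _ h]; first by rewrite invr_gt0.
  exists n.+1 => //; have /= := h n.+1 (leqnSn n).
  by rewrite sub0r normrN ger0_norm// mulr_ge0// exprn_ge0.
pose d k := nrm (iter k T f \- f).
pose M := \sum_(k < m) d k.
have dM k : (k < m)%N -> d k <= M.
  by move=> km; rewrite /M (bigD1 (Ordinal km))//= lerDl; apply: sumr_ge0 => j _; exact: nrm0.
have M0 : 0 <= M by apply: sumr_ge0 => j _; exact: nrm0.
pose e := nrm (f \- iter m T f).
(* The quasi-triangle inequality gives [d k <= d (k - m) / 2 + K * e]. A bound B survives this when
   B / 2 + K * e <= B, as for B = M + 2 * K * e, and [M] takes care of the first [m] indices. *)
have KM k : nrm (iter k T f \- f) <= M + 2 * K * e; last by exists (M + 2 * K * e).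
elim/ltn_ind: k => k IH.
have [/dM h|mk] := ltnP k m.
  by rewrite (le_trans h)// lerDl !mulr_ge0// nrm0.
rewrite -(subnKC mk); set j := (k - m)%N.
have djC : d j <= M + 2 * K * e.
  by apply: IH; rewrite /j ltn_subrL m0 (leq_trans m0 mk).
have -> : iter (m + j) T f \- f =
    (iter m T (iter j T f) \- iter m T f) \- (f \- iter m T f).
  by apply/funext => x; rewrite /= iterD; ring.
apply: le_trans (quasi _ _ _ _) _.
- by apply: (inF_sub XF); apply: iterF => //; exact: iterF.
- by apply: (inF_sub XF) => //; exact: iterF.
have h1 := iter_contr m (iterF j Ff) Ff.
have h2 : K * nrm (iter m T (iter j T f) \- iter m T f) <= 2^-1 * d j.
  rewrite (le_trans (ler_wpM2l K0 h1))// mulrA ler_wpM2r//.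
have h3 := nrm0 (f \- iter m T f); rewrite -/e in h3 *.
have h4 : 0 <= K * e by exact: mulr_ge0.
rewrite mulrDr; lra.
Qed.

(** The third clause pins down the representative: it holds at every point where the orbit
    converges, including points where [T psi x = psi x] is not known. *)
Lemma contraction_fixed_point f : inF f -> exists psi, [/\ inF psi,
  \forall x \near G, T psi x = psi x,
  forall x, cvg (iter n T f x @[n --> \oo]) ->
    iter n T f x @[n --> \oo] --> psi x &
  \forall x \near G, iter n T f x @[n --> \oo] --> psi x].
Proof.
move=> Ff; have [C bC] := orbit_bounded Ff.
have [n k|psi [Fpsi [D hD] cvgpsi cpsi]] := inF_complete XF (C := C)
    (T_contr.1) (fun n => iterF n Ff).
  rewrite /= iterD mulrC (le_trans (iter_contr n (iterF k Ff) Ff))//.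
  by rewrite ler_wpM2l// exprn_ge0.
exists psi; split => //.
have [K K0 quasi] := nrm_quasi XF.
have FTpsi := TF Fpsi.
have Fd : inF (T psi \- psi) by exact: (inF_sub XF).
have nd0 : nrm (T psi \- psi) = 0.
  apply/eqP; rewrite eq_le nrm0 andbT.
  (* Both [T psi] and [psi] are within [D * gamma ^+ n] of the iterate of order n + 1, whence the
     factor 2 * D; then [n] tends to infinity. *)
  have h n : nrm (T psi \- psi) <= K * (2 * D) * gamma ^+ n.
    have -> : T psi \- psi = (T psi \- iter n.+1 T f) \- (psi \- iter n.+1 T f).
      by apply/funext => x /=; ring.
    apply: le_trans (quasi _ _ _ _) _.
    - by apply: (inF_sub XF) => //; exact: iterF.
    - by apply: (inF_sub XF) => //; exact: iterF.
    have := (T_contr.2) _ _ Fpsi (iterF n Ff) => h1.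
    have h2 := hD n; have h3 := hD n.+1.
    have h4 : 0 <= D * gamma ^+ n by exact: le_trans (nrm0 _) h2.
    have h5 : gamma * nrm (psi \- iter n T f) <= D * gamma ^+ n.
      by rewrite (le_trans _ h2)// ler_piMl// ltW.
    have h6 : D * gamma ^+ n.+1 <= D * gamma ^+ n.
      by rewrite exprS mulrCA ler_piMl// ltW.
    rewrite -!mulrA ler_wpM2l//= mulr2n mulrDl mul1r; lra.
  have : K * (2 * D) * gamma ^+ n @[n --> \oo] --> K * (2 * D) * 0.
    by apply: cvgM; [exact: cvg_cst|apply: cvg_expr; rewrite ger0_norm].
  rewrite mulr0; move=> c; rewrite -(cvg_lim _ c)//.
  apply: limr_ge; first by apply/cvg_ex; eexists; exact: c.
  exact: nearW.
apply: filterS (nrm_eq0 XF Fd nd0) => x /= /eqP.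
by rewrite subr_eq0 => /eqP.
Qed.

(** Two fixed points satisfy [nrm (f - g) = nrm (T f - T g) <= gamma * nrm (f - g)], where the
    equality holds because [nrm] only sees functions up to equality along [G]. *)
Lemma contraction_fixed_point_unique f g : inF f -> inF g ->
  (\forall x \near G, T f x = f x) -> (\forall x \near G, T g x = g x) ->
  \forall x \near G, f x = g x.
Proof.
move=> Ff Fg Tf Tg.
have Fd : inF (f \- g) by exact: (inF_sub XF).
have nd0 : nrm (f \- g) = 0.
  have := (T_contr.2) _ _ Ff Fg.
  rewrite (@nrm_eq _ _ _ _ XF _ (f \- g))//.
  - move=> h; apply/eqP; rewrite eq_le nrm0 andbT.
    have := nrm0 (f \- g); have := gamma_lt1; nra.
  - by apply: (inF_sub XF); exact: TF.
  - by apply: filterS2 Tf Tg => x /= -> ->.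
apply: filterS (nrm_eq0 XF Fd nd0) => x /= /eqP.
by rewrite subr_eq0 => /eqP.
Qed.

End Contraction.

(** * Limits inferior and weighted integrals *)

Section EReal.
Context {R : realType}.
Local Open Scope ereal_scope.
Implicit Types (a b c : \bar R) (u v : nat -> \bar R).

Lemma lee_dense a b : (forall c, c < a -> c <= b) -> a <= b.
Proof.
case: a => [r|h|_]; last by rewrite leNye.
  by move=> h; apply/lee_subgt0Pr => e e0; apply: h; rewrite -EFinB lte_fin ltrBlDr ltrDl.
case: b h => [r h|//|h].
  by have := h (r + 1)%:E (ltry _); rewrite lee_fin gerDl ler10.
by have := h 0 (ltry _); rewrite leeNy_eq.
Qed.

(** Turns an inequality about a lower limit into eventual inequalities against the constants below
    [a]; the rules for powers, multiples and sums are read off this form. *)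
Lemma le_limn_einfP a u :
  a <= limn_einf u <-> forall c, c < a -> \forall n \near \oo, c <= u n.
Proof.
have uE : limn_einf u = ereal_sup (range (einfs u)).
  by rewrite limn_einf_lim; apply/cvg_lim => //; exact: cvg_einfs_sup.
rewrite uE; split=> [au c ca|h].
  have /ereal_sup_gt[_ [n _ <-] cn] := lt_le_trans ca au.
  exists n => // k /= nk; apply/ltW/(lt_le_trans cn).
  by apply: ereal_inf_lbound; exists k.
apply: lee_dense => c /h[n _ cu].
apply: (@le_trans _ _ (einfs u n)); last by apply: ereal_sup_ubound; exists n.
by apply: le_ereal_inf_tmp => _ [k /= nk <-]; exact: cu.
Qed.

Lemma le_limn_einf u v : (forall n, u n <= v n) -> limn_einf u <= limn_einf v.
Proof.
move=> uv; apply/le_limn_einfP => c cu.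
have /le_limn_einfP/(_ c cu) := lexx (limn_einf u).
by apply: filterS => n cn; exact: le_trans (uv n).
Qed.

Lemma limn_einf_le u b : (forall n, u n <= b) -> limn_einf u <= b.
Proof.
move=> ub; apply: lee_dense => c cu.
have /le_limn_einfP/(_ c cu)[n _ h] := lexx (limn_einf u).
by apply: le_trans (h n _) (ub n) => /=.
Qed.

Lemma limn_einf_cst a : limn_einf (fun=> a) = a.
Proof. by have [] := @cvg_limn_einf_sup _ (fun=> a) a (@cvg_cst _ _ _ _ _). Qed.

Let in0y a : 0 <= a -> a \in `[0, +oo].
Proof. by move=> a0; rewrite in_itv/= a0 leey. Qed.

Lemma le_poweR (r : R) a b : (0 <= r)%R -> 0 <= a -> a <= b -> a `^ r <= b `^ r.
Proof.
by move=> r0 a0 ab; apply: gt0_ler_poweR => //; apply: in0y => //; exact: le_trans ab.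
Qed.

Lemma poweR_limn_einf (r : R) a u : (0 < r)%R -> 0 <= a -> (forall n, 0 <= u n) ->
  a <= limn_einf u -> a `^ r <= limn_einf (fun n => u n `^ r).
Proof.
move=> r0 a0 u0 /le_limn_einfP h; apply/le_limn_einfP => c ca.
have [c0|c0] := leP 0 c; last first.
  by apply: nearW => n; rewrite (le_trans (ltW c0))// poweR_ge0.
have K b : 0 <= b -> (b `^ r^-1) `^ r = b.
  by move=> b0; rewrite -poweRrM mulVf ?gt_eqF// poweRe1.
have /h : c `^ r^-1 < a.
  rewrite ltNge; apply: contraL ca => ca; rewrite -leNgt -(K c c0).
  by apply: le_poweR => //; exact: ltW.
by apply: filterS => n cn; rewrite -(K c c0) le_poweR ?poweR_ge0// ltW.
Qed.

Lemma muleR_limn_einf (k : R) a u : (0 <= k)%R -> (forall n, 0 <= u n) ->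
  a <= limn_einf u -> k%:E * a <= limn_einf (fun n => k%:E * u n).
Proof.
rewrite le_eqVlt => /predU1P[<- u0 _|k0 u0 /le_limn_einfP h].
  by under eq_fun do rewrite mul0e; rewrite limn_einf_cst mul0e.
apply/le_limn_einfP => c; rewrite -lte_pdivrMl// => /h.
by apply: filterS => n; rewrite lee_pdivrMl.
Qed.

Lemma adde_limn_einf a b u v : 0 <= a -> 0 <= b ->
  (forall n, 0 <= u n) -> (forall n, 0 <= v n) ->
  a <= limn_einf u -> b <= limn_einf v -> a + b <= limn_einf (fun n => u n + v n).
Proof.
move=> a0 b0 u0 v0 ua vb.
set L := limn_einf _.
have step (a' c : R) : a'%:E < a -> c%:E < b -> (a' + c)%:E <= L.
  move=> aa cb; apply/le_limn_einfP => e eac.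
  move/le_limn_einfP : ua => /(_ _ aa); move/le_limn_einfP : vb => /(_ _ cb).
  by apply: filterS2 => n cv au; rewrite (le_trans (ltW eac))// EFinD leeD.
(* [a] and [b] are approximated one after the other, so that only finite numbers are subtracted;
   [a = +oo] is treated apart. *)
have step1 (c : R) : c%:E < b -> a <= L - c%:E.
  move=> cb; apply: lee_dense => -[a'| |] aa; last by rewrite leNye.
    by rewrite leeBrDr// -EFinD step.
  by move: aa; rewrite ltNge leey.
have [aoo|ay] := eqVneq a +oo.
  rewrite aoo addye ?(gt_eqF (lt_le_trans ltNy0 b0))//.
  have b1 : (-1)%:E < b by rewrite (lt_le_trans _ b0)// lte_fin ltrN10.
  by have := step1 _ b1; rewrite aoo leye_eq => /eqP; case: (L) => [l| |].
have afin : a \is a fin_num by rewrite ge0_fin_numE// ltey.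
rewrite addeC -leeBrDr//; apply: lee_dense => -[c| |] cb; last by rewrite leNye.
  by rewrite leeBrDr// addeC -leeBrDr// step1.
by move: cb; rewrite ltNge leey.
Qed.

Lemma normr_limn_einf (x : R) (f : nat -> R) : f n @[n --> \oo] --> x ->
  `|x|%:E <= limn_einf (fun n => `|f n|%:E).
Proof.
move=> fx; have h : `|f n|%:E @[n --> \oo] --> `|x|%:E.
  by apply: cvg_EFin; [exact: nearW|exact: cvg_norm fx].
by rewrite (cvg_limn_einf_sup h).1.
Qed.

(** Since x + y is at most twice the larger of the two, a factor 2 enters before the power is taken.
    This works for every [r > 0], hence for the exponent [p] as well as for [p^-1]. *)
Lemma poweR_quasi (x y z : \bar R) (K r : R) : (0 <= K)%R -> (0 < r)%R ->
  0 <= x -> 0 <= y -> 0 <= z ->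
  z <= K%:E * (x + y) -> z `^ r <= ((2 * K) `^ r)%:E * (x `^ r + y `^ r).
Proof.
move=> K0 r0 x0 y0 z0 zxy.
have mono := gt0_ler_poweR (ltW r0).
have K20 : (0 <= 2 * K)%R by rewrite mulr_ge0.
rewrite -poweR_EFin.
wlog xy : x y x0 y0 zxy / x <= y.
  move=> h; have [/h|/ltW yx] := leP x y; first exact.
  by rewrite addeC; apply: h => //; rewrite addeC.
apply: (@le_trans _ _ ((2 * K)%:E `^ r * y `^ r)).
  rewrite -poweRM//; apply: mono; rewrite ?in0y ?mule_ge0 ?lee_fin//.
  apply: le_trans zxy _; rewrite mulrC EFinM -muleA lee_wpmul2l ?lee_fin//.
  by rewrite mule_natl mule2n leeD2r.
by rewrite lee_wpmul2l ?poweR_ge0// leeDr// poweR_ge0.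
Qed.

End EReal.

Section NonnegIntegral.
Context d (T : measurableType d) (R : realType).
Variables (mu : {measure set T -> \bar R}) (D : set T) (mD : measurable D).
Local Open Scope ereal_scope.

Lemma ge0_integral_quasi (f g h : T -> \bar R) (K : R) : (0 <= K)%R ->
  (forall x, D x -> 0 <= f x) -> (forall x, D x -> 0 <= g x) ->
  (forall x, D x -> 0 <= h x) ->
  measurable_fun D f -> measurable_fun D g -> measurable_fun D h ->
  (forall x, D x -> h x <= K%:E * (f x + g x)) ->
  \int[mu]_(x in D) h x <=
    K%:E * (\int[mu]_(x in D) f x + \int[mu]_(x in D) g x).
Proof.
move=> K0 f0 g0 h0 mf mg mh hfg.
have mfg : measurable_fun D (f \+ g) by exact: emeasurable_funD.
have fg0 x : D x -> 0 <= (f \+ g) x by move=> Dx; rewrite adde_ge0 ?f0 ?g0.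
rewrite -ge0_integralD// -ge0_integralZl_EFin//.
by apply: ge0_le_integral => //; exact: measurable_funeM.
Qed.

(** Asking only for an inequality with the lower limit, almost everywhere, lets the lemma be nested:
    the integrals of an inner application are the integrands of the outer one. *)
Lemma fatou_ae (f : T -> \bar R) (u : nat -> T -> \bar R) :
  (forall x, D x -> 0 <= f x) -> (forall n x, D x -> 0 <= u n x) ->
  measurable_fun D f -> (forall n, measurable_fun D (u n)) ->
  {ae mu, forall x, D x -> f x <= limn_einf (u ^~ x)} ->
  \int[mu]_(x in D) f x <= limn_einf (fun n => \int[mu]_(x in D) u n x).
Proof.
move=> f0 u0 mf mu' h; apply: le_trans (fatou mu mD mu' u0).
apply: ae_ge0_le_integral => // [x Dx|].
  by rewrite -(limn_einf_cst 0); apply: le_limn_einf => n; exact: u0.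
rewrite /limn_einf; apply: measurableT_comp => //.
by apply: measurable_fun_limn_esup => n; exact: measurableT_comp.
Qed.

End NonnegIntegral.

(** * Lower semicontinuous quasinorms *)

(* The library's instances do not fire on the Borel type underlying
   [lebesgue_measure]. *)
#[global] Instance lebesgue_ae_filter (R : realType) :
  Filter (nbhs (almost_everywhere (@lebesgue_measure R))).
Proof. exact: ae_filter_ringOfSetsType. Qed.

Section Affine.
Context {R : realType}.
Local Notation mu := (@lebesgue_measure R).

(** Lebesgue measure is determined by the lengths of the intervals []x, y]], and [c] times the image
    of [mu] under the affine map gives them the same lengths. *)
Lemma lebesgue_measure_affine (t c : R) (A : set R) : 0 < c -> measurable A ->
  mu A = (c%:E * mu ((fun x => (t + c * x)%R) @^-1` A))%E.
Proof.
move=> c0 mA; pose f := fun x : R => (t + c * x)%R.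
have mf : measurable_fun [set: measurableTypeR R] (f : _ -> measurableTypeR R).
  by apply: measurable_funD => //; exact: measurable_funM.
pose nu := mscale (NngNum (ltW c0))
  (pushforward mu (f : measurableTypeR R -> measurableTypeR R)) : {measure set _ -> \bar R}.
rewrite [LHS](@lebesgue_measure_unique _ (nu mf))// => _ [[x y] _ <-].
rewrite -[RHS]/(c%:E * mu (f @^-1` `]x, y]%classic))%E.
have -> : f @^-1` `]x, y]%classic = `](x - t) / c, (y - t) / c]%classic.
  apply/seteqP; split=> z /=; rewrite !in_itv /= /f ltr_pdivrMr// ler_pdivlMr//.
    by move=> /andP[? ?]; apply/andP; split; lra.
  by move=> /andP[? ?]; apply/andP; split; lra.
rewrite !lebesgue_measure_itv/= !lte_fin ltr_pM2r ?invr_gt0// ltrD2r.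
case: ifPn => xy; last by rewrite mule0.
by rewrite -!EFinB -EFinM; congr EFin; field; rewrite gt_eqF.
Qed.

(** Used with [c = 1] to translate by a fixed step, and with [c = j] to vary the step of a finite
    difference at a fixed base point. *)
Lemma ae_affine (t c : R) (P : R -> Prop) : 0 < c ->
  {ae mu, forall x, P x} -> {ae mu, forall x, P (t + c * x)}.
Proof.
move=> c0 [N [mN N0 PN]]; exists ((fun x => t + c * x) @^-1` N); split.
- rewrite -[X in measurable X]setTI.
  have : measurable_fun setT (fun x : R => t + c * x).
    by apply: measurable_funD => //; exact: measurable_funM.
  by apply.
- have := lebesgue_measure_affine t c0 mN; rewrite N0 => /esym/eqP.
  by rewrite mule_eq0 eqe gt_eqF// => /eqP.
- by move=> x /= nP; apply: PN.
Qed.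

End Affine.

Section WeightedNorm.
Context d (T : measurableType d) (R : realType).
Variables (mu : {measure set T -> \bar R}) (D : set T) (mD : measurable D).
Variables (p : R) (w : T -> R).
Hypotheses (p_gt0 : 0 < p) (w_ge0 : forall x, D x -> 0 <= w x).
Hypothesis mw : measurable_fun D w.
Local Open Scope ereal_scope.
Implicit Types (f g h : T -> \bar R).

(** Weight 1 gives the L^p norm, and weight [t^-1] on ]0, 1[ the integral against dt / t of the
    Besov and Triebel-Lizorkin norms. The values are extended reals because moduli of smoothness and
    area functions may be infinite. *)
Definition weighted_norm f : \bar R :=
  (\int[mu]_(x in D) (f x `^ p * (w x)%:E)) `^ p^-1.

Let mpow f : measurable_fun D f -> measurable_fun D (fun x => f x `^ p * (w x)%:E).
Proof.
move=> mf; apply: emeasurable_funM; last exact/measurable_EFinP.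
by apply: (measurableT_comp (measurable_poweR p)).
Qed.

Let pow_ge0 f x : D x -> 0 <= f x `^ p * (w x)%:E.
Proof. by move=> Dx; rewrite mule_ge0 ?poweR_ge0// lee_fin w_ge0. Qed.

Let int_ge0 f : 0 <= \int[mu]_(x in D) (f x `^ p * (w x)%:E).
Proof. by apply: integral_ge0 => x; exact: pow_ge0. Qed.

(** The constant comes from [poweR_quasi] used twice: under the integral with exponent [p], which
    gives the p-th power of 2 K, then on the outer root with exponent [p^-1]. *)
Lemma weighted_norm_quasi f g h (K : R) : (0 <= K)%R ->
  (forall x, D x -> 0 <= f x) -> (forall x, D x -> 0 <= g x) ->
  (forall x, D x -> 0 <= h x) ->
  measurable_fun D f -> measurable_fun D g -> measurable_fun D h ->
  (forall x, D x -> h x <= K%:E * (f x + g x)) ->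
  weighted_norm h <= ((2 * (2 * K) `^ p) `^ p^-1)%:E *
    (weighted_norm f + weighted_norm g).
Proof.
move=> K0 f0 g0 h0 mf mg mh hfg.
apply: poweR_quasi; rewrite ?powR_ge0 ?invr_gt0//.
apply: ge0_integral_quasi; rewrite ?powR_ge0//; try exact: pow_ge0; try exact: mpow.
move=> x Dx; rewrite -ge0_muleDl ?poweR_ge0//.
by rewrite muleA lee_wpmul2r ?lee_fin ?w_ge0// poweR_quasi// ?f0 ?g0 ?h0 ?hfg.
Qed.

Lemma weighted_norm_fatou f (u : nat -> T -> \bar R) :
  (forall x, D x -> 0 <= f x) -> (forall n x, D x -> 0 <= u n x) ->
  measurable_fun D f -> (forall n, measurable_fun D (u n)) ->
  {ae mu, forall x, D x -> f x <= limn_einf (u ^~ x)} ->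
  weighted_norm f <= limn_einf (fun n => weighted_norm (u n)).
Proof.
move=> f0 u0 mf mu' h.
apply: poweR_limn_einf; rewrite ?invr_gt0//.
apply: fatou_ae => //; try exact: pow_ge0; try exact: mpow;
  try by move=> n; try exact: pow_ge0; exact: mpow.
apply: filterS h => x h Dx; rewrite muleC; under eq_fun do rewrite muleC.
apply: muleR_limn_einf; [exact: w_ge0|by move=> n; exact: poweR_ge0|].
by apply: poweR_limn_einf => // [|n|]; [exact: f0|exact: u0|exact: h].
Qed.

Lemma Lnorm_weighted f : w = cst 1%R -> (forall x, D x -> 0 <= f x) ->
  'N[mu]_p%:E[f \_ D] = weighted_norm f.
Proof.
move=> w1 f0; rewrite unlock /weighted_norm w1; congr (_ `^ _).
rewrite [RHS]integral_mkcond; apply: eq_integral => x _.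
rewrite !patchE; case: ifPn => xD; last by rewrite abse0 poweR0r// gt_eqF.
by rewrite mule1 gee0_abs// f0//; exact: set_mem.
Qed.

End WeightedNorm.

(** The last clause does double duty: constant sequences give invariance under almost everywhere
    equality, and for Cauchy sequences it carries norm bounds over to the limit. Since [E] may be
    infinite, the clauses ask for measurability rather than membership in a space. *)
Record lsc_quasinorm (R : realType) (X : set R) (E : (R -> R) -> \bar R) : Prop := {
  quasinorm_ge0 : forall f, (0 <= E f)%E;
  quasinorm_quasi : exists2 K : R, 0 <= K & forall f g : R -> R,
    measurable_fun X f -> measurable_fun X g ->
    (E (f \- g)%R <= K%:E * (E f + E g))%E;
  quasinorm_lsc : forall (f : R -> R) (u : nat -> R -> R),
    measurable_fun X f -> (forall n, measurable_fun X (u n)) ->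
    {ae (@lebesgue_measure R), forall x, X x -> u n x @[n --> \oo] --> f x} ->
    (E f <= limn_einf (fun n => E (u n)))%E }.

Lemma lsc_quasinormD (R : realType) (X : set R) (E1 E2 : (R -> R) -> \bar R) :
  lsc_quasinorm X E1 -> lsc_quasinorm X E2 ->
  lsc_quasinorm X (fun f => E1 f + E2 f)%E.
Proof.
move=> h1 h2; have E10 := quasinorm_ge0 h1; have E20 := quasinorm_ge0 h2.
split=> [f|| f u mf mu uf]; first by rewrite adde_ge0.
  have [K1 K10 q1] := quasinorm_quasi h1; have [K2 K20 q2] := quasinorm_quasi h2.
  exists (K1 + K2) => [|f g mf mg]; first exact: addr_ge0.
  have le (K K' : R) (E : (R -> R) -> \bar R) : (0 <= K)%R -> (0 <= K')%R ->
      (forall f, 0 <= E f)%E -> (E (f \- g)%R <= K%:E * (E f + E g))%E ->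
      (E (f \- g)%R <= (K + K')%:E * (E f + E g))%E.
    move=> K0 K'0 E0 /le_trans; apply.
    by rewrite lee_wpmul2r ?adde_ge0// lee_fin lerDl.
  apply: le_trans (leeD (le _ K2 _ K10 K20 E10 (q1 _ _ mf mg))
                        (le _ K1 _ K20 K10 E20 (q2 _ _ mf mg))) _.
  rewrite (addrC K2) -ge0_muleDr ?adde_ge0//.
  by rewrite addeACA.
apply: adde_limn_einf => //; [exact: (quasinorm_lsc h1)|exact: (quasinorm_lsc h2)].
Qed.

Section Lp.
Context {R : realType} (X : set R) (mX : measurable X) (p : R) (p_gt0 : 0 < p).
Local Notation mu := (@lebesgue_measure R).

Lemma Lp_normE f : Lp_norm X p f =
  weighted_norm mu X p (cst 1) (fun x => `|f x|%:E).
Proof.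
rewrite -Lnorm_weighted// /Lp_norm -Lnorm_abse; congr Lnorm.
by apply/funext => x /=; rewrite !patchE; case: ifPn => //=; rewrite normr0.
Qed.

Lemma Lp_norm_le (f g h : R -> R) (K : R) : 0 <= K ->
  measurable_fun X f -> measurable_fun X g -> measurable_fun X h ->
  (forall x, X x -> `|h x| <= K * (`|f x| + `|g x|)) ->
  (Lp_norm X p h <= ((2 * (2 * K) `^ p) `^ p^-1)%:E *
     (Lp_norm X p f + Lp_norm X p g))%E.
Proof.
move=> K0 mf mg mh hfg; rewrite !Lp_normE.
by apply: weighted_norm_quasi => //; apply/measurable_EFinP/measurableT_comp.
Qed.

Lemma Lp_norm_lsc : lsc_quasinorm X (Lp_norm X p).
Proof.
split=> [f||f u mf mu' uf]; first exact: Lnorm_ge0.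
- exists ((2 * (2 * 1) `^ p) `^ p^-1) => [|f g mf mg]; first exact: powR_ge0.
  apply: Lp_norm_le => //; first exact: measurable_funB.
  by move=> x Xx; rewrite mul1r ler_normB.
- have -> : Lp_norm X p = fun g => weighted_norm mu X p (cst 1) (fun x => `|g x|%:E).
    by apply/funext => g; exact: Lp_normE.
  apply: weighted_norm_fatou => //.
  - by apply/measurable_EFinP/measurableT_comp.
  - by move=> n; apply/measurable_EFinP/measurableT_comp => //; exact: mu'.
  by apply: filterS uf => x h Xx; apply: normr_limn_einf; exact: h.
Qed.

End Lp.

(** * Almost everywhere limits and completeness from geometric estimates *)

Section LimSup.
Context {R : realType}.

(** The upper limit exists everywhere, is measurable, and equals the limit wherever there is one.
    Its value at [x] depends on the values [u n x] alone, which fixes the same representative in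
    every space; [fine] sends infinite upper limits to 0. *)
Definition lim_fun (u : nat -> R -> R) (x : R) : R :=
  fine (limn_esup (fun n => (u n x)%:E)).

Lemma lim_funP u x : cvg (u n x @[n --> \oo]) -> u n x @[n --> \oo] --> lim_fun u x.
Proof.
move=> /cvg_ex[l ul]; rewrite /lim_fun.
have h : (u n x)%:E @[n --> \oo] --> l%:E by apply: cvg_EFin; [exact: nearW|].
by rewrite (cvg_limn_einf_sup h).2.
Qed.

Lemma measurable_lim_fun (X : set R) u : (forall n, measurable_fun X (u n)) ->
  measurable_fun X (lim_fun u).
Proof.
move=> mu; apply: (measurableT_comp (f := fine)) => //.
by apply: measurable_fun_limn_esup => n; exact/measurable_EFinP.
Qed.

End LimSup.

Section LpCvg.
Context {R : realType} (X : set R) (mX : measurable X) (p : R) (p_ge1 : 1 <= p).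
Local Notation mu := (@lebesgue_measure R).
Hypothesis X_fin : (mu X < +oo)%E.

(* Splitting according to whether [|v| <= l]. *)
Lemma L1_le_Lp (v : R -> R) (C l : R) : 0 <= C -> 0 < l -> measurable_fun X v ->
  (Lp_norm X p v <= (C * l)%:E)%E ->
  (\int[mu]_(x in X) `|v x|%:E <= ((fine (mu X) + C `^ p) * l)%:E)%E.
Proof.
move=> C0 l0 mv vCl; have p0 : 0 < p by exact: lt_le_trans p_ge1.
have vp : (\int[mu]_(x in X) (`|v x| `^ p)%:E <= ((C * l) `^ p)%:E)%E.
  move: vCl; rewrite Lp_normE// /weighted_norm.
  move=> /(@le_poweR _ p _ _ (ltW p0) (poweR_ge0 _ _)).
  rewrite -poweRrM mulVf ?gt_eqF// poweRe1; last first.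
    by apply: integral_ge0 => x _; rewrite mule1 poweR_ge0.
  by rewrite poweR_EFin; under eq_integral do rewrite mule1 poweR_EFin.
have mvE : measurable_fun X (fun x => `|v x|%:E).
  by apply/measurable_EFinP/measurableT_comp.
have mvp : measurable_fun X (fun x => (`|v x| `^ p)%:E).
  apply/measurable_EFinP; apply: (measurableT_comp (measurable_powR p)).
  exact: measurableT_comp.
(* For [a > l] the ratio [a / l] exceeds 1, so it is at most its p-th power, as [p >= 1]. *)
have le_pow (a : R) : 0 <= a -> a <= l + l * (l `^ p)^-1 * a `^ p.
  move=> a0; have [al|la] := leP a l.
    by rewrite (le_trans al)// lerDl !mulr_ge0 ?invr_ge0 ?powR_ge0 ?ltW.
  rewrite (@le_trans _ _ (l * (l `^ p)^-1 * a `^ p))//; last by rewrite lerDr ltW.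
  have -> : l * (l `^ p)^-1 * a `^ p = l * (a / l) `^ p.
    rewrite powRM ?invr_ge0 ?(ltW l0)// -(powR_inv1 (ltW l0)) -powRrM mulN1r powRN; ring.
  rewrite -ler_pdivrMl// mulrC -{1}(@powRr1 _ (a / l)) ?divr_ge0 ?(ltW l0)//.
  by rewrite ler_powR// ler_pdivlMr// mul1r ltW.
apply: (@le_trans _ _ (\int[mu]_(x in X) (l%:E + (l * (l `^ p)^-1)%:E * (`|v x| `^ p)%:E))%E).
  apply: ge0_le_integral => //.
    by apply: emeasurable_funD => //; exact: measurable_funeM.
  by move=> x Xx; rewrite -EFinM -EFinD lee_fin le_pow.
have c0 : 0 <= l * (l `^ p)^-1 by rewrite mulr_ge0 ?invr_ge0 ?powR_ge0 ?ltW.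
rewrite ge0_integralD//; first last.
- exact: measurable_funeM.
- by move=> x Xx; rewrite mule_ge0// lee_fin ?powR_ge0.
- by move=> x Xx; rewrite lee_fin ltW.
rewrite integral_cst// ge0_integralZl_EFin//.
rewrite mulrDl EFinD leeD//.
  by rewrite mulrC EFinM fineK// ge0_fin_numE ?measure_ge0.
apply: le_trans (lee_wpmul2l _ vp) _; first by rewrite lee_fin.
rewrite -EFinM lee_fin powRM ?(ltW l0)//.
rewrite [leLHS](_ : _ = C `^ p * l * ((l `^ p)^-1 * l `^ p)); last by ring.
by rewrite mulVf ?mulr1// gt_eqF// powR_gt0.
Qed.

(** On a set of finite measure the increments have L^1 norms bounded by a geometric series
    ([L1_le_Lp] with [l = gamma ^+ n]), so the sum of their absolute values is finite almost
    everywhere and the telescoping series converges absolutely. *)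
Lemma Lp_geometric_cvg (u : nat -> R -> R) (C gamma : R) : 0 <= gamma < 1 ->
  (forall n, measurable_fun X (u n)) ->
  (forall n, Lp_norm X p (u n.+1 \- u n)%R <= (C * gamma ^+ n)%:E)%E ->
  {ae mu, forall x, X x -> cvg (u n x @[n --> \oo])}.
Proof.
(* [L1_le_Lp] needs [l > 0], so a ratio that may be 0 is replaced by its maximum with 1/2. *)
wlog gamma0 : gamma / 0 < gamma.
  move=> h /andP[g0 g1] mu' Cu.
  apply: (h (Num.max gamma 2^-1)) => //.
  - by rewrite lt_max invr_gt0 ltr0n orbT.
  - by rewrite le_max g0 gt_max g1 invf_lt1 ?ltr0n// ltr1n.
  - move=> n; apply: le_trans (Cu n) _; rewrite lee_fin.
    have C0 : 0 <= C by have := le_trans (Lnorm_ge0 _ _ _) (Cu 0%N); rewrite lee_fin expr0 mulr1.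
    rewrite ler_wpM2l// lerXn2r ?nnegrE// ?le_max ?g0 ?lexx//.
move=> /andP[_ gamma1] mu' Cu.
have p0 : 0 < p by exact: lt_le_trans p_ge1.
have C0 : 0 <= C by have := le_trans (Lnorm_ge0 _ _ _) (Cu 0%N); rewrite lee_fin expr0 mulr1.
pose v n := u n.+1 \- u n.
have mv n : measurable_fun X (v n) by exact: measurable_funB.
have mvE n : measurable_fun X (fun x => `|v n x|%:E).
  by apply/measurable_EFinP/measurableT_comp.
have v1 n : (\int[mu]_(x in X) `|v n x|%:E <= ((fine (mu X) + C `^ p) * gamma ^+ n)%:E)%E.
  by apply: L1_le_Lp => //; [exact: exprn_gt0|exact: Cu].
have sum_fin : (\int[mu]_(x in X) (\sum_(n <oo) `|v n x|%:E) < +oo)%E.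
  rewrite integral_nneseries//.
  apply: (@le_lt_trans _ _ (\sum_(n <oo) ((fine (mu X) + C `^ p) * gamma ^+ n)%:E)%E).
    by apply: lee_nneseries => // n _; rewrite integral_ge0.
  have g1 : `|gamma| < 1 by rewrite gtr0_norm.
  have h : series (geometric (fine (mu X) + C `^ p) gamma) n @[n --> \oo] -->
      (fine (mu X) + C `^ p) * (1 - gamma)^-1 by exact: cvg_geometric_series.
  have h2 : (series (geometric (fine (mu X) + C `^ p) gamma) n)%:E @[n --> \oo] -->
      ((fine (mu X) + C `^ p) * (1 - gamma)^-1)%:E.
    by apply: cvg_EFin; [exact: nearW|exact: h].
  rewrite [X in (X < _)%E](_ : _ = ((fine (mu X) + C `^ p) * (1 - gamma)^-1)%:E) ?ltry//.
  rewrite -(cvg_lim _ h2)//; apply: congr_lim; apply/funext => n /=.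
  by rewrite sumEFin.
have : {ae mu, forall x, X x -> (\sum_(n <oo) `|v n x|%:E)%E \is a fin_num}.
  apply: (@integrable_ae _ _ _ mu X mX (fun x => \sum_(n <oo) `|v n x|%:E)%E).
  apply/integrableP; split.
    by apply: ge0_emeasurable_sum => // n _; exact: mvE.
  by under eq_integral do (rewrite gee0_abs; last exact: nneseries_ge0).
apply: filterS => x /[apply] sfin.
have cv : cvgn (series (v ^~ x)).
  apply: normed_cvg; apply: nondecreasing_is_cvgn.
    by apply: nondecreasing_series => n _ _; exact: normr_ge0.
  exists (fine (\sum_(n <oo) `|v n x|%:E)) => _ [n _ <-].
  rewrite -lee_fin fineK// -sumEFin.
  exact: (@nneseries_lim_ge _ (fun n => `|v n x|%:E)).
have uE : (fun n => u 0%N x + series (v ^~ x) n) = u ^~ x.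
  by apply/funext => n; rewrite /series /= telescope_sumr// addrC subrK.
have : cvgn (fun n => u 0%N x + series (v ^~ x) n).
  by apply: is_cvgD => //; exact: is_cvg_cst.
by rewrite uE.
Qed.

End LpCvg.

Section LscSpace.
Context {R : realType} (X : set R) (mX : measurable X) (p : R) (p_ge1 : 1 <= p).
Local Notation mu := (@lebesgue_measure R).
Hypothesis X_fin : (mu X < +oo)%E.

Let p_gt0 : 0 < p. Proof. exact: lt_le_trans p_ge1. Qed.

Lemma Lp_norm_eq0 f : measurable_fun X f -> Lp_norm X p f = 0%E ->
  {ae mu, forall x, X x -> f x = 0}.
Proof.
move=> mf /Lnorm_eq0_eq0.
have mfX : measurable_fun setT ((EFin \o f) \_ X).
  by apply/(measurable_restrictT _ mX); exact/measurable_EFinP.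
move=> /(_ mfX); rewrite lte_fin => /(_ p_gt0).
apply: filterS => x /(_ I); rewrite patchE => + Xx; rewrite mem_set//=.
by move=> [].
Qed.

Section LscQuasinorm.
Variable E : (R -> R) -> \bar R.
Hypothesis HE : lsc_quasinorm X E.

(** Lower semicontinuity along the constant sequence [g], which converges almost everywhere to [f],
    gives [E f <= E g]; the roles are then exchanged. *)
Lemma quasinorm_ae_eq f g : measurable_fun X f -> measurable_fun X g ->
  {ae mu, forall x, X x -> f x = g x} -> E f = E g.
Proof.
have le h k : measurable_fun X h -> measurable_fun X k ->
    {ae mu, forall x, X x -> h x = k x} -> (E h <= E k)%E.
  move=> mh mk hk; rewrite -(limn_einf_cst (E k)); apply: (quasinorm_lsc HE) => //.
  by apply: filterS hk => x hk Xx; rewrite hk//; exact: cvg_cst.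
move=> mf mg fg; apply/eqP; rewrite eq_le !le//.
by apply: filterS fg => x fg Xx; rewrite fg.
Qed.

Lemma quasinorm_ltyB f g : measurable_fun X f -> measurable_fun X g ->
  (E f < +oo)%E -> (E g < +oo)%E -> (E (f \- g)%R < +oo)%E.
Proof.
move=> mf mg Ef Eg; have [K K0 q] := quasinorm_quasi HE.
apply: le_lt_trans (q _ _ mf mg) _.
by rewrite lte_mul_pinfty ?lee_fin// lte_add_pinfty.
Qed.

End LscQuasinorm.

(** Convergence in norm costs no triangle inequality: for fixed [n], the differences
    [u (n + k) - u n] tend almost everywhere to [lim_fun u - u n], and lower semicontinuity keeps
    the bound [C * gamma ^+ n]. Domination of the L^p norm supplies the almost everywhere
    convergence. *)
Lemma lsc_banach_like (E : (R -> R) -> \bar R) : lsc_quasinorm X E ->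
  (forall f, (Lp_norm X p f <= E f)%E) ->
  banach_like (fun f => in_Lp X p f /\ (E f < +oo)%E) (fine \o E)
    (within X (almost_everywhere mu)).
Proof.
move=> HE LpE; have E0 := quasinorm_ge0 HE.
have Lpsub f g : in_Lp X p f -> in_Lp X p g -> in_Lp X p (f \- g).
  move=> [mf Lf] [mg Lg]; split; first exact: measurable_funB.
  exact: (quasinorm_ltyB (Lp_norm_lsc mX p_gt0)).
have Efin f : (E f < +oo)%E -> E f = (fine (E f))%:E by move=> Ef; rewrite fineK// ge0_fin_numE.
have inB f g : in_Lp X p f /\ (E f < +oo)%E -> in_Lp X p g /\ (E g < +oo)%E ->
    in_Lp X p (f \- g) /\ (E (f \- g)%R < +oo)%E.
  move=> [Lf Ef] [Lg Eg]; split; first exact: Lpsub.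
  by apply: (quasinorm_ltyB HE) => //; [exact: Lf.1|exact: Lg.1].
split.
- by move=> f; exact: fine_ge0.
- exact: inB.
- have [K K0 q] := quasinorm_quasi HE; exists K => // f g [Lf Ef] [Lg Eg].
  have := q _ _ Lf.1 Lg.1; rewrite (Efin _ Ef) (Efin _ Eg).
  by rewrite (Efin _ (quasinorm_ltyB HE Lf.1 Lg.1 Ef Eg)) -EFinD -EFinM lee_fin.
- by move=> f g [[mf _] _] [[mg _] _] fg; rewrite /= (quasinorm_ae_eq HE mf mg).
- move=> f [[mf _] Ef] /= Ef0; apply: Lp_norm_eq0 => //.
  by apply/eqP; rewrite eq_le Lnorm_ge0 andbT (le_trans (LpE f))// Efin// Ef0.
- move=> u C gamma g01 Fu Cu.
  have EC n k : (E (u (n + k)%N \- u n)%R <= (C * gamma ^+ n)%:E)%E.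
    by rewrite Efin ?lee_fin; [exact: Cu|have [] := inB _ _ (Fu (n + k)%N) (Fu n)].
  have mu' n : measurable_fun X (u n) by have [[]] := Fu n.
  have cvgu : {ae mu, forall x, X x -> u n x @[n --> \oo] --> lim_fun u x}.
    have := @Lp_geometric_cvg _ _ mX _ p_ge1 X_fin u C gamma g01 mu'.
    have h n : (Lp_norm X p (u n.+1 \- u n)%R <= (C * gamma ^+ n)%:E)%E.
      by rewrite (le_trans (LpE _))// -addn1.
    by move=> /(_ h); apply: filterS => x /[apply]; exact: lim_funP.
  have mlim : measurable_fun X (lim_fun u) by exact: measurable_lim_fun.
  have Elim n : (E (lim_fun u \- u n)%R <= (C * gamma ^+ n)%:E)%E.
    apply: le_trans (limn_einf_le (EC n)).
    apply: (quasinorm_lsc HE) => [|k|]; try exact: measurable_funB.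
    apply: filterS cvgu => x h Xx; apply: cvgB; last exact: cvg_cst.
    have := h Xx; rewrite -(cvg_shiftn n); apply: cvg_trans.
    by under eq_fun do rewrite addnC.
  have Elt n : (E (lim_fun u \- u n)%R < +oo)%E by rewrite (le_lt_trans (Elim n))// ltry.
  have Flim : in_Lp X p (lim_fun u) /\ (E (lim_fun u) < +oo)%E.
    (* Membership is only known to be stable under differences, so adding [u 0] is written as
       subtracting [(u 0 - u 0) - u 0]. *)
    have -> : lim_fun u = (lim_fun u \- u 0%N) \- ((u 0%N \- u 0%N) \- u 0%N).
      by apply/funext => x /=; ring.
    apply: (inB); last by apply: (inB) => //; exact: inB.
    split=> //; split; first exact: measurable_funB.
    exact: le_lt_trans (LpE _) (Elt _).
  exists (lim_fun u); split => //.
  + exists C => n; have [_ Ed] := inB _ _ Flim (Fu n).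
    by rewrite -lee_fin /= -Efin// Elim.
  + by move=> x; exact: lim_funP.
Qed.

End LscSpace.

(** * Besov spaces *)

Section Measurability.
Context {R : realType}.

(** Preimages of half-lines are intervals. This serves the modulus of smoothness, a supremum over
    uncountably many steps. *)
Lemma nondecreasing_emeasurable (D : set R) (f : R -> \bar R) : measurable D ->
  {homo f : x y / x <= y >-> (x <= y)%E} -> measurable_fun D f.
Proof.
move=> mD f_nd; apply: (measurability _ (ErealGenCInfty.measurableE R)) => //.
move=> _ [_ [c ->] <-].
apply: measurableI => //; apply: is_interval_measurable => s t /=.
rewrite !in_itv/= !andbT => fs ft u /andP[su ut].
by rewrite in_itv/= andbT (le_trans fs)// f_nd.
Qed.

Lemma measurable_integral_param d1 d2 (T1 : measurableType d1)
    (T2 : measurableType d2) (m : {sigma_finite_measure set T2 -> \bar R})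
    (D : set T2) (phi : T1 * T2 -> \bar R) : measurable D ->
  measurable_fun (setT `*` D) phi ->
  (forall x y, D y -> (0 <= phi (x, y))%E) ->
  measurable_fun setT (fun x => \int[m]_(y in D) phi (x, y))%E.
Proof.
move=> mD mphi phi0.
have mTD : measurable (setT `*` D : set (T1 * T2)) by exact: measurableX.
pose psi := phi \_ (setT `*` D).
have mpsi : measurable_fun setT psi by apply/(measurable_restrictT _ mTD).
have psi0 z : (0 <= psi z)%E.
  rewrite /psi patchE; case: z => x y; case: ifPn => // /set_mem[_ Dy].
  exact: phi0.
have := @measurable_fun_fubini_tonelli_F _ _ T1 T2 R m psi mpsi psi0.
congr measurable_fun; apply/funext => x; rewrite /fubini_F [RHS]integral_mkcond.
apply: eq_integral => y _; rewrite /psi !patchE.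
by congr (if _ then _ else _); apply/idP/idP => /set_mem h; apply/mem_set;
  [exact: h.2|split].
Qed.

End Measurability.

Section FiniteDifference.
Context {R : realType} (X : set R) (X_itv : is_interval X) (M : nat).
Local Notation mu := (@lebesgue_measure R).

Let mX : measurable X. Proof. exact: is_interval_measurable. Qed.

Lemma finite_difference_mem h x : X x -> X (x + M%:R * h) ->
  forall j : 'I_M.+1, X (x + j%:R * h).
Proof.
move=> Xx XMx j; have [M0|M0] := posnP M.
  have -> : (j : nat) = 0%N by case: j => -[|j]//=; rewrite M0.
  by rewrite mul0r addr0.
have jM : (j%:R : R) <= M%:R by rewrite ler_nat -ltnS.
have [h0|h0] := leP 0 h.
  by apply: (X_itv Xx XMx); rewrite lerDl mulr_ge0//= lerD2l ler_wpM2r.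
apply: (X_itv XMx Xx); apply/andP; split.
  by rewrite lerD2l ler_wnM2r// ltW.
by rewrite gerDl mulr_ge0_le0// ltW.
Qed.

Lemma finite_differenceB h f g x : finite_difference X M h (f \- g) x =
  finite_difference X M h f x - finite_difference X M h g x.
Proof.
rewrite /finite_difference; case: ifPn => _; last by rewrite subr0.
by rewrite -sumrB; apply: eq_bigr => j _ /=; rewrite mulrBr.
Qed.

Lemma finite_difference_cvg h (u : nat -> R -> R) f x :
  (forall j : 'I_M.+1, X (x + j%:R * h) ->
    u n (x + j%:R * h) @[n --> \oo] --> f (x + j%:R * h)) ->
  finite_difference X M h (u n) x @[n --> \oo] --> finite_difference X M h f x.
Proof.
move=> uf; rewrite /finite_difference; case: ifPn => [|_]; last exact: cvg_cst.
move=> /andP[/set_mem Xx /set_mem XMx].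
apply: cvg_big => [|j _]; first exact: add_continuous.
apply: cvgM; first exact: cvg_cst.
by apply: uf; exact: finite_difference_mem.
Qed.

Lemma measurable_finite_difference2 f : measurable_fun X f ->
  measurable_fun setT (fun z : R * R => finite_difference X M z.2 f z.1).
Proof.
move=> mf.
have mg : measurable_fun setT (f \_ X) by apply/(measurable_restrictT _ mX).
have shift (c : R) : measurable_fun setT (fun z : R * R => z.1 + c * z.2).
  by apply: measurable_funD => //; apply: measurable_funM.
have mX1 : measurable_fun setT (\1_X : R -> R) by exact: measurable_indic.
(* As [f] is measurable on X only, the guard becomes a product of indicators and [f] is extended by
   0. No node is affected, since all nodes lie in X when both ends do. *)
rewrite (_ : (fun z => _) = (fun z : R * R => \1_X z.1 * \1_X (z.1 + M%:R * z.2) *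
  \sum_(j < M.+1) (-1) ^+ (M - j) * 'C(M, j)%:R * (f \_ X) (z.1 + j%:R * z.2))).
  apply: measurable_funM.
    apply: measurable_funM; first exact: (measurableT_comp mX1).
    exact: (measurableT_comp mX1 (shift _)).
  apply: measurable_sum => j; apply: measurable_funM => //.
  exact: (measurableT_comp mg (shift _)).
apply/funext => -[x h] /=; rewrite /finite_difference !indicE.
case: ifPn => [/andP[Xx XMx]|].
  rewrite Xx XMx !mul1r; apply: eq_bigr => j _; rewrite patchE mem_set//.
  by apply: finite_difference_mem; exact: set_mem.
by rewrite negb_and => /orP[/negPf ->|/negPf ->]; rewrite ?(mul0r, mulr0).
Qed.

Lemma measurable_finite_difference h f : measurable_fun X f ->
  measurable_fun setT (finite_difference X M h f).
Proof.
move=> /measurable_finite_difference2 m2.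
by apply: (measurableT_comp m2 (g := fun x => (x, h))); exact: measurable_pair2.
Qed.

End FiniteDifference.

Lemma measurable_inv01 {R : realType} :
  measurable_fun (`]0, 1[%classic : set R) (fun t : R => t^-1).
Proof.
apply: (@eq_measurable_fun _ _ _ _ _ (fun t => t `^ (-1))).
  by move=> t /set_mem/=; rewrite in_itv/= => /andP[t0 _]; rewrite powR_inv1// ltW.
by apply: measurable_funTS; exact: measurable_powR.
Qed.

Section Besov.
Context {R : realType} (X : set R) (X_itv : is_interval X).
Variables (s p q : R) (p_gt0 : 0 < p) (q_gt0 : 0 < q).
Local Notation mu := (@lebesgue_measure R).
Local Notation I01 := (`]0%R, 1%R[%classic : set R).
Local Notation M := (Num.truncn s).+1.

Let mX : measurable X. Proof. exact: is_interval_measurable. Qed.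

Let mfd h f : measurable_fun X f -> measurable_fun X (finite_difference X M h f).
Proof. by move=> mf; apply: measurable_funTS; exact: measurable_finite_difference. Qed.

(** The nodes are finitely many translates of [x], and translations preserve null sets. The
    exceptional set depends on [h]. *)
Lemma ae_finite_difference_cvg h (u : nat -> R -> R) f :
  {ae mu, forall x, X x -> u n x @[n --> \oo] --> f x} ->
  {ae mu, forall x, X x ->
    finite_difference X M h (u n) x @[n --> \oo] --> finite_difference X M h f x}.
Proof.
move=> uf.
have : {ae mu, forall x (j : 'I_M.+1), X (x + j%:R * h) ->
    u n (x + j%:R * h) @[n --> \oo] --> f (x + j%:R * h)}.
  apply: filter_forall => j; have := ae_affine (j%:R * h) (@ltr01 R) uf.
  by apply: filterS => x; rewrite mul1r (addrC (_ * _)).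
by apply: filterS => x ufx _; exact: finite_difference_cvg.
Qed.

(** The step 0 is the witness; for negative [t] no step is admissible and the supremum is -oo. *)
Lemma modulus_ge0 f t : 0 <= t -> (0 <= modulus_of_smoothness X M p f t)%E.
Proof.
move=> t0; apply: (@le_trans _ _ (Lp_norm X p (finite_difference X M 0 f))).
  exact: Lnorm_ge0.
by apply: ereal_sup_ubound; exists 0 => //=; rewrite normr0.
Qed.

Lemma Lp_norm_le_modulus f h t : `|h| <= t ->
  (Lp_norm X p (finite_difference X M h f) <= modulus_of_smoothness X M p f t)%E.
Proof. by move=> ht; apply: ereal_sup_ubound; exists h. Qed.

Lemma measurable_modulus (D : set R) f : measurable D ->
  measurable_fun D (modulus_of_smoothness X M p f).
Proof.
move=> mD; apply: nondecreasing_emeasurable => // t t' tt'.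
by apply: ge_ereal_sup => _ [h /= ht <-]; apply: ereal_sup_ubound; exists h => //=;
  exact: le_trans tt'.
Qed.

Local Notation besov_density f :=
  (fun t : R => (t `^ (- s))%:E * modulus_of_smoothness X M p f t)%E.

Let density_ge0 f t : I01 t -> (0 <= besov_density f t)%E.
Proof.
rewrite /= in_itv/= => /andP[t0 _].
by rewrite mule_ge0 ?lee_fin ?powR_ge0// modulus_ge0// ltW.
Qed.

Let density_m f : measurable_fun I01 (besov_density f).
Proof.
apply: emeasurable_funM; last exact: measurable_modulus.
by apply/measurable_EFinP/measurable_funTS; exact: measurable_powR.
Qed.

(** For each step [h], semicontinuity of the L^p norm bounds the norm of the difference of [f] by
    the lower limit of the moduli of [u n], a bound free of [h], so it passes to the supremum.
    Exceptional sets depending on [h] are harmless, because the integral in [x] is taken before the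
    supremum. Fatou's lemma in [t] concludes. *)
Lemma besov_seminorm_lsc : lsc_quasinorm X (fun f =>
  weighted_norm mu I01 q (fun t => t^-1) (besov_density f)).
Proof.
have w0 (t : R) : I01 t -> 0 <= t^-1.
  by rewrite /= in_itv/= => /andP[t0 _]; rewrite invr_ge0 ltW.
have HL := Lp_norm_lsc mX p_gt0.
split=> [f||f u mf mu' uf]; first exact: poweR_ge0.
- have [K K0 LK] := quasinorm_quasi HL.
  exists ((2 * (2 * K) `^ q) `^ q^-1) => [|f g mf mg]; first exact: powR_ge0.
  apply: weighted_norm_quasi => //; try exact: density_ge0; try exact: density_m.
    exact: measurable_inv01.
  move=> t /=; rewrite in_itv/= => /andP[t0 _].
  rewrite -ge0_muleDr ?modulus_ge0 ?(ltW t0)//.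
  rewrite muleCA lee_wpmul2l ?lee_fin ?powR_ge0//.
  apply: ge_ereal_sup => _ [h /= ht <-].
  have -> : finite_difference X M h (f \- g) =
      finite_difference X M h f \- finite_difference X M h g.
    by apply/funext => x; exact: finite_differenceB.
  apply: le_trans (LK _ _ (mfd h mf) (mfd h mg)) _.
  by rewrite lee_wpmul2l ?lee_fin// leeD// Lp_norm_le_modulus.
- apply: weighted_norm_fatou => //; try exact: density_ge0; try exact: density_m;
    try by move=> n; try exact: density_ge0; try exact: density_m.
    exact: measurable_inv01.
  apply: nearW => t /=; rewrite in_itv/= => /andP[t0 _].
  apply: muleR_limn_einf; first exact: powR_ge0.
    by move=> n; rewrite modulus_ge0// ltW.
  apply: ge_ereal_sup => _ [h /= ht <-].
  have := quasinorm_lsc HL (mfd h mf) (fun n => mfd h (mu' n))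
    (ae_finite_difference_cvg h uf).
  by move=> /le_trans; apply; apply: le_limn_einf => n; exact: Lp_norm_le_modulus.
Qed.

Lemma besov_norm_lsc : lsc_quasinorm X (besov_norm X s p q).
Proof. exact: lsc_quasinormD (Lp_norm_lsc mX p_gt0) besov_seminorm_lsc. Qed.

End Besov.

(** * Triebel-Lizorkin spaces *)

Section TriebelLizorkin.
Context {R : realType} (X : set R) (X_itv : is_interval X).
Variables (s p q : R) (p_gt0 : 0 < p) (q_gt0 : 0 < q).
Local Notation mu := (@lebesgue_measure R).
Local Notation I01 := (`]0%R, 1%R[%classic : set R).
Local Notation M := (Num.truncn s).+1.

Let mX : measurable X. Proof. exact: is_interval_measurable. Qed.

(** Together with [area_density] and [area_fun], this names the pieces local to
    [triebel_lizorkin_norm], the integral against dt / t being read as a [weighted_norm]. *)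
Definition ball_mean f (t x : R) : \bar R :=
  ((t^-1)%:E * \int[mu]_(h in `](- t)%R, t[%classic)
    `|finite_difference X M h f x|%:E)%E.

Definition area_density f (x t : R) : \bar R := ((t `^ (- s))%:E * ball_mean f t x)%E.

Definition area_fun f (x : R) : \bar R :=
  weighted_norm mu I01 q (fun t => t^-1) (area_density f x).

Lemma triebel_lizorkin_normE f : triebel_lizorkin_norm X s p q f =
  (Lp_norm X p f + weighted_norm mu X p (cst 1%R) (area_fun f))%E.
Proof.
by rewrite -Lnorm_weighted// => x _; exact: poweR_ge0.
Qed.

Let w0 (t : R) : I01 t -> 0 <= t^-1.
Proof. by rewrite /= in_itv/= => /andP[t0 _]; rewrite invr_ge0 ltW. Qed.

Lemma area_density_ge0 f x t : I01 t -> (0 <= area_density f x t)%E.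
Proof.
move=> It; rewrite mule_ge0 ?lee_fin ?powR_ge0// mule_ge0 ?lee_fin ?w0//.
by apply: integral_ge0 => h _; rewrite lee_fin.
Qed.

(** The domain of integration moves with the parameter; cutting off by the condition -t < h < t
    turns it into an integral over the whole line of a jointly measurable function, to which
    Tonelli's theorem applies. *)
Lemma measurable_ball_integral f : measurable_fun X f ->
  measurable_fun setT (fun z : R * R => \int[mu]_(h in `](- z.2)%R, z.2[%classic)
    `|finite_difference X M h f z.1|%:E)%E.
Proof.
move=> mf.
pose phi (z : R * R * R) : \bar R := if (- z.1.2 < z.2) && (z.2 < z.1.2)
  then `|finite_difference X M z.2 f z.1.1|%:E else 0%E.
have mphi : measurable_fun setT phi.
  have m12 : measurable_fun setT (fun z : R * R * R => z.1.2).
    exact: (measurableT_comp measurable_snd measurable_fst).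
  apply: measurable_fun_ifT => //.
    by apply: measurable_and; apply: measurable_fun_ltr => //; exact: measurableT_comp.
  apply/measurable_EFinP; apply: measurableT_comp => //.
  apply: (measurableT_comp (measurable_finite_difference2 X_itv M mf)
    (g := fun z : R * R * R => (z.1.1, z.2))).
  apply: measurable_fun_pair => //.
  exact: (measurableT_comp measurable_fst measurable_fst).
have := @measurable_integral_param R _ _ _ _ mu setT phi measurableT.
rewrite setTX => /(_ _) h.
have : measurable_fun setT (fun z : R * R => \int[mu]_h phi (z, h))%E.
  by apply: h => [|z h _]; [exact: mphi|rewrite /phi; case: ifP => //= _; rewrite lee_fin].
congr measurable_fun; apply/funext => z.
rewrite [RHS]integral_mkcond; apply: eq_integral => h' _.
by rewrite patchE /phi mem_setE in_itv.
Qed.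

Lemma measurable_area_density2 f : measurable_fun X f ->
  measurable_fun (setT `*` I01) (fun z : R * R => area_density f z.1 z.2).
Proof.
move=> mf.
have mTI : measurable (setT `*` I01 : set (R * R)) by exact: measurableX.
apply: emeasurable_funM.
  apply/measurable_EFinP/measurable_funTS.
  exact: (measurableT_comp (measurable_powR _)).
apply: emeasurable_funM; last by apply: measurable_funTS; exact: measurable_ball_integral.
apply/measurable_EFinP.
apply: (measurable_comp (F := I01) (f := fun t : R => t^-1)) => //.
  by move=> _ [[x t] [_ It] <-].
  exact: measurable_inv01.
by apply: measurable_funTS; exact: measurable_snd.
Qed.

Lemma measurable_area_density f x : measurable_fun X f ->
  measurable_fun I01 (area_density f x).
Proof.
move=> /measurable_area_density2 m2.
apply: (measurable_comp (F := setT `*` I01) _ _ m2 (g := fun t => (x, t))).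
- exact: measurableX.
- by move=> _ [t It <-].
- by apply: measurable_funTS; exact: measurable_pair1.
Qed.

Lemma measurable_area_fun f : measurable_fun X f -> measurable_fun setT (area_fun f).
Proof.
move=> mf; apply: (measurableT_comp (measurable_poweR _)).
apply: (@measurable_integral_param R _ _ _ _ mu I01
  (fun z => ((area_density f z.1 z.2) `^ q * (z.2^-1)%:E)%E)) => //.
  apply: emeasurable_funM.
    apply: (measurableT_comp (measurable_poweR q)).
    exact: measurable_area_density2.
  apply/measurable_EFinP.
  apply: (measurable_comp (F := I01) (f := fun t : R => t^-1)) => //.
    by move=> _ [[x t] [_ It] <-].
    exact: measurable_inv01.
  by apply: measurable_funTS; exact: measurable_snd.
by move=> x t It; rewrite mule_ge0 ?poweR_ge0// lee_fin w0.
Qed.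

Let mfdh f x (t : R) : measurable_fun X f ->
  measurable_fun `](- t)%R, t[%classic (fun h => `|finite_difference X M h f x|%:E).
Proof.
move=> mf; apply/measurable_EFinP/measurable_funTS/measurableT_comp => //.
apply: (measurableT_comp (measurable_finite_difference2 X_itv M mf) (g := fun h => (x, h))).
exact: measurable_pair1.
Qed.

Lemma area_fun_quasi (f g : R -> R) x : measurable_fun X f -> measurable_fun X g ->
  (area_fun (f \- g)%R x <=
    ((2 * (2 * 1) `^ q) `^ q^-1)%:E * (area_fun f x + area_fun g x))%E.
Proof.
move=> mf mg; have mfg : measurable_fun X (f \- g)%R by exact: measurable_funB.
apply: weighted_norm_quasi => //; try exact: area_density_ge0;
  try exact: measurable_area_density; first exact: measurable_inv01.
move=> t It; have /andP[t0 _] : 0 < t < 1 by rewrite /= in_itv/= in It.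
rewrite mul1e /area_density /ball_mean.
have i0 k : (0 <= \int[mu]_(h in `](- t)%R, t[%classic) `|finite_difference X M h k x|%:E)%E.
  by apply: integral_ge0 => h _; rewrite lee_fin.
rewrite -ge0_muleDr ?mule_ge0 ?lee_fin ?w0// lee_wpmul2l ?lee_fin ?powR_ge0//.
rewrite -ge0_muleDr// lee_wpmul2l ?lee_fin ?w0//.
have := @ge0_integral_quasi _ _ R mu `](- t)%R, t[%classic _
  (fun h => `|finite_difference X M h f x|%:E)
  (fun h => `|finite_difference X M h g x|%:E)
  (fun h => `|finite_difference X M h (f \- g)%R x|%:E) 1.
rewrite mul1e; apply=> //; try exact: mfdh.
by move=> h _; rewrite finite_differenceB mul1e -EFinD lee_fin ler_normB.
Qed.

(** Two nested applications of Fatou's lemma at a fixed [x]: in [h] inside the ball mean, and in [t]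
    outside it. *)
Lemma area_fun_fatou f (u : nat -> R -> R) x : measurable_fun X f ->
  (forall n, measurable_fun X (u n)) ->
  {ae mu, forall h, finite_difference X M h (u n) x @[n --> \oo] -->
                    finite_difference X M h f x} ->
  (area_fun f x <= limn_einf (fun n => area_fun (u n) x))%E.
Proof.
move=> mf mu' uf; apply: weighted_norm_fatou => //; try exact: area_density_ge0;
  try exact: measurable_area_density;
  try by move=> n; try exact: area_density_ge0; exact: measurable_area_density.
  exact: measurable_inv01.
apply: nearW => t It.
have i0 k : (0 <= \int[mu]_(h in `](- t)%R, t[%classic) `|finite_difference X M h k x|%:E)%E.
  by apply: integral_ge0 => h _; rewrite lee_fin.
apply: muleR_limn_einf; first exact: powR_ge0.
  by move=> n; rewrite mule_ge0// lee_fin w0.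
apply: muleR_limn_einf => //; first exact: w0.
apply: fatou_ae => //; try exact: mfdh; try by move=> n; exact: mfdh.
by apply: filterS uf => h uh _; exact: normr_limn_einf.
Qed.

(** Here [x] is fixed and [h] varies, the opposite of the Besov case. The node of index [j > 0] is
    affine in [h] with slope [j], which pulls null sets back to null sets; the node [j = 0] is [x]
    itself, where convergence is assumed. *)
Lemma ae_ae_finite_difference_cvg (u : nat -> R -> R) f :
  {ae mu, forall x, X x -> u n x @[n --> \oo] --> f x} ->
  {ae mu, forall x, X x -> {ae mu, forall h,
    finite_difference X M h (u n) x @[n --> \oo] --> finite_difference X M h f x}}.
Proof.
move=> uf; apply: filterS (uf) => x ufx Xx.
have : {ae mu, forall h (j : 'I_M.+1), X (x + j%:R * h) ->
    u n (x + j%:R * h) @[n --> \oo] --> f (x + j%:R * h)}.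
  apply: filter_forall => j; have [j0|j0] := posnP j.
    by apply: nearW => h _; rewrite j0 mul0r addr0; exact: ufx.
  have jR : 0 < j%:R :> R by rewrite ltr0n.
  exact: (ae_affine x jR uf).
by apply: filterS => h; exact: finite_difference_cvg.
Qed.

Lemma triebel_lizorkin_norm_lsc : lsc_quasinorm X (triebel_lizorkin_norm X s p q).
Proof.
have -> : triebel_lizorkin_norm X s p q = fun f =>
    (Lp_norm X p f + weighted_norm mu X p (cst 1%R) (area_fun f))%E.
  by apply/funext => f; exact: triebel_lizorkin_normE.
apply: lsc_quasinormD (Lp_norm_lsc mX p_gt0) _.
have area0 f x : (0 <= area_fun f x)%E by exact: poweR_ge0.
have mA f : measurable_fun X f -> measurable_fun X (area_fun f).
  by move=> mf; apply: measurable_funTS; exact: measurable_area_fun.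
split=> [f||f u mf mu' uf]; first exact: poweR_ge0.
- set K := ((2 * (2 * 1) `^ q) `^ q^-1).
  exists ((2 * (2 * K) `^ p) `^ p^-1) => [|f g mf mg]; first exact: powR_ge0.
  apply: weighted_norm_quasi => //; try exact: mA.
  + exact: powR_ge0.
  + by apply: mA; exact: measurable_funB.
  + by move=> x _; exact: area_fun_quasi.
- apply: weighted_norm_fatou => //; [exact: mA|by move=> n; exact: mA|].
  apply: filterS (ae_ae_finite_difference_cvg uf) => x h Xx.
  by apply: area_fun_fatou => //; exact: h.
Qed.

End TriebelLizorkin.

(** * Test functions and weak derivatives *)

Section Bump.
Context {R : realType}.

(** The classical flat function exp(-1/y) with extra powers of 1/y, whose linear combinations are
    stable under differentiation. *)
Definition flat_exp (k : nat) (y : R) : R :=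
  if 0 < y then y ^- k * expR (- y^-1) else 0.

Lemma flat_exp_ge0 k y : 0 <= flat_exp k y.
Proof.
rewrite /flat_exp; case: ifPn => // y0.
by rewrite mulr_ge0 ?expR_ge0// invr_ge0 exprn_ge0// ltW.
Qed.

(** With t = 1/y the bound reads t^(k+1) <= (k+1)! exp t, one term of the exponential series. It
    provides continuity at 0. *)
Lemma flat_exp_le k y : flat_exp k y <= k.+1`!%:R * `|y|.
Proof.
rewrite /flat_exp; case: ifPn => [y0|_]; last by rewrite mulr_ge0.
rewrite gtr0_norm// -exprVn; set t := y^-1.
have t0 : 0 < t by rewrite invr_gt0.
have yE : y = t^-1 by rewrite invrK.
have h : t ^+ k.+1 <= k.+1`!%:R * expR t.
  rewrite -ler_pdivrMl ?ltr0n ?fact_gt0// mulrC.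
  by have := expR_ge1Dxn k (ltW t0); apply: le_trans; rewrite lerDr.
rewrite expRN ler_pdivrMr ?expR_gt0// mulrAC yE ler_pdivlMr//.
by rewrite -exprSr.
Qed.

Lemma flat_exp0 k : flat_exp k 0 = 0.
Proof. by rewrite /flat_exp ltxx. Qed.

Lemma is_derive_flat_exp k (y : R) :
  is_derive y 1 (flat_exp k) (flat_exp k.+2 y - k%:R * flat_exp k.+1 y).
Proof.
have [y0|y0|<-] := ltgtP 0 y.
- have nE : {near y, (fun z => z ^- k * expR (- z^-1)) =1 flat_exp k}.
    by near=> z; rewrite /flat_exp ifT//; near: z; exact: lt_nbhsr.
  apply: near_eq_is_derive nE _.
  (* The logarithmic form exp(-k ln z - 1/z) avoids differentiating a negative power. *)
  pose u (z : R) := - (k%:R * ln z) - z^-1.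
  have nE : {near y, (expR \o u) =1 (fun z => z ^- k * expR (- z^-1))}.
    near=> z; have z0 : 0 < z by near: z; exact: lt_nbhsr.
    by rewrite /= /u expRD expRN expRM_natl lnK.
  apply: near_eq_is_derive nE _.
  have dV : is_derive y 1 (fun z : R => z^-1) (- y ^- 2).
    by apply: is_derive_eq; [apply: is_deriveV; rewrite gt_eqF|rewrite /= scaler1].
  have dln : is_derive y 1 (@ln R) y^-1 by exact: is_derive1_ln.
  have du : is_derive y 1 u (- (k%:R * y^-1) + y ^- 2).
    by rewrite -[y ^- 2]opprK; apply: is_deriveB; apply: is_deriveN; exact: is_deriveZ.
  have := is_derive1_comp (is_derive_expR (u y)) du.
  move=> /is_derive_eq; apply.
  rewrite /flat_exp y0 /= /u expRD expRN expRM_natl lnK// !exprS; field.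
  by rewrite expf_neq0 gt_eqF.
- have nE : {near y, cst 0 =1 flat_exp k}.
    near=> z; rewrite /flat_exp ifF//; apply/negbTE; rewrite -leNgt ltW//.
    by near: z; exact: lt_nbhsl.
  apply: near_eq_is_derive nE _.
  by rewrite /flat_exp ltNge (ltW y0)/= mulr0 subr0; exact: is_derive_cst.
(* At 0 the difference quotient [flat_exp k z / z] is [flat_exp k.+1 z]: the next member of the
   family is the Caratheodory slope. *)
- apply/is_derive1_caratheodory; exists (flat_exp k.+1); split.
  + move=> z; rewrite flat_exp0 !subr0 /flat_exp.
    case: ifPn => z0; last by rewrite mul0r.
    have zn0 : z != 0 by rewrite gt_eqF.
    by rewrite exprSr; field; rewrite ?expf_neq0 ?zn0.
  + rewrite /prop_for /continuous_at flat_exp0.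
    apply: (@squeeze_cvgr _ _ _ _ (cst 0) (fun z => k.+2`!%:R * `|z|)).
    * apply: nearW => z; rewrite /= flat_exp_ge0. by rewrite flat_exp_le.
    * exact: cvg_cst.
    * rewrite -[X in _ --> X](mulr0 (k.+2`!%:R)).
      by apply: cvgM; [exact: cvg_cst|rewrite -[X in _ --> X](normr0 R); exact: norm_continuous].
  + by rewrite !flat_exp0 mulr0 subr0.
Unshelve. all: by end_near. Qed.

(* A class of functions closed under differentiation, hence of smooth ones. *)
Inductive bumpy : (R -> R) -> Prop :=
  | bumpy_flat k a b : bumpy (fun x => flat_exp k (a * x + b))
  | bumpy_scale c f : bumpy f -> bumpy (fun x => c * f x)
  | bumpy_add f g : bumpy f -> bumpy g -> bumpy (fun x => f x + g x)
  | bumpy_mul f g : bumpy f -> bumpy g -> bumpy (fun x => f x * g x).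

Lemma bumpy_derive f : bumpy f ->
  exists2 g, bumpy g & forall x : R, is_derive x 1 f (g x).
Proof.
elim=> {f} [k a b|c f _ [f' bf' df]|f g _ [f' bf' df] _ [g' bg' dg]
  |f g bf [f' bf' df] bg [g' bg' dg]].
- exists (fun x => a * (flat_exp k.+2 (a * x + b) +
    (- k%:R) * flat_exp k.+1 (a * x + b))).
    by apply: bumpy_scale; apply: bumpy_add;
      [exact: bumpy_flat|apply: bumpy_scale; exact: bumpy_flat].
  move=> x; have da : is_derive x 1 (fun x : R => a * x + b) a.
    rewrite -[X in is_derive _ _ _ X]addr0.
    by apply: is_deriveD; rewrite -[X in is_derive _ _ _ X]mulr1; exact: is_deriveZ.
  have := @is_derive1_comp _ (flat_exp k) (fun x => a * x + b) x _ _
    (is_derive_flat_exp k (a * x + b)) da.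
  by move=> /is_derive_eq; apply; rewrite mulrC mulNr.
- exists (fun x => c * f' x); first exact: bumpy_scale.
  by move=> x; exact: is_deriveZ.
- exists (fun x => f' x + g' x); first exact: bumpy_add.
  by move=> x; exact: is_deriveD.
- exists (fun x => f x * g' x + g x * f' x).
    by apply: bumpy_add; exact: bumpy_mul.
  by move=> x; exact: is_deriveM.
Qed.

Lemma bumpy_derive1n f j : bumpy f -> bumpy (derive1n j f).
Proof.
move=> bf; elim: j => [|j IH] //; have [g bg dg] := bumpy_derive IH.
suff -> : derive1n j.+1 f = g by [].
by apply/funext => x; rewrite derive1nS derive1E; have [_ ->] := dg x.
Qed.

Lemma bumpy_derivable f j (x : R) : bumpy f -> derivable (derive1n j f) x 1.
Proof.
by move=> /(bumpy_derive1n j)/bumpy_derive[g _ /(_ x)[]].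
Qed.

(** Vanishes outside [c, d] for every [m], while the dilation by m + 1 steepens both ends so that
    the limit is the indicator of ]c, d[. *)
Definition bump (c d : R) (m : nat) (x : R) : R :=
  flat_exp 0 (m.+1%:R * (x - c)) * flat_exp 0 (m.+1%:R * (d - x)).

Lemma bump_test (X : set R) c d m : `[c, d]%classic `<=` X^° ->
  test_function X (bump c d m).
Proof.
move=> cdX; split=> [j x|]; last first.
  exists c, d; split=> // x /=; rewrite in_itv/= => /negP.
  rewrite negb_and -!ltNge /bump /flat_exp => /orP[xc|dx].
    by rewrite ifF ?mul0r// pmulr_rgt0// subr_gt0 ltNge ltW.
  by rewrite [X in _ * X]ifF ?mulr0// pmulr_rgt0// subr_gt0 ltNge ltW.
apply: bumpy_derivable.
have -> : bump c d m = fun x => flat_exp 0 (m.+1%:R * x + - (m.+1%:R * c)) *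
    flat_exp 0 (- m.+1%:R * x + m.+1%:R * d).
  by apply/funext => y; rewrite /bump; congr (flat_exp _ _ * flat_exp _ _); ring.
by apply: bumpy_mul; exact: bumpy_flat.
Qed.

Lemma flat_exp_01 (y : R) : 0 <= flat_exp 0 y <= 1.
Proof.
rewrite flat_exp_ge0/= /flat_exp; case: ifPn => // y0.
by rewrite expr0 invr1 mul1r expR_le1 oppr_le0 invr_ge0 ltW.
Qed.

Lemma bump_01 c d m x : 0 <= bump c d m x <= 1.
Proof.
have /andP[u0 u1] := flat_exp_01 (m.+1%:R * (x - c)).
have /andP[v0 v1] := flat_exp_01 (m.+1%:R * (d - x)).
by rewrite /bump mulr_ge0//= mulr_ile1.
Qed.

Lemma bump_cvg c d x : bump c d m x @[m --> \oo] --> (\1_(`]c, d[%classic : set R) x : R).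
Proof.
have h (y : R) : 0 < y -> flat_exp 0 (m.+1%:R * y) @[m --> \oo] --> (1 : R).
  move=> y0; rewrite /flat_exp.
  rewrite (_ : (fun m : nat => _) = (fun m : nat => expR (- (y^-1 * m.+1%:R^-1)))); last first.
    by apply/funext => m; rewrite pmulr_rgt0// y0 expr0 invr1 mul1r invfM mulrC.
  rewrite -[X in _ --> X](expR0 R).
  apply: continuous_cvg; first exact: continuous_expR.
  rewrite -[X in _ --> X]oppr0; apply: cvgN; rewrite -[X in _ --> X](mulr0 y^-1).
  by apply: cvgM; [exact: cvg_cst|exact: cvg_harmonic].
have [xI|xI] := boolP (x \in `]c, d[); rewrite indicE mem_setE ?xI.
  move: xI; rewrite in_itv/= => /andP[cx xd].
  by rewrite -[X in _ --> X]mulr1; apply: cvgM; apply: h; rewrite subr_gt0.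
rewrite (negPf xI); move: xI; rewrite in_itv/= negb_and -!leNgt => xcd.
rewrite (_ : (fun m => _) = cst 0); first exact: cvg_cst.
apply/funext => m; rewrite /bump /flat_exp; case/orP: xcd => [xc|dx].
  by rewrite ifF ?mul0r// pmulr_rgt0// subr_gt0 ltNge xc.
by rewrite [X in _ * X]ifF ?mulr0// pmulr_rgt0// subr_gt0 ltNge dx.
Qed.

Lemma measurable_bump c d m : measurable_fun setT (bump c d m).
Proof.
apply: continuous_measurable_fun => x.
have [bt _] : test_function setT (bump c d m) by apply: bump_test; rewrite interiorT.
exact/differentiable_continuous/derivable1_diffP/(bt 0%N).
Qed.

End Bump.

Section DuBoisReymond.
Context {R : realType} (a b : R) (ab : a < b) (ca cb : bool).
Local Notation mu := (@lebesgue_measure R).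
Local Notation X := ([set` Interval (BSide ca a) (BSide cb b)] : set R).

Lemma itv_sub_interior c d : a < c -> d < b -> `[c, d]%classic `<=` X^°.
Proof.
move=> ac db x /=; rewrite in_itv/= => /andP[cx xd].
apply: (@filterS _ _ _ `]a, b[%classic).
  move=> y /=; rewrite !in_itv/= => /andP[ay yb].
  by rewrite !lteifS.
apply: (@open_nbhs_nbhs _ x); split; first exact: itv_open.
by rewrite /= in_itv/= (lt_le_trans ac)//= (le_lt_trans xd).
Qed.

(** Dominated convergence along [bump c d m] shows that [g] has integral zero over ]c, d[ whenever a
    < c and d < b. Its primitive from [c] then vanishes, and by Lebesgue differentiation that
    primitive has derivative [g] almost everywhere. *)
Lemma du_bois_reymond (g : R -> R) : mu.-integrable X (EFin \o g) ->
  (forall phi, test_function X phi -> \int[mu]_(x in X) (g x * phi x) = 0) ->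
  {ae mu, forall x, X x -> g x = 0}.
Proof.
move=> ig g0; have mX : measurable X by exact: measurable_itv.
have mg : measurable_fun X g by apply/measurable_EFinP; exact: measurable_int ig.
have itv0 c d : a < c -> d < b -> (\int[mu]_(x in X) (g x * \1_(`]c, d[%classic : set R) x)%:E = 0)%E.
  move=> ac db.
  pose f_ m x := (g x * bump c d m x)%:E.
  pose f x := (g x * \1_(`]c, d[%classic : set R) x)%:E.
  have mf_ m : measurable_fun X (f_ m).
    apply/measurable_EFinP; apply: measurable_funM => //.
    exact: measurable_funTS (measurable_bump c d m).
  have mf : measurable_fun X f.
    by apply/measurable_EFinP; apply: measurable_funM => //; exact: measurable_indic.
  have f_f : {ae mu, forall x, X x -> f_ ^~ x @ \oo --> f x}.
    apply: nearW => x _; apply: cvg_EFin; first exact: nearW.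
    by apply: cvgM; [exact: cvg_cst|exact: bump_cvg].
  have f_g : {ae mu, forall x n, X x -> (`|f_ n x| <= `|g x|%:E)%E}.
    apply: nearW => x m _; rewrite /f_ abse_EFin lee_fin normrM.
    by have /andP[b0 b1] := bump_01 c d m x; rewrite ler_piMr// ger0_norm.
  have ig' : mu.-integrable X (fun x => `|g x|%:E) by exact: integrable_norm ig.
  have [_ _ h] := @dominated_convergence _ _ R mu X mX f_ f (fun x => `|g x|%:E) mf_ mf f_f ig' f_g.
  rewrite -(cvg_lim _ h)//; apply/cvg_lim => //.
  rewrite (_ : (fun n => _) = cst 0%E); first exact: cvg_cst.
  apply/funext => m; have := g0 (bump c d m) (bump_test m (itv_sub_interior ac db)).
  have if_ : mu.-integrable X (f_ m).
    apply: (@le_integrable _ _ _ mu X mX (f_ m) (fun x => `|g x|%:E)) => // [|x Xx]; first exact: mf_.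
    have /andP[b0 b1] := bump_01 c d m x.
    by rewrite /f_ !abse_EFin normr_id lee_fin normrM ler_piMr// ger0_norm.
  by rewrite /Rintegral => g0m; rewrite -[LHS]fineK ?g0m//; exact: integrable_fin_num if_.
pose G := g \_ X.
have iG : mu.-integrable setT (EFin \o G).
  by rewrite /G -restrict_EFin; apply/integrable_restrict => //; rewrite setTI.
have G0 c : a < c -> {ae mu, forall x, c < x < b -> g x = 0}.
  move=> ac; pose F x := \int[mu]_(t in `]c, x]) G t.
  have iGi (i : interval R) : mu.-integrable [set` i] (EFin \o G).
    by move: iG; apply: integrableS => //; exact: measurable_itv.
  have lG : locally_integrable setT G by exact: open_integrable_locally openT iG.
  have F0 x : c < x < b -> F x = 0.
    move=> /andP[cx xb]; rewrite /F -Rintegral_itv_bndo_bndc//.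
    rewrite /Rintegral -[RHS]/(fine 0%E) -(itv0 c x ac xb) integral_mkcond [in RHS]integral_mkcond.
    congr fine; apply: eq_integral => y _; rewrite !patchE indicE /G patchE.
    have [yI|yI] := boolP (y \in (`]c, x[%classic : set R)); last first.
      by case: ifP => // _; rewrite mulr0.
    have -> : y \in X.
      move: yI; rewrite !mem_setE !in_itv/= => /andP[cy yx].
      by rewrite !lteifS// ?(lt_trans ac)// (lt_trans yx).
    by rewrite mulr1.
  have := FTC1 (fun y => iGi (Interval (BRight c) (BRight y))) lG.
  apply: filterS => x /= h /andP[cx xb].
  have [_] := h cx.
  rewrite -/F => F'; rewrite -(_ : G x = g x); last first.
    rewrite /G patchE mem_setE in_itv/= !lteifS//; exact: lt_trans cx.
  rewrite -F' derive1E (near_eq_derive (g := cst 0)); first by rewrite derive_cst.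
  near=> y; apply: F0; near: y.
  by apply: (@near_in_itvoo R c b); rewrite in_itv/= cx.
(* The points [a] and [b] may belong to X; they are discarded as null, and the base points
   [a + 1 / (n + 1)] exhaust the rest. *)
have n0 (c : R) : {ae mu, forall x, x != c}.
  exists [set c]; split; [exact: measurable_set1|exact: lebesgue_measure_set1|].
  by move=> x /= /negP; rewrite negbK => /eqP.
have acn n : a < a + n.+1%:R^-1 by rewrite ltrDl invr_gt0.
have := ae_foralln (fun n => G0 (a + n.+1%:R^-1) (acn n)).
apply: filterS2 (filterI (n0 a) (n0 b)) => x [xa xb] h /=.
rewrite in_itv/= => /andP[ax bx].
have {}ax : a < x by rewrite lt_neqAle eq_sym xa; exact: lteifW ax.
have {}bx : x < b by rewrite lt_neqAle xb; exact: lteifW bx.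
have [n nx] : exists n, a + n.+1%:R^-1 < x.
  have xa0 : 0 < x - a by rewrite subr_gt0.
  exists (Num.truncn (x - a)^-1); rewrite -ltrBrDl invf_plt ?posrE//.
  exact: truncnS_gt.
by apply: (h n); rewrite nx.
Unshelve. all: by end_near. Qed.

End DuBoisReymond.

Section WeakDerivative.
Context {R : realType} (a b : R) (ab : a < b) (ca cb : bool).
Variables (p : R) (p_ge1 : 1 <= p).
Local Notation mu := (@lebesgue_measure R).
Local Notation X := ([set` Interval (BSide ca a) (BSide cb b)] : set R).

Let mX : measurable X. Proof. exact: measurable_itv. Qed.

Lemma bounded_itv_finite : (mu X < +oo)%E.
Proof. by rewrite lebesgue_measure_itv/= lte_fin ab -EFinB ltry. Qed.

Lemma in_Lp_integrable f : in_Lp X p f -> mu.-integrable X (EFin \o f).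
Proof.
move=> [mf Lf]; apply/integrableP; split; first exact/measurable_EFinP.
have Lfin : Lp_norm X p f = (fine (Lp_norm X p f))%:E.
  by rewrite fineK// ge0_fin_numE// Lnorm_ge0.
have := @L1_le_Lp _ X mX p p_ge1 bounded_itv_finite f (fine (Lp_norm X p f)) 1.
rewrite mulr1 -Lfin => /(_ (fine_ge0 (Lnorm_ge0 _ _ _)) ltr01 mf (lexx _)).
by move=> /le_lt_trans; apply; rewrite ltry.
Qed.

Section TestFunction.
Variables (phi : R -> R) (j : nat).
Hypothesis tphi : test_function X phi.

Lemma test_function_continuous : continuous (derive1n j phi).
Proof.
by move=> x; have [h _] := tphi; exact/differentiable_continuous/derivable1_diffP/(h j).
Qed.

Lemma test_function_bounded :
  exists2 B : R, 0 <= B & forall x, X x -> `|derive1n j phi x| <= B.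
Proof.
have cn : {within `[a, b], continuous (fun x => `|derive1n j phi x|)}.
  apply: continuous_subspaceT => x; apply: continuous_comp.
    exact: test_function_continuous.
  exact: norm_continuous.
have [c _ hc] := EVT_max (ltW ab) cn.
exists `|derive1n j phi c| => // x /=; rewrite in_itv/= => /andP[ax xb].
by apply: hc; rewrite in_itv/= (lteifW ax) (lteifW xb).
Qed.

Lemma measurable_test_function : measurable_fun X (derive1n j phi).
Proof.
by apply: measurable_funTS; apply: continuous_measurable_fun;
  exact: test_function_continuous.
Qed.

Lemma integrable_test_function f : mu.-integrable X (EFin \o f) ->
  mu.-integrable X (EFin \o (fun x => f x * derive1n j phi x)).
Proof.
move=> fi; have [B B0 hB] := test_function_bounded.
have mf : measurable_fun X f by apply/measurable_EFinP; exact: measurable_int fi.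
have iBf : mu.-integrable X (fun x => B%:E * (EFin \o f) x)%E.
  exact: integrableZl.
apply: (@le_integrable _ _ _ mu X mX _ (fun x => B%:E * (EFin \o f) x)%E) => //.
  apply/measurable_EFinP; apply: measurable_funM => //.
  exact: measurable_test_function.
move=> x Xx; rewrite /= lee_fin !normrM mulrC (ger0_norm B0).
by rewrite ler_wpM2r// hB.
Qed.

(* The integral against a fixed test function is continuous for the Lp norm. *)
Lemma Rintegral_test_cvg0 : exists2 B : R, 0 <= B & forall (v : R -> R) (e : R),
  0 < e -> measurable_fun X v -> (Lp_norm X p v <= e%:E)%E ->
  `|\int[mu]_(x in X) (v x * derive1n j phi x)| <= B * e.
Proof.
have [B B0 hB] := test_function_bounded.
(* [B] bounds the test function, and [mu X + 1] is the constant of [L1_le_Lp] for [C = 1] and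
   [l = e]. *)
exists (B * (fine (mu X) + 1)) => [|v e e0 mv ve].
  by rewrite mulr_ge0// addr_ge0// fine_ge0.
have Lv : in_Lp X p v by split=> //; rewrite (le_lt_trans ve)// ltry.
have iv := in_Lp_integrable Lv.
have ivt := integrable_test_function iv.
rewrite -lee_fin; apply: (@le_trans _ _ (\int[mu]_(x in X) `|(v x * derive1n j phi x)%:E|)%E).
  by rewrite EFin_normr_Rintegral//; apply: le_abse_integral => //; exact: measurable_int ivt.
have mav : measurable_fun X (fun x => `|v x|%:E).
  by apply/measurable_EFinP/measurableT_comp.
apply: (@le_trans _ _ (\int[mu]_(x in X) (B%:E * `|v x|%:E))%E).
  apply: ge0_le_integral => //.
  - by apply: measurableT_comp => //; exact: measurable_int ivt.
  - exact: measurable_funeM.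
  - by move=> x Xx; rewrite /= -EFinM lee_fin normrM mulrC ler_wpM2r// hB.
rewrite ge0_integralZl_EFin// -mulrA EFinM lee_wpmul2l ?lee_fin//.
have := @L1_le_Lp _ X mX p p_ge1 bounded_itv_finite v 1 e ler01 e0 mv.
by rewrite mul1r powR1; apply.
Qed.

End TestFunction.

Lemma weak_derivativeB j f1 f2 g1 g2 : in_Lp X p f1 -> in_Lp X p f2 ->
  in_Lp X p g1 -> in_Lp X p g2 ->
  weak_derivative X j f1 g1 -> weak_derivative X j f2 g2 ->
  weak_derivative X j (f1 \- f2) (g1 \- g2).
Proof.
move=> /in_Lp_integrable Lf1 /in_Lp_integrable Lf2.
move=> /in_Lp_integrable Lg1 /in_Lp_integrable Lg2 w1 w2 phi tphi.
have E (f g h : R -> R) : \int[mu]_(x in X) ((f \- g) x * h x) =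
    \int[mu]_(x in X) (f x * h x - g x * h x).
  by apply: eq_Rintegral => x _ /=; rewrite mulrBl.
rewrite !E !RintegralB ?w1 ?w2 ?mulrBr//;
  by [exact: (integrable_test_function 0 tphi)|exact: integrable_test_function].
Qed.

Lemma ae_eq_Rintegral f g : measurable_fun X f -> measurable_fun X g ->
  {ae mu, forall x, X x -> f x = g x} ->
  \int[mu]_(x in X) f x = \int[mu]_(x in X) g x.
Proof.
move=> mf mg fg; rewrite /Rintegral; congr fine.
apply: ae_eq_integral => //; try exact/measurable_EFinP.
by apply: filterS fg => x h Xx; rewrite h.
Qed.

Lemma eq_weak_derivative j f1 f2 g : measurable_fun X f1 -> measurable_fun X f2 ->
  {ae mu, forall x, X x -> f1 x = f2 x} ->
  weak_derivative X j f1 g -> weak_derivative X j f2 g.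
Proof.
move=> m1 m2 f12 w phi tphi; rewrite -w//; apply: ae_eq_Rintegral.
- by apply: measurable_funM => //; exact: measurable_test_function.
- by apply: measurable_funM => //; exact: measurable_test_function.
- by apply: filterS f12 => x h Xx; rewrite h.
Qed.

Lemma weak_derivative_unique j f g1 g2 : in_Lp X p g1 -> in_Lp X p g2 ->
  weak_derivative X j f g1 -> weak_derivative X j f g2 ->
  {ae mu, forall x, X x -> g1 x = g2 x}.
Proof.
move=> /in_Lp_integrable ig1 /in_Lp_integrable ig2 w1 w2.
have : {ae mu, forall x, X x -> (g1 \- g2) x = 0}.
  apply: (@du_bois_reymond _ a b ca cb).
    rewrite (_ : EFin \o _ = (EFin \o g1) \- (EFin \o g2))%E; last exact/funext.
    exact: integrableB.
  move=> phi tphi; rewrite (_ : \int[mu]_(x in X) _ =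
      \int[mu]_(x in X) (g1 x * phi x - g2 x * phi x)); last first.
    by apply: eq_Rintegral => x _ /=; rewrite mulrBl.
  rewrite RintegralB//; last 2 first.
  - exact: (integrable_test_function 0 tphi ig1).
  - exact: (integrable_test_function 0 tphi ig2).
  apply/eqP; rewrite subr_eq0; apply/eqP.
  apply: (@mulrI _ ((-1) ^+ j)); first by rewrite unitrX// unitrN unitr1.
  by rewrite -(w1 _ tphi) -(w2 _ tphi).
by apply: filterS => x h Xx; apply/eqP; rewrite -subr_eq0; apply/eqP; exact: h.
Qed.

(** Against a fixed test function both sides of the defining identity are continuous for the L^p
    norm, so the identity survives a simultaneous approximation of [f] and [g]. *)
Lemma weak_derivative_lim j f g (u v : nat -> R -> R) :
  in_Lp X p f -> in_Lp X p g ->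
  (forall n, in_Lp X p (u n)) -> (forall n, in_Lp X p (v n)) ->
  (forall n, weak_derivative X j (u n) (v n)) ->
  (forall e : R, 0 < e -> exists n, (Lp_norm X p (f \- u n)%R <= e%:E)%E /\
                             (Lp_norm X p (g \- v n)%R <= e%:E)%E) ->
  weak_derivative X j f g.
Proof.
move=> Lf Lg Lu Lv w lim phi tphi.
have [B1 B10 h1] := Rintegral_test_cvg0 j tphi.
have [B2 B20 h2] := Rintegral_test_cvg0 0 tphi.
apply/eqP; rewrite -subr_eq0 -normr_le0; apply/ler_addgt0Pr => e e0; rewrite add0r.
have B0 : 0 < B1 + B2 + 1 by rewrite ltr_wpDl// addr_ge0.
have [n [fun_ gvn]] := lim (e / (B1 + B2 + 1)) (divr_gt0 e0 B0).
have := h1 _ _ (divr_gt0 e0 B0) (measurable_funB Lf.1 (Lu n).1) fun_.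
have := h2 _ _ (divr_gt0 e0 B0) (measurable_funB Lg.1 (Lv n).1) gvn.
have E (k1 k2 h : R -> R) : \int[mu]_(x in X) ((k1 \- k2) x * h x) =
    \int[mu]_(x in X) (k1 x * h x - k2 x * h x).
  by apply: eq_Rintegral => x _ /=; rewrite mulrBl.
rewrite !E !RintegralB//; try (by apply: integrable_test_function => //; exact: in_Lp_integrable);
  try (by apply: (integrable_test_function 0 tphi); exact: in_Lp_integrable).
rewrite (w n _ tphi) /= => hg hf.
set If := \int[mu]_(x in X) (f x * _) in hf *.
set Ig := \int[mu]_(x in X) (g x * _) in hg *.
set Iv := \int[mu]_(x in X) (v n x * _) in hf hg.
have -> : If - (-1) ^+ j * Ig = (If - (-1) ^+ j * Iv) - (-1) ^+ j * (Ig - Iv) by ring.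
apply: le_trans (ler_normB _ _) _; rewrite normrM normrX normrN1 expr1n mul1r.
apply: le_trans (lerD hf hg) _.
by rewrite -mulrDl mulrA ler_pdivrMr// mulrC ler_wpM2l ?(ltW e0)// lerDl.
Qed.

End WeakDerivative.

(** * Sobolev-Slobodeckij spaces *)

Section Gagliardo.
Context {R : realType} (X : set R) (mX : measurable X).
Variables (sigma p : R) (p_gt0 : 0 < p).
Local Notation mu := (@lebesgue_measure R).

Definition gagliardo_density (f : R -> R) (x y : R) : \bar R :=
  (`|f x - f y| `^ p / `|x - y| `^ (1 + sigma * p))%:E.

Lemma gagliardo_density_ge0 f x y : (0 <= gagliardo_density f x y)%E.
Proof. by rewrite lee_fin divr_ge0// powR_ge0. Qed.

Lemma gagliardo_density_quasi (f g : R -> R) x y :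
  (gagliardo_density (f \- g)%R x y <=
    ((2 * 1) `^ p)%:E * (gagliardo_density f x y + gagliardo_density g x y))%E.
Proof.
rewrite /gagliardo_density -EFinD -EFinM lee_fin -mulrDl mulrA.
rewrite ler_wpM2r ?invr_ge0 ?powR_ge0// -lee_fin EFinM EFinD -!poweR_EFin.
apply: poweR_quasi => //; rewrite mul1e -EFinD lee_fin.
rewrite [X in `|X|](_ : _ = (f x - f y) - (g x - g y)); last by rewrite /=; ring.
exact: ler_normB.
Qed.

Lemma measurable_gagliardo_density f : measurable_fun X f ->
  measurable_fun (X `*` X) (fun z : R * R => gagliardo_density f z.1 z.2).
Proof.
move=> mf; have mXX : measurable (X `*` X : set (R * R)) by exact: measurableX.
have m1 : measurable_fun (X `*` X) (fun z : R * R => f z.1).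
  apply: (measurable_comp (F := X)) => //; first by move=> _ [[x y] [Xx _] <-].
  exact: measurable_funTS.
have m2 : measurable_fun (X `*` X) (fun z : R * R => f z.2).
  apply: (measurable_comp (F := X)) => //; first by move=> _ [[x y] [_ Xy] <-].
  exact: measurable_funTS.
apply/measurable_EFinP; apply: measurable_funM.
  apply: (measurableT_comp (measurable_powR p)); apply: measurableT_comp => //.
  exact: measurable_funB.
under eq_fun do rewrite -powRN.
apply: (measurableT_comp (measurable_powR _)); apply: measurableT_comp => //.
by apply: measurable_funTS; exact: measurable_funB.
Qed.

Lemma measurable_gagliardo_density1 f x : X x -> measurable_fun X f ->
  measurable_fun X (gagliardo_density f x).
Proof.
move=> Xx /measurable_gagliardo_density m.
apply: (measurable_comp (F := X `*` X) _ _ m (g := fun y => (x, y))).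
- exact: measurableX.
- by move=> _ [y Xy <-].
- by apply: measurable_funTS; exact: measurable_pair1.
Qed.

Lemma measurable_gagliardo_inner f : measurable_fun X f ->
  measurable_fun X (fun x => \int[mu]_(y in X) gagliardo_density f x y)%E.
Proof.
move=> mf.
pose psi (z : R * R) := ((fun z : R * R => gagliardo_density f z.1 z.2) \_ (X `*` X)) z.
have mpsi : measurable_fun setT psi.
  apply/(measurable_restrictT _ (measurableX mX mX)).
  exact: measurable_gagliardo_density.
have := @measurable_integral_param R _ _ _ _ mu X psi mX (measurable_funTS mpsi).
have psi0 x y : X y -> (0 <= psi (x, y))%E.
  by rewrite /psi patchE; case: ifPn => // _ _; exact: gagliardo_density_ge0.
move=> /(_ psi0) m; apply: (@eq_measurable_fun _ _ _ _ _
    (fun x => \int[mu]_(y in X) psi (x, y))%E); last exact: measurable_funTS.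
move=> x /set_mem Xx; apply: eq_integral => y /set_mem Xy.
by rewrite /psi patchE mem_set.
Qed.

(** [gagliardo] carries no p-th root, so the natural estimate is a quasi-triangle inequality with
    constant 2^p, which is all that [lsc_quasinorm] asks for. Semicontinuity is Fatou's lemma in [y]
    nested in Fatou's lemma in [x]. *)
Lemma gagliardo_lsc : lsc_quasinorm X (gagliardo X sigma p).
Proof.
have int0 f x : (0 <= \int[mu]_(y in X) gagliardo_density f x y)%E.
  by apply: integral_ge0 => y _; exact: gagliardo_density_ge0.
split=> [f||f u mf mu' uf].
- by apply: integral_ge0 => x _; exact: int0.
- exists ((2 * 1) `^ p) => [|f g mf mg]; first exact: powR_ge0.
  have mfg : measurable_fun X (f \- g) by exact: measurable_funB.
  apply: ge0_integral_quasi => //; try exact: powR_ge0;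
    try exact: measurable_gagliardo_inner; try by move=> x _; exact: int0.
  move=> x Xx; apply: ge0_integral_quasi => //; try exact: measurable_gagliardo_density1;
    try exact: powR_ge0; try by move=> y _; exact: gagliardo_density_ge0.
  by move=> y _; exact: gagliardo_density_quasi.
- apply: fatou_ae => //; try exact: measurable_gagliardo_inner;
    try by move=> *; exact: int0.
    by move=> n; exact: measurable_gagliardo_inner.
  apply: filterS (uf) => x ux Xx.
  apply: fatou_ae => //; try exact: measurable_gagliardo_density1;
    try by move=> *; exact: gagliardo_density_ge0.
    by move=> n; exact: measurable_gagliardo_density1.
  apply: filterS (uf) => y uy Xy.
  have uxy : u n x - u n y @[n --> \oo] --> f x - f y.
    by apply: cvgB; [exact: ux|exact: uy].
  rewrite /gagliardo_density mulrC EFinM.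
  under eq_fun do rewrite mulrC EFinM.
  apply: muleR_limn_einf; [by rewrite invr_ge0 powR_ge0|by move=> n; rewrite lee_fin powR_ge0|].
  rewrite -poweR_EFin; under eq_fun do rewrite -poweR_EFin.
  by apply: poweR_limn_einf => //; exact: normr_limn_einf.
Qed.

End Gagliardo.

Section QuasinormFamily.
Context {R : realType} (X : set R).
Local Notation mu := (@lebesgue_measure R).

Lemma lsc_quasinorm_pow (E : (R -> R) -> \bar R) (r : R) : 0 < r ->
  lsc_quasinorm X E -> lsc_quasinorm X (fun f => E f `^ r)%E.
Proof.
move=> r0 HE; have E0 := quasinorm_ge0 HE; split=> [f||f u mf mu' uf].
- exact: poweR_ge0.
- have [K K0 q] := quasinorm_quasi HE.
  exists ((2 * K) `^ r) => [|f g mf mg]; first exact: powR_ge0.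
  by apply: poweR_quasi => //; exact: q.
- by apply: poweR_limn_einf => //; exact: (quasinorm_lsc HE).
Qed.

Variables (m : nat) (E : nat -> (R -> R) -> \bar R).
Hypothesis HE : forall j, lsc_quasinorm X (E j).

Lemma sum_quasinorm_ge0 (g : nat -> R -> R) : (0 <= \sum_(j < m) E j (g j))%E.
Proof. by apply: sume_ge0 => j _; exact: (quasinorm_ge0 (HE j)). Qed.

Lemma sum_quasinorm_quasi : exists2 K : R, 0 <= K & forall f g : nat -> R -> R,
  (forall j, (j < m)%N -> measurable_fun X (f j)) ->
  (forall j, (j < m)%N -> measurable_fun X (g j)) ->
  (\sum_(j < m) E j (f j \- g j)%R <=
    K%:E * (\sum_(j < m) E j (f j) + \sum_(j < m) E j (g j)))%E.
Proof.
have ex j : exists K : R, 0 <= K /\ forall f g : R -> R,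
    measurable_fun X f -> measurable_fun X g ->
    (E j (f \- g)%R <= K%:E * (E j f + E j g))%E.
  by have [K K0 q] := quasinorm_quasi (HE j); exists K.
have [K HK] := choice ex.
have K0 j : 0 <= K j by have [] := HK j.
exists (\sum_(j < m) K j) => [|f g mf mg]; first exact: sumr_ge0.
rewrite -big_split/= ge0_sume_distrr; last first.
  by move=> j _; apply: adde_ge0; exact: (quasinorm_ge0 (HE j)).
apply: lee_sum => j _; have [_ q] := HK j.
apply: le_trans (q _ _ (mf j (ltn_ord j)) (mg j (ltn_ord j))) _.
rewrite lee_wpmul2r ?adde_ge0 ?(quasinorm_ge0 (HE j))// lee_fin.
by rewrite (bigD1 j)//= lerDl sumr_ge0.
Qed.

Lemma sum_quasinorm_lsc (f : nat -> R -> R) (u : nat -> nat -> R -> R) :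
  (forall j, (j < m)%N -> measurable_fun X (f j)) ->
  (forall j n, (j < m)%N -> measurable_fun X (u n j)) ->
  (forall j, (j < m)%N ->
    {ae mu, forall x, X x -> u n j x @[n --> \oo] --> f j x}) ->
  (\sum_(j < m) E j (f j) <= limn_einf (fun n => \sum_(j < m) E j (u n j)))%E.
Proof.
elim: m => [|k IH] mf mu' uf.
  rewrite big_ord0 -[X in (X <= _)%E](limn_einf_cst 0%E); apply: le_limn_einf => n.
  by rewrite big_ord0.
rewrite big_ord_recr/=.
have -> : (fun n => \sum_(j < k.+1) E j (u n j))%E =
    (fun n => \sum_(j < k) E j (u n j) + E k (u n k))%E.
  by apply/funext => n; rewrite big_ord_recr.
have E0 j h := quasinorm_ge0 (HE j) h.
apply: adde_limn_einf => //.
- by apply: sume_ge0 => j _; exact: E0.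
- by move=> n; apply: sume_ge0 => j _; exact: E0.
- by apply: IH => [j jk|j n jk|j jk]; [apply: mf|apply: mu'|apply: uf]; exact: ltnW.
- by apply: (quasinorm_lsc (HE k)) => [|n|]; [exact: mf|exact: mu'|exact: uf].
Qed.

End QuasinormFamily.

Section Sobolev.
Context {R : realType} (a b : R) (ab : a < b) (ca cb : bool).
Variables (s p : R) (p_ge1 : 1 <= p).
Local Notation mu := (@lebesgue_measure R).
Local Notation X := ([set` Interval (BSide ca a) (BSide cb b)] : set R).
Local Notation m := (Num.truncn s).
Local Notation sigma := (s - m%:R).
Local Notation wd := (weak_derive X p).

Let mX : measurable X. Proof. exact: measurable_itv. Qed.
Let p_gt0 : 0 < p. Proof. exact: lt_le_trans p_ge1. Qed.
Let X_fin : (mu X < +oo)%E. Proof. exact: bounded_itv_finite. Qed.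

(** The summand of order [j] under the root of the Sobolev norm. Attaching the Gagliardo term to
    [j = m] presents that sum as a family of quasinorms, each evaluated at its own weak
    derivative. *)
Definition sobolev_term (j : nat) (f : R -> R) : \bar R :=
  (Lp_norm X p f `^ p +
    (if (j == m) && (sigma != 0%R) then gagliardo X sigma p f else 0))%E.

Local Notation E := sobolev_term.

Lemma sobolev_term_lsc j : lsc_quasinorm X (E j).
Proof.
apply: lsc_quasinormD; first exact: lsc_quasinorm_pow (Lp_norm_lsc mX p_gt0).
case: (_ && _); first exact: gagliardo_lsc.
split=> [f||f u _ _ _] //; last by rewrite limn_einf_cst.
by exists 0 => // f g _ _; rewrite mul0e.
Qed.

Let HE := sobolev_term_lsc.

Lemma sobolev_normE f : sobolev_norm X s p f =
  ((\sum_(j < m.+1) E j (wd j f)) `^ p^-1)%E.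
Proof.
rewrite /sobolev_norm /E; congr (_ `^ _)%E; rewrite big_split/=; congr (_ + _)%E.
rewrite big_ord_recr/= eqxx/= big1 ?add0e; last first.
  by move=> j _; rewrite ltn_eqF.
by case: eqP.
Qed.

Lemma Lp_norm_le_term j f : (Lp_norm X p f `^ p <= E j f)%E.
Proof.
rewrite leeDl//; case: ifP => // _.
exact: (quasinorm_ge0 (gagliardo_lsc mX _ p_gt0)).
Qed.

Lemma weak_deriveP j f : (exists g, in_Lp X p g /\ weak_derivative X j f g) ->
  in_Lp X p (wd j f) /\ weak_derivative X j f (wd j f).
Proof.
move=> ex.
exact: (@xgetPex _ (fun=> 0) [set g | in_Lp X p g /\ weak_derivative X j f g] ex).
Qed.

Lemma weak_derive_eq j f g : in_Lp X p g -> weak_derivative X j f g ->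
  {ae mu, forall x, X x -> wd j f x = g x}.
Proof.
move=> Lg wg; have [Lw ww] := weak_deriveP (ex_intro _ g (conj Lg wg)).
exact: (weak_derivative_unique ab p_ge1 Lw Lg ww wg).
Qed.

Lemma weak_derivative0 f : weak_derivative X 0 f f.
Proof. by move=> phi _; rewrite expr0 mul1r. Qed.

Section Derivatives.
Variables (f : R -> R) (h : nat -> R -> R).
Hypothesis Lf : in_Lp X p f.
Hypothesis Lh : forall j, (j < m.+1)%N -> in_Lp X p (h j).
Hypothesis wh : forall j, (j < m.+1)%N -> weak_derivative X j f (h j).

(** The chosen representatives [wd j] need not depend linearly on the function. Uniqueness up to
    null sets lets the norm be computed from any family of weak derivatives, such as
    [wd j f - wd j g] for [f - g]. *)
Lemma sobolev_norm_derivatives : sobolev_norm X s p f =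
  ((\sum_(j < m.+1) E j (h j)) `^ p^-1)%E.
Proof.
rewrite sobolev_normE.
apply: (congr1 (fun z : \bar R => z `^ p^-1)%E).
apply: eq_bigr => j _.
have [Lw _] := weak_deriveP (ex_intro _ (h j) (conj (Lh (ltn_ord j)) (wh (ltn_ord j)))).
apply: (quasinorm_ae_eq (HE j) Lw.1 (Lh (ltn_ord j)).1).
by apply: weak_derive_eq; [exact: Lh|exact: wh].
Qed.

Lemma in_sobolev_derivatives : (\sum_(j < m.+1) E j (h j) < +oo)%E ->
  in_sobolev X s p f.
Proof.
move=> fin; split=> // [j jm|].
  by exists (h j); split; [exact: Lh|exact: wh].
by rewrite sobolev_norm_derivatives poweR_lty.
Qed.

End Derivatives.

Lemma in_sobolevP f : in_sobolev X s p f ->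
  [/\ in_Lp X p f, forall j, (j < m.+1)%N -> in_Lp X p (wd j f),
      forall j, (j < m.+1)%N -> weak_derivative X j f (wd j f) &
      (\sum_(j < m.+1) E j (wd j f) < +oo)%E].
Proof.
move=> [Lf ex fin]; split=> // [j jm|j jm|].
- by have [] := weak_deriveP (ex j jm).
- by have [] := weak_deriveP (ex j jm).
- move: fin; rewrite sobolev_normE; apply: lty_poweRy.
  by rewrite invr_neq0// gt_eqF.
Qed.

Let quasi_lty (f g : nat -> R -> R) :
  (forall j, (j < m.+1)%N -> in_Lp X p (f j)) ->
  (forall j, (j < m.+1)%N -> in_Lp X p (g j)) ->
  (\sum_(j < m.+1) E j (f j) < +oo)%E -> (\sum_(j < m.+1) E j (g j) < +oo)%E ->
  (\sum_(j < m.+1) E j (f j \- g j)%R < +oo)%E.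
Proof.
move=> Lf Lg ff fg; have [K K0 q] := sum_quasinorm_quasi m.+1 HE.
apply: le_lt_trans (q _ _ (fun j jm => (Lf j jm).1) (fun j jm => (Lg j jm).1)) _.
apply: lte_mul_pinfty; [by rewrite lee_fin|exact: isT|exact: lte_add_pinfty ff fg].
Qed.

Let LpB f g : in_Lp X p f -> in_Lp X p g -> in_Lp X p (f \- g).
Proof.
move=> [mf Lf] [mg Lg]; split; first exact: measurable_funB.
exact: (quasinorm_ltyB (Lp_norm_lsc mX p_gt0)).
Qed.

Lemma sobolevB f g : in_sobolev X s p f -> in_sobolev X s p g ->
  in_sobolev X s p (f \- g) /\ sobolev_norm X s p (f \- g) =
    ((\sum_(j < m.+1) E j (wd j f \- wd j g)%R) `^ p^-1)%E.
Proof.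
move=> /in_sobolevP[Lf Lwf wf ff] /in_sobolevP[Lg Lwg wg fg].
have Lh j : (j < m.+1)%N -> in_Lp X p (wd j f \- wd j g).
  by move=> jm; apply: LpB; [exact: Lwf|exact: Lwg].
have wh j : (j < m.+1)%N -> weak_derivative X j (f \- g) (wd j f \- wd j g).
  move=> jm; apply: (weak_derivativeB ab p_ge1 Lf Lg (Lwf _ jm) (Lwg _ jm)).
    exact: wf.
  exact: wg.
split; last exact: (@sobolev_norm_derivatives _ (fun j => wd j f \- wd j g)).
apply: (@in_sobolev_derivatives _ (fun j => wd j f \- wd j g));
  [exact: LpB|exact: Lh|exact: wh|exact: (quasi_lty Lwf Lwg ff fg)].
Qed.

(** Almost everywhere convergence of [u n] does not control its weak derivatives, so semicontinuity
    is not sought for [sobolev_norm] as a function of [u n] alone. Each sequence of derivatives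
    converges in L^p by itself, the limits are weak derivatives of the limit, and semicontinuity is
    applied to the sum over the orders. *)
Lemma sobolev_banach_like :
  banach_like (fun f => in_sobolev X s p f /\ (sobolev_norm X s p f < +oo)%E)
    (fine \o sobolev_norm X s p) (within X (almost_everywhere mu)).
Proof.
have S0 f : (0 <= sobolev_norm X s p f)%E by rewrite sobolev_normE poweR_ge0.
have Sfin f : (sobolev_norm X s p f < +oo)%E ->
    sobolev_norm X s p f = (fine (sobolev_norm X s p f))%:E.
  by move=> Ef; rewrite fineK// ge0_fin_numE.
have sub f g : in_sobolev X s p f -> in_sobolev X s p g ->
    in_sobolev X s p (f \- g) /\ (sobolev_norm X s p (f \- g)%R < +oo)%E.
  by move=> Ff Fg; have [Fd _] := sobolevB Ff Fg; split=> //; have [] := Fd.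
have sum0 (h : nat -> R -> R) : (0 <= \sum_(j < m.+1) E j (h j))%E.
  exact: sum_quasinorm_ge0.
have pV0 : 0 < p^-1 by rewrite invr_gt0.
have powK (x : \bar R) : (0 <= x -> (x `^ p^-1) `^ p = x)%E.
  by move=> x0; rewrite -poweRrM mulVf ?gt_eqF// poweRe1.
have powVK (x : \bar R) : (0 <= x -> (x `^ p) `^ p^-1 = x)%E.
  by move=> x0; rewrite -poweRrM mulfV ?gt_eqF// poweRe1.
split.
- by move=> f; exact: fine_ge0.
- by move=> f g [Ff _] [Fg _]; exact: sub.
- have [K K0 q] := sum_quasinorm_quasi m.+1 HE.
  exists ((2 * K) `^ p^-1) => [|f g [Ff Sf] [Fg Sg]]; first exact: powR_ge0.
  have [Fd dE] := sobolevB Ff Fg; have [_ Sd] := sub _ _ Ff Fg.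
  suff : (sobolev_norm X s p (f \- g)%R <= ((2 * K) `^ p^-1)%:E *
      (sobolev_norm X s p f + sobolev_norm X s p g))%E.
    by rewrite (Sfin _ Sd) (Sfin _ Sf) (Sfin _ Sg) -EFinD -EFinM lee_fin.
  rewrite dE !sobolev_normE.
  have [_ Lwf _ _] := in_sobolevP Ff; have [_ Lwg _ _] := in_sobolevP Fg.
  apply: (poweR_quasi K0 pV0 (sum0 (fun j => wd j f)) (sum0 (fun j => wd j g))
    (sum0 (fun j => wd j f \- wd j g))).
  by apply: (q (fun j => wd j f) (fun j => wd j g)) => j jm;
    [exact: (Lwf j jm).1|exact: (Lwg j jm).1].
- move=> f g [Ff _] [Fg _] fg.
  suff SS : sobolev_norm X s p f = sobolev_norm X s p g by rewrite !compE SS.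
  have [Lf Lwf wf _] := in_sobolevP Ff; have [Lg _ _ _] := in_sobolevP Fg.
  have wg j : (j < m.+1)%N -> weak_derivative X j g (wd j f).
    by move=> jm; exact: (eq_weak_derivative Lf.1 Lg.1 fg (wf j jm)).
  by rewrite (sobolev_norm_derivatives Lwf wg) sobolev_normE.
- move=> f [Ff Sf] f0; have [Lf Lwf wf _] := in_sobolevP Ff.
  have S00 : sobolev_norm X s p f = 0%E by rewrite (Sfin _ Sf) -[fine _]/((fine \o sobolev_norm X s p) f) f0.
  have sum00 : (\sum_(j < m.+1) E j (wd j f) = 0)%E.
    have sW : (0 <= \sum_(j < m.+1) E j (wd j f))%E by exact: (sum0 (fun j => wd j f)).
    by rewrite -(powK _ sW) -sobolev_normE S00 poweR0r// gt_eqF.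
  (* A function is its own weak derivative of order 0, so the vanishing of this single term gives
     [f = 0] almost everywhere. *)
  have L0 : Lp_norm X p (wd 0 f) = 0%E.
    apply: (poweR_eq0_eq0 (r := p)); first exact: Lnorm_ge0.
    apply/eqP; rewrite eq_le poweR_ge0 andbT -sum00.
    apply: le_trans (Lp_norm_le_term 0 _) _.
    rewrite (bigD1 ord0)//= leeDl// sume_ge0// => j _.
    exact: (quasinorm_ge0 (HE j)).
  have w0 := Lp_norm_eq0 mX p_ge1 (Lwf 0%N (ltn0Sn _)).1 L0.
  apply: filterS2 w0 (weak_derive_eq Lf (weak_derivative0 f)) => x w0 wf0 Xx.
  by rewrite -wf0// w0.
- move=> u C gamma g01 Fu Cu.
  have Wu n := in_sobolevP (Fu n).1.
  pose v j n := wd j (u n).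
  have Lv j n : (j < m.+1)%N -> in_Lp X p (v j n) by have [_ h _ _] := Wu n; exact: h.
  have Cg0 n : 0 <= C * gamma ^+ n by apply: le_trans (Cu n 0%N); exact: fine_ge0.
  have sumC n k : (\sum_(j < m.+1) E j (v j (n + k)%N \- v j n)%R <=
      ((C * gamma ^+ n) `^ p)%:E)%E.
    have [_ dE] := sobolevB (Fu (n + k)%N).1 (Fu n).1.
    have [_ Sd] := sub _ _ (Fu (n + k)%N).1 (Fu n).1.
    have h : (sobolev_norm X s p (u (n + k)%N \- u n)%R <= (C * gamma ^+ n)%:E)%E.
      by rewrite (Sfin _ Sd) lee_fin; exact: Cu.
    rewrite dE in h.
    have := le_poweR (ltW p_gt0) (poweR_ge0 _ _) h.
    by rewrite (powK _ (sum0 (fun j => v j (n + k)%N \- v j n))).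
  have LC j n k : (j < m.+1)%N ->
      (Lp_norm X p (v j (n + k)%N \- v j n)%R <= (C * gamma ^+ n)%:E)%E.
    move=> jm; rewrite -[leLHS]powVK ?Lnorm_ge0//.
    rewrite -[leRHS]powVK ?lee_fin//.
    apply: le_poweR; [exact: ltW|exact: poweR_ge0|].
    apply: le_trans (Lp_norm_le_term j _) _; apply: le_trans (sumC n k).
    rewrite (bigD1 (Ordinal jm))//= leeDl// sume_ge0// => i _.
    exact: (quasinorm_ge0 (HE i)).
  have HLp := lsc_banach_like mX p_ge1 X_fin (Lp_norm_lsc mX p_gt0) (fun f => lexx _).
  have exh j : exists h : R -> R, (j < m.+1)%N -> [/\ in_Lp X p h,
      exists D : R, forall n, (Lp_norm X p (h \- v j n)%R <= (D * gamma ^+ n)%:E)%E &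
      {ae mu, forall x, X x -> v j n x @[n --> \oo] --> h x}].
    have [jm|jm] := boolP (j < m.+1)%N; last by exists (fun=> 0).
    have [|n k|h [Lh [D hD] _ ch]] := inF_complete HLp (u := v j) (C := C) g01.
    - by move=> n; split; [exact: Lv|exact: (Lv j n jm).2].
    - rewrite -lee_fin /= fineK ?LC// ge0_fin_numE ?Lnorm_ge0//.
      by rewrite (le_lt_trans (LC j n k jm))// ltry.
    exists h => _; split=> //; first by case: Lh.
    exists D => n; have := hD n; rewrite -lee_fin /= fineK// ge0_fin_numE ?Lnorm_ge0//.
    by have [] := LpB Lh.1 (Lv j n jm).
  have [h hP] := choice exh.
  have Lh j : (j < m.+1)%N -> in_Lp X p (h j) by move=> /hP[].
  have ch j : (j < m.+1)%N -> {ae mu, forall x, X x -> v j n x @[n --> \oo] --> h j x}.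
    by move=> /hP[].
  (* The choice is not [h 0], which agrees with this function only almost everywhere: the limit must
     follow [u] itself at every point of convergence. *)
  pose f := lim_fun u.
  have uv0 : {ae mu, forall x n, X x -> v 0%N n x = u n x}.
    apply: ae_foralln => n; have [Lu _ _ _] := Wu n.
    exact: weak_derive_eq Lu (weak_derivative0 _).
  have cu : {ae mu, forall x, X x -> u n x @[n --> \oo] --> h 0%N x}.
    apply: filterS2 uv0 (ch 0%N (ltn0Sn _)) => x uvx cx Xx.
    rewrite (_ : u ^~ x = v 0%N ^~ x); first exact: cx.
    by apply/funext => n; rewrite uvx.
  have fcu : {ae mu, forall x, X x -> u n x @[n --> \oo] --> f x}.
    apply: filterS cu => x /[apply] cx; apply: lim_funP.
    by apply/cvg_ex; eexists; exact: cx.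
  have fh : {ae mu, forall x, X x -> f x = h 0%N x}.
    apply: filterS2 fcu cu => x fx hx Xx.
    exact: (cvg_unique _ (fx Xx) (hx Xx)).
  have mf : measurable_fun X f.
    by apply: measurable_lim_fun => n; have [[]] := Wu n.
  have HL := Lp_norm_lsc mX p_gt0.
  have Lf : in_Lp X p f.
    split=> //; rewrite (quasinorm_ae_eq HL mf (Lh 0%N (ltn0Sn _)).1 fh).
    by have [] := Lh 0%N (ltn0Sn _).
  have Lfu n : Lp_norm X p (f \- u n)%R = Lp_norm X p (h 0%N \- v 0%N n)%R.
    have [Lu _ _ _] := Wu n.
    apply: (quasinorm_ae_eq HL); [exact: (LpB Lf Lu).1|exact: (LpB (Lh _ _) (Lv _ _ _)).1|].
    by apply: filterS2 fh uv0 => x fx uvx Xx /=; rewrite fx// uvx.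
  have small D (e : R) : 0 < e -> \forall n \near \oo, D * gamma ^+ n <= e.
    move=> e0; have : D * gamma ^+ n @[n --> \oo] --> D * 0.
      apply: cvgM; [exact: cvg_cst|apply: cvg_expr].
      by have /andP[g0 g1] := g01; rewrite ger0_norm.
    rewrite mulr0 => /cvgrPdist_le/(_ e e0); apply: filterS => n.
    by rewrite sub0r normrN; exact: le_trans (ler_norm _).
  have wf j : (j < m.+1)%N -> weak_derivative X j f (h j).
    move=> jm; apply: (weak_derivative_lim ab p_ge1 Lf (Lh j jm) (u := u) (v := v j)).
    - by move=> n; have [] := Wu n.
    - by move=> n; exact: Lv.
    - by move=> n; have [_ _ w _] := Wu n; exact: w.
    move=> e e0; have [_ [D0 hD0] _] := hP 0%N (ltn0Sn _); have [_ [D hD] _] := hP j jm.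
    have [n [n0 nj]] := filter_ex (filterI (small D0 e e0) (small D e e0)).
    exists n; rewrite Lfu; split; first by rewrite (le_trans (hD0 n))// lee_fin.
    by rewrite (le_trans (hD n))// lee_fin.
  have sumh n : (\sum_(j < m.+1) E j (h j \- v j n)%R <= ((C * gamma ^+ n) `^ p)%:E)%E.
    apply: le_trans (limn_einf_le (sumC n)).
    apply: (@sum_quasinorm_lsc _ X m.+1 _ HE (fun j => h j \- v j n)
      (fun k j => v j (n + k)%N \- v j n)).
    + by move=> j jm; exact: (LpB (Lh j jm) (Lv j n jm)).1.
    + by move=> j k jm; exact: (LpB (Lv j _ jm) (Lv j n jm)).1.
    + move=> j jm; apply: filterS (ch j jm) => x cx Xx; apply: cvgB; last exact: cvg_cst.
      have := cx Xx; rewrite -(cvg_shiftn n); apply: cvg_trans.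
      by under eq_fun do rewrite addnC.
  have fin_h : (\sum_(j < m.+1) E j (h j) < +oo)%E.
    rewrite (_ : (\sum_(j < m.+1) _)%E = (\sum_(j < m.+1) E j
        ((h j \- v j 0%N) \- ((v j 0%N \- v j 0%N) \- v j 0%N))%R)%E); last first.
      by apply: eq_bigr => j _; congr (E _ _); apply/funext => x /=; ring.
    have [_ _ _ fin0] := Wu 0%N.
    have LB j : (j < m.+1)%N -> in_Lp X p ((v j 0%N \- v j 0%N) \- v j 0%N).
      by move=> jm; apply: LpB; [apply: LpB; exact: Lv|exact: Lv].
    apply: (quasi_lty (f := fun j => h j \- v j 0%N)
        (g := fun j => (v j 0%N \- v j 0%N) \- v j 0%N)).
    + by move=> j jm; apply: LpB; [exact: Lh|exact: Lv].
    + exact: LB.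
    + exact: le_lt_trans (sumh 0%N) (ltry _).
    have Lv0 j : (j < m.+1)%N -> in_Lp X p (v j 0%N) by exact: Lv.
    apply: (quasi_lty (f := fun j => v j 0%N \- v j 0%N) (g := fun j => v j 0%N)).
    + by move=> j jm; apply: LpB; exact: Lv.
    + exact: Lv0.
    + exact: (quasi_lty Lv0 Lv0).
    + exact: fin0.
  have Ff : in_sobolev X s p f by exact: (in_sobolev_derivatives Lf Lh wf).
  exists f; split.
  + by split=> //; case: Ff.
  + exists C => n; have [_ Sd] := sub _ _ Ff (Fu n).1.
    have [Lu _ w _] := Wu n.
    have LB j : (j < m.+1)%N -> in_Lp X p (h j \- v j n).
      by move=> jm; apply: LpB; [exact: Lh|exact: Lv].
    have wB j : (j < m.+1)%N -> weak_derivative X j (f \- u n) (h j \- v j n).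
      move=> jm; apply: (weak_derivativeB ab p_ge1 Lf Lu (Lh j jm) (Lv j n jm)).
        exact: wf.
      exact: w.
    suff : (sobolev_norm X s p (f \- u n)%R <= (C * gamma ^+ n)%:E)%E.
      by rewrite (Sfin _ Sd) lee_fin.
    rewrite (sobolev_norm_derivatives (h := fun j => h j \- v j n) LB wB).
    rewrite -[leRHS]powVK ?lee_fin//.
    by apply: le_poweR; [exact: ltW|exact: (sum0 (fun j => h j \- v j n))|exact: sumh].
  + by move=> x; exact: lim_funP.
  + exact: fcu.
Qed.

End Sobolev.

(** * Spaces of smooth functions *)

Section RelativeDerivative.
Context {R : realType} (a b : R) (ab : a < b) (ca cb : bool).
Local Notation X := ([set` Interval (BSide ca a) (BSide cb b)] : set R).
Implicit Types (f g : R -> R) (x y : R).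

Lemma itv_between x y z : X x -> X y -> x <= z <= y -> X z.
Proof. by move=> Xx Xy; exact: (@interval_is_interval R _ _ _ Xx Xy). Qed.

(** As [a < b], every point of X is a limit of other points of X: the witness lies to the right when
    [x < b] and to the left when [x] is the right end. Properness makes the derivative relative to X
    unique. *)
Lemma within_itv_proper x : X x -> ProperFilter (within X x^').
Proof.
move=> Xx; apply: Build_ProperFilter => -[e /= e0 eA].
have ball_A y : X y -> y != x -> `|y - x| < e -> False.
  by move=> Xy yx xye; apply: (eA y) => //=; rewrite distrC.
have := Xx; rewrite /= in_itv/= => /andP[/lteifW ax /lteifW xb].
have [xltb|bx] := ltP x b.
  have d0 : 0 < Num.min e (b - x) by rewrite lt_min e0 subr_gt0.
  have de : Num.min e (b - x) <= e by rewrite ge_min lexx.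
  have db : Num.min e (b - x) <= b - x by rewrite ge_min lexx orbT.
  set d := Num.min _ _ in d0 de db.
  apply: (ball_A (x + d / 2)).
  - by rewrite /= in_itv/= !lteifS//; lra.
  - by rewrite gt_eqF//; lra.
  - by rewrite addrC addKr gtr0_norm; lra.
have axb : a < x by exact: lt_le_trans bx.
have d0 : 0 < Num.min e (x - a) by rewrite lt_min e0 subr_gt0.
have de : Num.min e (x - a) <= e by rewrite ge_min lexx.
have db : Num.min e (x - a) <= x - a by rewrite ge_min lexx orbT.
set d := Num.min _ _ in d0 de db.
apply: (ball_A (x - d / 2)).
- by rewrite /= in_itv/= !lteifS//; lra.
- by rewrite lt_eqF//; lra.
- by rewrite addrC addKr normrN gtr0_norm; lra.
Qed.

Lemma eq_difference_quotient f g x y : X x -> X y ->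
  (forall z, X z -> f z = g z) ->
  difference_quotient f x y = difference_quotient g x y.
Proof. by move=> Xx Xy fg; rewrite /difference_quotient !fg. Qed.

Lemma eq_difference_quotient_cvg f g x (l : R) : X x -> (forall z, X z -> f z = g z) ->
  difference_quotient f x y @[y --> within X x^'] --> l ->
  difference_quotient g x y @[y --> within X x^'] --> l.
Proof.
move=> Xx fg; apply: cvg_trans; apply: near_eq_cvg.
rewrite near_withinE; apply: nearW => y Xy.
exact: eq_difference_quotient.
Qed.

Lemma derive_onP f x : X x -> cvg (difference_quotient f x y @[y --> within X x^']) ->
  difference_quotient f x y @[y --> within X x^'] --> derive_on X f x.
Proof. by []. Qed.

Lemma derive_on_unique f x (l : R) : X x ->
  difference_quotient f x y @[y --> within X x^'] --> l -> derive_on X f x = l.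
Proof.
by move=> Xx; have := within_itv_proper Xx => pX; apply: cvg_lim.
Qed.

Lemma derivable_onE f x : derivable_on X f -> X x ->
  difference_quotient f x y @[y --> within X x^'] --> derive_on X f x.
Proof. by move=> df Xx; apply: derive_onP => //; exact: df. Qed.

Lemma derivable_on_eq f g : (forall x, X x -> f x = g x) ->
  derivable_on X f -> derivable_on X g.
Proof.
move=> fg df x Xx; apply/cvg_ex; exists (derive_on X f x).
by apply: (eq_difference_quotient_cvg Xx fg); exact: derivable_onE.
Qed.

Lemma derive_on_eq f g : derivable_on X f -> (forall x, X x -> f x = g x) ->
  forall x, X x -> derive_on X g x = derive_on X f x.
Proof.
move=> df fg x Xx; apply: derive_on_unique => //.
by apply: (eq_difference_quotient_cvg Xx fg); exact: derivable_onE.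
Qed.

Lemma difference_quotientB f g x y : difference_quotient (f \- g) x y =
  difference_quotient f x y - difference_quotient g x y.
Proof. by rewrite /difference_quotient /= -mulrBl; congr (_ / _); ring. Qed.

Lemma difference_quotientB_cvg f g x : derivable_on X f -> derivable_on X g -> X x ->
  difference_quotient (f \- g) x y @[y --> within X x^'] -->
    derive_on X f x - derive_on X g x.
Proof.
move=> df dg Xx; rewrite (_ : difference_quotient (f \- g) x =
    fun y => difference_quotient f x y - difference_quotient g x y); last first.
  by apply/funext => y; exact: difference_quotientB.
by apply: cvgB; exact: derivable_onE.
Qed.

Lemma derivable_onB f g : derivable_on X f -> derivable_on X g ->
  derivable_on X (f \- g).
Proof.
by move=> df dg x Xx; apply/cvg_ex; eexists; exact: difference_quotientB_cvg.
Qed.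

Lemma derive_onB f g x : derivable_on X f -> derivable_on X g -> X x ->
  derive_on X (f \- g) x = derive_on X f x - derive_on X g x.
Proof. by move=> df dg Xx; apply: derive_on_unique => //; exact: difference_quotientB_cvg. Qed.

Lemma derivable_on_continuous f x : derivable_on X f -> X x ->
  f y @[y --> within X (nbhs x)] --> f x.
Proof.
move=> df Xx; set l := derive_on X f x.
have /cvgrPdist_le/(_ 1 ltr01) h := derivable_onE df Xx.
have h1 : \forall y \near x, y != x -> X y -> `|l - difference_quotient f x y| <= 1.
  exact: h.
apply/cvgrPdist_le => e e0.
have l1 : 0 < `|l| + 1 by rewrite ltr_wpDl.
have h2 : \forall y \near x, `|x - y| <= e / (`|l| + 1).
  have := nbhsx_ballx x _ (divr_gt0 e0 l1).
  by apply: filterS => y; rewrite /ball/= => /ltW.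
rewrite near_withinE; apply: filterS2 h1 h2 => y h1 h2 Xy.
have [->|yx] := eqVneq y x; first by rewrite subrr normr0 ltW.
have -> : f x - f y = difference_quotient f x y * (x - y).
  by rewrite /difference_quotient -opprB -[x - y]opprB mulrN divfK// subr_eq0.
have dl : `|difference_quotient f x y| <= `|l| + 1.
  rewrite (_ : difference_quotient f x y = l - (l - difference_quotient f x y)); last by ring.
  by rewrite (le_trans (ler_normB _ _))// lerD2l; exact: h1.
rewrite normrM (le_trans (ler_pM _ _ dl h2))//.
by rewrite mulrC divfK// gt_eqF.
Qed.

(** Bridge to the two-sided derivative at interior points, where the mean value theorem uses it. *)
Lemma derivable_on_is_derive f x : derivable_on X f -> a < x < b ->
  is_derive x 1 f (derive_on X f x).
Proof.
move=> df /andP[ax xb].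
have nX : \forall y \near x, X y.
  have : \forall y \near x, y \in `]a, b[ by apply: near_in_itvoo; rewrite in_itv/= ax.
  by apply: filterS => y; rewrite /= !in_itv/= => /andP[ay yb]; rewrite !lteifS.
have Xx : X x by exact: nbhs_singleton nX.
apply/is_derive1_caratheodory.
exists (fun y => if y == x then derive_on X f x else difference_quotient f x y).
split; last by rewrite eqxx.
  move=> y; case: eqP => [->|/eqP yx]; first by rewrite !subrr mulr0.
  by rewrite /difference_quotient divfK// subr_eq0.
apply/continuous_withinNx; rewrite eqxx => A /(derivable_onE df Xx) hA.
have nX' : \forall y \near x^', X y by exact: nbhs_dnbhs nX.
have yNx : \forall y \near x^', y != x by exact: nbhs_dnbhs_neq.
apply: filterS3 nX' hA yNx => y Xy hAy yx /=.
by rewrite (negPf yx); exact: hAy.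
Qed.

Lemma mean_value_bound f (e : R) x y : derivable_on X f ->
  (forall z, X z -> `|derive_on X f z| <= e) -> X x -> X y ->
  `|f y - f x| <= e * `|y - x|.
Proof.
move=> df he Xx Xy; wlog xy : x y Xx Xy / x <= y.
  move=> h; have [/h|/ltW yx] := leP x y; first exact.
  by rewrite distrC (distrC y); exact: h.
move: xy; rewrite le_eqVlt => /predU1P[->|xy]; first by rewrite !subrr normr0 mulr0.
have sub z : x <= z <= y -> X z by exact: itv_between.
have hd z : z \in `]x, y[ -> is_derive z 1 f (derive_on X f z).
  rewrite in_itv/= => /andP[xz zy]; apply: derivable_on_is_derive => //.
  move: Xx Xy; rewrite /= !in_itv/= => /andP[ax _] /andP[_ yb].
  by rewrite (le_lt_trans (lteifW ax))//= (lt_le_trans zy)// (lteifW yb).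
have hc : {within `[x, y], continuous f}.
  apply/subspace_continuousP => z /=; rewrite in_itv/= => zxy.
  apply: cvg_trans (derivable_on_continuous df (sub z zxy)).
  move=> A hA; have {}hA : \forall w \near z, X w -> A (f w) by exact: hA.
  suff : \forall w \near z, w \in `[x, y] -> A (f w) by [].
  by apply: filterS hA => w h; rewrite in_itv/= => /sub; exact: h.
have [c] := MVT xy hd hc.
rewrite in_itv/= => /andP[xc cy] ->; rewrite normrM ler_wpM2r//.
by apply: he; apply: sub; rewrite !ltW.
Qed.

(* Termwise differentiation: the difference quotients of [u n] converge
   uniformly, by the mean value inequality applied to [u (n + k) - u n]. *)
Lemma derive_on_lim (u : nat -> R -> R) (C gamma : R) f g :
  0 <= gamma < 1 -> (forall n, derivable_on X (u n)) ->
  (forall n k x, X x -> `|derive_on X (u (n + k)%N) x - derive_on X (u n) x| <= C * gamma ^+ n) ->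
  (forall x, X x -> u n x @[n --> \oo] --> f x) ->
  (forall x, X x -> derive_on X (u n) x @[n --> \oo] --> g x) ->
  forall x, X x -> difference_quotient f x y @[y --> within X x^'] --> g x.
Proof.
move=> /andP[g0 g1] du hC uf ug x Xx.
have dq n y : X y -> y != x ->
    `|difference_quotient f x y - difference_quotient (u n) x y| <= C * gamma ^+ n.
  move=> Xy yx.
  have hk k : `|difference_quotient (u (n + k)%N) x y - difference_quotient (u n) x y|
      <= C * gamma ^+ n.
    rewrite -difference_quotientB /difference_quotient normrM normfV ler_pdivrMr ?normr_gt0 ?subr_eq0//.
    apply: mean_value_bound => //; first exact: derivable_onB.
    by move=> z Xz; rewrite derive_onB//; exact: hC.
  have uk z : X z -> u (n + k)%N z @[k --> \oo] --> f z.
    move=> Xz; have := uf z Xz; rewrite -(cvg_shiftn n); apply: cvg_trans.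
    by under eq_fun do rewrite addnC.
  have c : `|difference_quotient (u (n + k)%N) x y - difference_quotient (u n) x y|
      @[k --> \oo] --> `|difference_quotient f x y - difference_quotient (u n) x y|.
    apply: cvg_norm; apply: cvgB; last exact: cvg_cst.
    by apply: cvgM; [apply: cvgB; exact: uk|exact: cvg_cst].
  rewrite -(cvg_lim _ c)//; apply: limr_le; last exact: nearW.
  by apply/cvg_ex; eexists; exact: c.
apply/cvgrPdist_le => e e0.
have e3 : 0 < e / 3 by rewrite divr_gt0.
have Cg : \forall n \near \oo, C * gamma ^+ n <= e / 3.
  have : C * gamma ^+ n @[n --> \oo] --> C * 0.
    by apply: cvgM; [exact: cvg_cst|apply: cvg_expr; rewrite ger0_norm].
  rewrite mulr0 => /cvgrPdist_le/(_ _ e3); apply: filterS => n.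
  by rewrite sub0r normrN; exact: le_trans (ler_norm _).
have /cvgrPdist_le/(_ _ e3) ug3 := ug x Xx.
have [n [Cn gn]] := filter_ex (filterI Cg ug3).
have /cvgrPdist_le/(_ _ e3) dun := derivable_onE (du n) Xx.
have yNx : \forall y \near within X x^', y != x.
  have : \forall y \near x^', y != x by exact: nbhs_dnbhs_neq.
  by rewrite near_withinE; apply: filterS.
have Xy : \forall y \near within X x^', X y by exact: withinT.
apply: filterS3 dun yNx Xy => y h1 yx Xy.
rewrite (_ : g x - _ = (g x - derive_on X (u n) x) +
  (derive_on X (u n) x - difference_quotient (u n) x y) -
  (difference_quotient f x y - difference_quotient (u n) x y)); last by ring.
apply: le_trans (ler_normB _ _) _.
apply: (@le_trans _ _ ((e / 3 + e / 3) + e / 3)); last by lra.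
apply: lerD; last exact: le_trans (dq n y Xy yx) Cn.
by apply: le_trans (ler_normD _ _) _; apply: lerD.
Qed.

End RelativeDerivative.

Lemma geometric_cauchy_cvg (R : realType) (w : nat -> R) (C gamma : R) :
  0 <= gamma < 1 -> (forall n k, `|w (n + k)%N - w n| <= C * gamma ^+ n) ->
  cvg (w n @[n --> \oo]).
Proof.
move=> /andP[g0 g1] h; apply: cauchy_cvg; apply: cauchy_exP => e e0.
have : C * gamma ^+ n @[n --> \oo] --> C * 0.
  by apply: cvgM; [exact: cvg_cst|apply: cvg_expr; rewrite ger0_norm].
rewrite mulr0 => /cvgrPdist_lt/(_ _ e0)[n _ hn].
exists (w n); exists n => // k /= nk; rewrite -(subnKC nk) /ball/= distrC.
apply: le_lt_trans (h _ _) _; have := hn n (leqnn n).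
by rewrite /= sub0r normrN; exact: le_lt_trans (ler_norm _).
Qed.

Lemma within_continuous_cvg (R : realType) (X : set R) (f : R -> R) :
  {within X, continuous f} ->
  forall x, X x -> f y @[y --> within X (nbhs x)] --> f x.
Proof. by move/subspace_continuousP. Qed.

Lemma cvg_within_continuous (R : realType) (X : set R) (f : R -> R) :
  (forall x, X x -> f y @[y --> within X (nbhs x)] --> f x) ->
  {within X, continuous f}.
Proof. by move=> h; apply/subspace_continuousP. Qed.

Section Smooth.
Context {R : realType} (a b : R) (ab : a < b) (ca cb : bool) (k : nat).
Local Notation X := ([set` Interval (BSide ca a) (BSide cb b)] : set R).
Local Notation D := (derive_on_n X).
Implicit Types f g : R -> R.

Variable top_norm : (R -> R) -> \bar R.
Hypothesis top_ge0 : forall f, (0 <= top_norm f)%E.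
Hypothesis top_eq : forall f g, (forall x, X x -> f x = g x) -> top_norm f = top_norm g.
Hypothesis topB : forall f g, (top_norm (f \- g)%R <= top_norm f + top_norm g)%E.
Hypothesis top_lim : forall f (u : nat -> R -> R) (c : R),
  (forall x, X x -> u n x @[n --> \oo] --> f x) ->
  (forall n, top_norm (u n) <= c%:E)%E -> (top_norm f <= c%:E)%E.

Local Notation smooth := (continuously_differentiable X k).

(** [top_norm] is the seminorm put on the k-th derivative: zero for C^k and [holder_seminorm] for
    C^(k,alpha), so that one proof serves both spaces. *)
Definition smooth_norm f : \bar R := (Ck_norm X k f + top_norm (D k f))%E.

(** The identity of order [j] is known on X only; the induction proceeds because a derivative
    relative to X depends only on values on X. *)
Lemma derive_on_nB f g : smooth f -> smooth g -> forall j, (j <= k)%N ->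
  forall x, X x -> D j (f \- g) x = D j f x - D j g x.
Proof.
move=> [df _] [dg _]; elim=> [//|j IH] jk x Xx.
have dB : derivable_on X (D j f \- D j g).
  by apply: derivable_onB => //; [exact: df|exact: dg].
have E z : X z -> (D j f \- D j g) z = D j (f \- g) z.
  by move=> Xz /=; rewrite IH// ltnW.
rewrite /derive_on_n iterS (derive_on_eq ab dB E Xx).
by rewrite derive_onB//; [exact: df|exact: dg].
Qed.

Lemma smoothB f g : smooth f -> smooth g -> smooth (f \- g).
Proof.
move=> sf sg; have DB := derive_on_nB sf sg; have [df cf] := sf; have [dg cg] := sg.
split=> [j jk|].
  apply: (@derivable_on_eq _ _ _ _ _ (D j f \- D j g)).
    by move=> x Xx; rewrite DB// ltnW.
  by apply: derivable_onB => //; [exact: df|exact: dg].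
have {}cf := within_continuous_cvg cf; have {}cg := within_continuous_cvg cg.
apply: cvg_within_continuous => x Xx; rewrite DB//.
apply: cvg_trans (cvgB (cf x Xx) (cg x Xx)).
apply: near_eq_cvg; rewrite near_withinE; apply: nearW => y Xy.
by rewrite DB.
Qed.

Lemma le_sup_norm f x : X x -> (`|f x|%:E <= sup_norm X f)%E.
Proof. by move=> Xx; apply: ereal_sup_ubound; exists x. Qed.

Lemma sup_norm_le f (c : \bar R) : (forall x, X x -> `|f x|%:E <= c)%E ->
  (sup_norm X f <= c)%E.
Proof. by move=> h; apply: ge_ereal_sup => _ [x Xx <-]; exact: h. Qed.

Lemma itv_midpoint : X ((a + b) / 2).
Proof. by rewrite /= in_itv/= !lteifS// ?(midf_lt ab). Qed.

Lemma sup_norm_ge0 f : (0 <= sup_norm X f)%E.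
Proof. by apply: le_trans (le_sup_norm f itv_midpoint). Qed.

Lemma sup_norm_eq f g : (forall x, X x -> f x = g x) -> sup_norm X f = sup_norm X g.
Proof.
move=> fg; congr ereal_sup; apply/seteqP; split=> _ [x Xx <-]; exists x => //.
  by rewrite fg.
by rewrite fg.
Qed.

Lemma smooth_norm_ge0 f : (0 <= smooth_norm f)%E.
Proof. by rewrite adde_ge0// sume_ge0// => j _; exact: sup_norm_ge0. Qed.

Lemma smooth_normB f g : smooth f -> smooth g ->
  (smooth_norm (f \- g)%R <= smooth_norm f + smooth_norm g)%E.
Proof.
move=> sf sg; have DB := derive_on_nB sf sg.
rewrite /smooth_norm addeACA leeD//.
  rewrite /Ck_norm -big_split/=; apply: lee_sum => j _.
  apply: sup_norm_le => x Xx; rewrite DB// -1?ltnS//.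
  apply: (@le_trans _ _ (`|D j f x|%:E + `|D j g x|%:E)%E).
    by rewrite -EFinD lee_fin ler_normB.
  by rewrite leeD// le_sup_norm.
by rewrite (top_eq (g := D k f \- D k g))// => x Xx; rewrite DB.
Qed.

Lemma sup_norm_le_smooth f j : (j <= k)%N -> (sup_norm X (D j f) <= smooth_norm f)%E.
Proof.
move=> jk; rewrite /smooth_norm /Ck_norm (bigD1 (Ordinal (jk : (j < k.+1)%N)))//=.
rewrite -addeA leeDl// adde_ge0// sume_ge0// => i _; exact: sup_norm_ge0.
Qed.

Lemma top_norm_le_smooth f : (top_norm (D k f) <= smooth_norm f)%E.
Proof. by rewrite leeDr// sume_ge0// => i _; exact: sup_norm_ge0. Qed.

(** Derivatives up to order [k] converge uniformly at the rate [C * gamma ^+ n]. By [derive_on_lim]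
    each limit [v j.+1] is the derivative of [v j], so the [v j] are the derivatives of
    [lim_fun u]. *)
Lemma smooth_banach_like :
  banach_like (fun f => smooth f /\ (smooth_norm f < +oo)%E)
    (fine \o smooth_norm) (within X (globally [set: R])).
Proof.
have Sfin f : (smooth_norm f < +oo)%E -> smooth_norm f = (fine (smooth_norm f))%:E.
  by move=> Ef; rewrite fineK// ge0_fin_numE// smooth_norm_ge0.
have sub f g : smooth f /\ (smooth_norm f < +oo)%E -> smooth g /\ (smooth_norm g < +oo)%E ->
    smooth (f \- g) /\ (smooth_norm (f \- g)%R < +oo)%E.
  move=> [sf ff] [sg fg]; split; first exact: smoothB.
  by apply: le_lt_trans (smooth_normB sf sg) _; exact: lte_add_pinfty.
have deriv_eq f g : smooth f -> (forall x, X x -> f x = g x) ->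
    forall j, (j <= k)%N -> forall x, X x -> D j g x = D j f x.
  move=> [df _] fg; elim=> [_ x Xx|j IH jk x Xx]; first by rewrite /= fg.
  rewrite /derive_on_n !iterS; apply: derive_on_eq => // [|y Xy].
    exact: df.
  by rewrite -[LHS]IH// ltnW.
split.
- by move=> f; apply: fine_ge0; exact: smooth_norm_ge0.
- exact: sub.
- exists 1 => // f g Ff Fg; rewrite mul1r.
  suff : (smooth_norm (f \- g)%R <= smooth_norm f + smooth_norm g)%E.
    by rewrite (Sfin _ (sub _ _ Ff Fg).2) (Sfin _ Ff.2) (Sfin _ Fg.2) -EFinD lee_fin.
  exact: smooth_normB Ff.1 Fg.1.
- move=> f g [sf _] _ fg; suff E : smooth_norm f = smooth_norm g by rewrite !compE E.
  have fg' x : X x -> f x = g x by exact: fg x I.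
  have DE := deriv_eq f g sf fg'.
  rewrite /smooth_norm; congr (_ + _)%E; last by apply: top_eq => x Xx; rewrite DE.
  apply: eq_bigr => j _; apply: sup_norm_eq => x Xx.
  by rewrite DE// -ltnS.
- move=> f [sf ff] f0 x _ Xx.
  have S0 : smooth_norm f = 0%E by rewrite (Sfin _ ff) -[fine _]/((fine \o smooth_norm) f) f0.
  have := le_trans (le_sup_norm f Xx) (sup_norm_le_smooth f (leq0n k)).
  by rewrite S0 lee_fin normr_le0 => /eqP.
- move=> u C gamma g01 Fu Cu; have /andP[g0 g1] := g01.
  have EC n i : (smooth_norm (u (n + i)%N \- u n)%R <= (C * gamma ^+ n)%:E)%E.
    by rewrite (Sfin _ (sub _ _ (Fu (n + i)%N) (Fu n)).2) lee_fin; exact: Cu.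
  have DB n i := derive_on_nB (Fu (n + i)%N).1 (Fu n).1.
  have DC j n i x : (j <= k)%N -> X x ->
      `|D j (u (n + i)%N) x - D j (u n) x| <= C * gamma ^+ n.
    move=> jk Xx; rewrite -DB// -lee_fin; apply: le_trans (EC n i).
    exact: le_trans (le_sup_norm _ Xx) (sup_norm_le_smooth _ jk).
  pose v j := lim_fun (fun n => D j (u n)).
  have vP j x : (j <= k)%N -> X x -> D j (u n) x @[n --> \oo] --> v j x.
    move=> jk Xx; apply: lim_funP; apply: (@geometric_cauchy_cvg _ _ C gamma) => // n i.
    exact: DC.
  pose f := lim_fun u.
  have vD j x : (j < k)%N -> X x ->
      difference_quotient (v j) x y @[y --> within X x^'] --> v j.+1 x.
    move=> jk Xx.
    apply: (@derive_on_lim _ a b ab ca cb (fun n => D j (u n)) C gamma (v j) (v j.+1)) => //.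
    + by move=> n; have [[d _] _] := Fu n; exact: d.
    + by move=> n i y Xy; exact: (DC j.+1).
    + by move=> y Xy; apply: vP => //; exact: ltnW.
    + by move=> y Xy; exact: (vP j.+1).
  have dv j : (j < k)%N -> derivable_on X (v j).
    by move=> jk x Xx; apply/cvg_ex; eexists; exact: vD.
  have Df j : (j <= k)%N -> forall x, X x -> D j f x = v j x.
    elim: j => [//|j IH] jk x Xx.
    rewrite /derive_on_n iterS (derive_on_eq ab (dv j jk) (g := D j f))//.
      by apply: derive_on_unique => //; exact: vD.
    by move=> z Xz; rewrite IH// ltnW.
  have DfC j n x : (j <= k)%N -> X x -> `|D j f x - D j (u n) x| <= C * gamma ^+ n.
    move=> jk Xx; rewrite Df//.
    have c : `|D j (u (n + i)%N) x - D j (u n) x| @[i --> \oo] --> `|v j x - D j (u n) x|.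
      apply: cvg_norm; apply: cvgB; last exact: cvg_cst.
      have := vP j x jk Xx; rewrite -(cvg_shiftn n); apply: cvg_trans.
      by under eq_fun do rewrite addnC.
    rewrite -(cvg_lim _ c)//; apply: limr_le; first by apply/cvg_ex; eexists; exact: c.
    by apply: nearW => i; exact: DC.
  have small (e : R) : 0 < e -> exists n, C * gamma ^+ n <= e.
    move=> e0; have : C * gamma ^+ n @[n --> \oo] --> C * 0.
      by apply: cvgM; [exact: cvg_cst|apply: cvg_expr; rewrite ger0_norm].
    rewrite mulr0 => /cvgrPdist_le/(_ e e0)[n _ h]; exists n.
    have := h n (leqnn n); rewrite /= sub0r normrN; exact: le_trans (ler_norm _).
  have sf : smooth f.
    split=> [j jk|].
      apply: (derivable_on_eq _ (dv j jk)) => x Xx.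
      by rewrite Df// ltnW.
    apply: cvg_within_continuous => x Xx; apply/cvgrPdist_le => e e0.
    have [n Cn] := small _ (divr_gt0 e0 (ltr0n R 3)).
    have /within_continuous_cvg/(_ x Xx)/cvgrPdist_le := (Fu n).1.2.
    move=> /(_ _ (divr_gt0 e0 (ltr0n R 3))) cun.
    have Xy : \forall y \near within X (nbhs x), X y by exact: withinT.
    apply: filterS2 cun Xy => y cun Xy.
    rewrite (_ : D k f x - D k f y = (D k f x - D k (u n) x) +
      (D k (u n) x - D k (u n) y) - (D k f y - D k (u n) y)); last by ring.
    apply: le_trans (ler_normB _ _) _.
    apply: (@le_trans _ _ ((e / 3 + e / 3) + e / 3)); last by lra.
    apply: lerD; last exact: le_trans (DfC k n y (leqnn k) Xy) Cn.
    apply: le_trans (ler_normD _ _) _; apply: lerD => //.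
    exact: le_trans (DfC k n x (leqnn k) Xx) Cn.
  (* The factor k + 2 counts the k + 1 sup norms and the top seminorm, each at most
     [C * gamma ^+ n]. *)
  have Nf n : (smooth_norm (f \- u n)%R <= ((k.+2%:R * C) * gamma ^+ n)%:E)%E.
    have DBf := derive_on_nB sf (Fu n).1.
    rewrite -natr1 mulrDl mul1r mulrDl EFinD leeD//.
      rewrite /Ck_norm -mulrA mulr_natl -[k.+1 in leRHS]card_ord -sumr_const -sumEFin.
      apply: lee_sum => j _; apply: sup_norm_le => x Xx.
      have jk : (j <= k)%N by rewrite -ltnS.
      by rewrite DBf// lee_fin DfC.
    rewrite (top_eq (g := D k f \- D k (u n))); last by move=> x Xx; rewrite DBf.
    apply: (top_lim (u := fun i => D k (u (n + i)%N) \- D k (u n))) => [x Xx|i].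
      apply: cvgB; last exact: cvg_cst.
      rewrite Df//; have := vP k x (leqnn k) Xx; rewrite -(cvg_shiftn n).
      by apply: cvg_trans; under eq_fun do rewrite addnC.
    rewrite (top_eq (g := D k (u (n + i)%N \- u n))); last by move=> x Xx; rewrite DB.
    exact: le_trans (top_norm_le_smooth _) (EC n i).
  have Nfu n : smooth (f \- u n) /\ (smooth_norm (f \- u n)%R < +oo)%E.
    by split; [exact: smoothB (Fu n).1|rewrite (le_lt_trans (Nf n))// ltry].
  have Ff : smooth f /\ (smooth_norm f < +oo)%E.
    have -> : f = (f \- u 0%N) \- ((u 0%N \- u 0%N) \- u 0%N).
      by apply/funext => x /=; ring.
    exact: sub _ _ (Nfu 0%N) (sub _ _ (sub _ _ (Fu 0%N) (Fu 0%N)) (Fu 0%N)).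
  exists f; split=> //.
  + exists (k.+2%:R * C) => n.
    suff : (smooth_norm (f \- u n)%R <= ((k.+2%:R * C) * gamma ^+ n)%:E)%E.
      by rewrite (Sfin _ (Nfu n).2) lee_fin.
    exact: Nf.
  + by move=> x; exact: lim_funP.
  + by move=> x _ Xx; exact: (vP 0%N).
Qed.

End Smooth.

Section Holder.
Context {R : realType} (a b : R) (ab : a < b) (ca cb : bool) (alpha : R).
Local Notation X := ([set` Interval (BSide ca a) (BSide cb b)] : set R).
Implicit Types f g : R -> R.

Lemma holder_seminormP f (c : \bar R) : (holder_seminorm X alpha f <= c)%E <->
  forall x y, X x -> X y -> x != y ->
    ((`|f x - f y| / `|x - y| `^ alpha)%:E <= c)%E.
Proof.
split=> [h x y Xx Xy xy|h].
  by apply: le_trans h; apply: ereal_sup_ubound; exists (x, y).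
by apply: ge_ereal_sup => _ [[x y] [Xx Xy xy] <-]; exact: h.
Qed.

(** Two explicit distinct points of X keep the supremum from ranging over the empty set, where it
    would be -oo. *)
Lemma holder_seminorm_ge0 f : (0 <= holder_seminorm X alpha f)%E.
Proof.
have X1 : X ((a + b) / 2) by exact: itv_midpoint.
have ab' := ab.
have X2 : X ((3 * a + b) / 4) by rewrite /= in_itv/= !lteifS//; lra.
have neq : (a + b) / 2 != (3 * a + b) / 4 by rewrite gt_eqF//; lra.
have := (holder_seminormP f _).1 (lexx _) _ _ X1 X2 neq.
by apply: le_trans; rewrite lee_fin divr_ge0// powR_ge0.
Qed.

Lemma holder_seminorm_eq f g : (forall x, X x -> f x = g x) ->
  holder_seminorm X alpha f = holder_seminorm X alpha g.
Proof.
have le h1 h2 : (forall x, X x -> h1 x = h2 x) ->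
    (holder_seminorm X alpha h1 <= holder_seminorm X alpha h2)%E.
  move=> h12; apply/holder_seminormP => x y Xx Xy xy; rewrite !h12//.
  exact: (holder_seminormP h2 _).1.
move=> fg; apply/eqP; rewrite eq_le !le// => x Xx; by rewrite fg.
Qed.

Lemma holder_seminormB f g : (holder_seminorm X alpha (f \- g)%R <=
  holder_seminorm X alpha f + holder_seminorm X alpha g)%E.
Proof.
apply/holder_seminormP => x y Xx Xy xy.
apply: le_trans (leeD ((holder_seminormP f _).1 (lexx _) x y Xx Xy xy)
                      ((holder_seminormP g _).1 (lexx _) x y Xx Xy xy)).
rewrite -EFinD lee_fin -mulrDl ler_wpM2r ?invr_ge0 ?powR_ge0//=.
rewrite [X in `|X|](_ : _ = (f x - f y) - (g x - g y)); last by ring.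
exact: ler_normB.
Qed.

Lemma holder_seminorm_lim f (u : nat -> R -> R) (c : R) :
  (forall x, X x -> u n x @[n --> \oo] --> f x) ->
  (forall n, holder_seminorm X alpha (u n) <= c%:E)%E ->
  (holder_seminorm X alpha f <= c%:E)%E.
Proof.
move=> uf uc; apply/holder_seminormP => x y Xx Xy xy; rewrite lee_fin.
have h : `|u n x - u n y| / `|x - y| `^ alpha @[n --> \oo] -->
    `|f x - f y| / `|x - y| `^ alpha.
  apply: cvgM; last exact: cvg_cst.
  by apply: cvg_norm; apply: cvgB; exact: uf.
rewrite -(cvg_lim _ h)//; apply: limr_le; first by apply/cvg_ex; eexists; exact: h.
by apply: nearW => n; rewrite -lee_fin; exact: (holder_seminormP _ _).1.
Qed.

End Holder.

(** * The spaces of the theorem and the Clifford-valued fixed point *)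

Lemma space_banach_like (R : realType) (a b : R) (ab : a < b) (ca cb : bool)
    (F : function_space R) :
  let X := [set` Interval (BSide ca a) (BSide cb b)] in
  admissible F ->
  banach_like (in_space X F) (space_norm X F) (space_filter X F).
Proof.
move=> X; have mX : measurable X by exact: measurable_itv.
have iX : is_interval X by exact: interval_is_interval.
have fX : (lebesgue_measure X < +oo)%E by exact: bounded_itv_finite ab ca cb.
have gt0 (p : R) : 1 <= p -> 0 < p by exact: lt_le_trans ltr01.
case: F => [k|k alpha|p|s p|s p q|s p q].
- move=> _; pose top (f : R -> R) : \bar R := 0%E.
  have E : smooth_norm a b ca cb k top = Ck_norm X k.
    by apply/funext => f; rewrite /smooth_norm/= /top adde0.
  have := @smooth_banach_like R a b ab ca cb k top.
  rewrite E; apply=> //.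
  by move=> f g; rewrite /top adde0.
  move=> f u c _ h; exact: h 0%N.
- move=> _; apply: (@smooth_banach_like R a b ab ca cb k (holder_seminorm X alpha)).
  + exact: holder_seminorm_ge0.
  + by move=> f g; exact: holder_seminorm_eq.
  + exact: holder_seminormB.
  + by move=> f u c; exact: holder_seminorm_lim.
- move=> p1; apply: (lsc_banach_like mX p1 fX (Lp_norm_lsc mX (gt0 _ p1))).
  by move=> f; exact: lexx.
- move=> [_ p1]; exact: (@sobolev_banach_like R a b ab ca cb s p p1).
- move=> [_ p1 q1].
  apply: (lsc_banach_like mX p1 fX (besov_norm_lsc iX s (gt0 _ p1) (gt0 _ q1))) => f.
  by apply: leeDl; exact: poweR_ge0.
- move=> [_ p1 q1].
  apply: (lsc_banach_like mX p1 fX (triebel_lizorkin_norm_lsc iX s (gt0 _ p1) (gt0 _ q1))).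
  by move=> f; apply: leeDl; exact: Lnorm_ge0.
Qed.

(** The sum over [A] in the last equation is what [q i] becomes among Clifford-valued functions:
    [Tt] adds [q i] in every coordinate, not along the unit alone. *)
Theorem theorem4p1 (R : realType) (n : nat) (n_gt0 : (0 < n)%N)
    (a b : R) (ab : a < b) (ca cb : bool)
    (N : nat) (N_gt1 : (1 < N)%N) (L : 'I_N -> R -> R)
    (F : function_space R) (q s : 'I_N -> R -> R) (gamma : R) :
  let X := [set` Interval (BSide ca a) (BSide cb b)] in
  let T := RB_operator X L q s in
  let Tt := @clifford_operator R n T in
  admissible F ->
  (forall i, set_fun X X (L i)) ->
  (forall i, set_inj X (L i)) ->
  (forall i, exists2 k : R, 0 < k < 1 & k.-lipschitz_X (L i)) ->
  (forall i j, i != j -> (L i @` X) `&` (L j @` X) = set0) ->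
  X = \bigcup_i (L i @` X) ->
  (forall i, in_space X F (q i)) ->
  (forall i, exists M : R, forall x, X x -> `|s i x| <= M) ->
  (forall i f, in_space X F f -> in_space X F (s i \* f)) ->
  (forall f, in_space X F f -> in_space X F (T f)) ->
  contractive_on (in_space X F) (space_norm X F) T gamma ->
  [/\ forall f, in_cspace X F f -> in_cspace X F (Tt f),
      contractive_on (@in_cspace R n X F) (@cspace_norm R n X F) Tt gamma &
      exists psi : R -> clifford R n,
        [/\ in_cspace X F psi,
            eq_space X F (Tt psi) psi,
            forall phi, in_cspace X F phi -> eq_space X F (Tt phi) phi ->
              eq_space X F phi psi &
            forall i, for_space X F (fun x =>
              psi (L i x) =
              \sum_(A : {set 'I_n}) q i x *: blade A + s i x *: psi x)]].
Proof.
move=> X T Tt Fadm LX L_inj _ L_disj XL Fq _ _ TF T_contr.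
have XF := space_banach_like ab ca cb Fadm; rewrite -/X in XF.
have Tt_coord f A : ccoord (Tt f) A = T (ccoord f A).
  exact: ccoord_clifford_operator.
have TtF f : in_cspace X F f -> in_cspace X F (Tt f).
  by move=> Ff A; rewrite Tt_coord; apply: TF; exact: Ff.
have [gamma01 T_lip] := T_contr; have /andP[gamma0 _] := gamma01.
split; first exact: TtF.
  split; [exact: gamma01|move=> f g Ff Fg]; rewrite /cspace_norm.
  (* Moving [gamma] under the root as a square reduces the estimate to one inequality per
     coordinate. *)
  rewrite -[X in X * _](ger0_norm gamma0) -sqrtr_sqr -sqrtrM ?sqr_ge0//.
  rewrite ler_sqrt; last by rewrite mulr_ge0 ?sqr_ge0// sumr_ge0// => A _; rewrite sqr_ge0.
  rewrite mulr_sumr ler_sum// => A _; rewrite -exprMn.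
  rewrite ler_pXn2r// ?nnegrE ?mulr_ge0 ?(nrm_ge0 XF)//.
  have -> : ccoord (Tt f \- Tt g) A = T (ccoord f A) \- T (ccoord g A).
    by rewrite -!Tt_coord; apply/funext => x; rewrite /ccoord /= !ffunE.
  have -> : ccoord (f \- g) A = ccoord f A \- ccoord g A.
    by apply/funext => x; rewrite /ccoord /= !ffunE.
  exact: T_lip (Ff A) (Fg A).
(* Any member of the space can start the iteration; [q i0] is one at hand. *)
pose i0 : 'I_N := Ordinal (ltnW N_gt1).
have [psi [Fpsi Tpsi cvgpsi cpsi]] := contraction_fixed_point XF TF T_contr (Fq i0).
(* Every coordinate is the same [psi], since each coordinate of [Tt] is the operator [T] with its
   single fixed point. *)
exists (fun x => [ffun=> psi x]); split.
- move=> A; suff -> : ccoord (fun x => [ffun=> psi x]) A = psi by [].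
  by apply/funext => x; rewrite /ccoord ffunE.
- rewrite /eq_space for_spaceE; apply: filterS Tpsi => x Tpsix.
  apply/ffunP => A; rewrite -[LHS]/(ccoord (Tt _) A x) Tt_coord ffunE -Tpsix.
  by congr (T _ x); apply/funext => y; rewrite /ccoord ffunE.
- move=> phi Fphi; rewrite /eq_space !for_spaceE => Tphi.
  have : \forall x \near space_filter X F, forall A, ccoord phi A x = psi x.
    apply: filter_forall => A.
    apply: (contraction_fixed_point_unique XF TF T_contr (Fphi A) Fpsi) => //.
    by apply: filterS Tphi => x; rewrite -Tt_coord /ccoord => ->.
  by apply: filterS => x h; apply/ffunP => A; rewrite ffunE; exact: h.
- move=> i; rewrite for_spaceE.
  apply: filterS2 (space_filterT X F) cpsi => x Xx psix.
  apply/ffunP => A; rewrite [in RHS]ffunE clifford_coord cscaleE !ffunE.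
  (* The formula for [T] at [L i x] is exact at every stage, so the iterates converge there as soon
     as they converge at [x]. *)
  have h : iter n T (q i0) (L i x) @[n --> \oo] --> q i x + s i x * psi x.
    rewrite -cvg_shiftS.
    have -> : (fun k => iter k.+1 T (q i0) (L i x)) =
        (fun k => q i x + s i x * iter k T (q i0) x).
      by apply/funext => k; exact: RB_operatorE.
    by apply: cvgD; [exact: cvg_cst|apply: cvgM => //; exact: cvg_cst].
  (* [cvgpsi] identifies [psi (L i x)] with this limit even when [L i x] lies in the exceptional set
     where [T psi = psi] may fail. *)
  by apply: (cvg_unique _ (cvgpsi _ _) h) => //; apply/cvg_ex; eexists; exact: h.
Qed.
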